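(* Let $G$ be a connected complex semi-simple Lie group with Lie algebra $\mathfrak{g}$, let $q\in\mathbb{C}\setminus\{0\}$ be not a root of unity, let $\mathcal{A}=\mathbb{C}_q[G]$ be the coordinate algebra of the standard quantum group associated with $G$, and identify $\mathcal{U}(\mathcal{A})$ with $U_q(\mathfrak{g})$. Then the canonical embedding of algebras $$\iota:\mathcal{U}(\mathcal{A}\bowtie\mathcal{A})\to U_q(\mathfrak{g})\otimes U_q(\mathfrak{g}),\qquad \iota(f)=\langle f_{(1)},(\cdot\otimes1)\rangle\otimes\langle f_{(2)},(1\otimes\cdot)\rangle$$ is not surjective.
   Context: **Quantum group data.** $\{\alpha_i\}_{i=1,\dots,N}$ are the simple roots of $\mathfrak{g}$, $\mathbf{Q}=\sum_i\mathbb{Z}\alpha_i$ is the root lattice, and $\mathbf{L}\supseteq\mathbf{Q}$ is the character group of a maximal torus of $G$, viewed as a sublattice of the weight lattice. $\langle\cdot,\cdot\rangle$ is the scalar product on $\mathbf{L}$ with $\langle\alpha_i,\alpha_j\rangle=d_ia_{ij}$, where $(a_{ij})$ is the Cartan matrix and $(d_ia_{ij})$ the symmetrized Cartan matrix. Put $q_i=q^{d_i}$. A root of $q$ is fixed so that $q^{\langle\lambda,\mu\rangle}$ makes sense (multiplicatively) for all $\lambda,\mu\in\mathbf{L}$. $U_q(\mathfrak{g})$ is the Hopf algebra over $\mathbb{C}$ with generators $K_\lambda$ ($\lambda\in\mathbf{L}$), $E_i,F_i$ ($1\le i\le N$) and relations $K_0=1$, $K_\lambda K_\mu=K_{\lambda+\mu}$,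 $K_\lambda E_iK_\lambda^{-1}=q^{\langle\lambda,\alpha_i\rangle}E_i$, $K_\lambda F_iK_\lambda^{-1}=q^{-\langle\lambda,\alpha_i\rangle}F_i$, $[E_i,F_j]=\delta_{ij}\frac{K_i-K_i^{-1}}{q_i-q_i^{-1}}$ with $K_i:=K_{\alpha_i}$, and the $q$-Serre relations $\sum_{r=0}^{1-a_{ij}}(-1)^r\binom{1-a_{ij}}{r}_{q_i}E_i^{1-a_{ij}-r}E_jE_i^r=0$ for $i\ne j$, and the same with $F$ instead of $E$ (symmetric $q_i$-binomial coefficients). The coproduct is $\Delta(K_\lambda)=K_\lambda\otimes K_\lambda$, $\Delta(E_i)=E_i\otimes K_i+1\otimes E_i$, $\Delta(F_i)=F_i\otimes1+K_i^{-1}\otimes F_i$; the counit satisfies $\varepsilon(K_\lambda)=1$, $\varepsilon(E_i)=\varepsilon(F_i)=0$; the antipode satisfies $S(K_\lambda)=K_\lambda^{-1}$, $S(E_i)=-E_iK_i^{-1}$, $S(F_i)=-K_iF_i$. $U_q(\mathfrak{n}_+)$, $U_q(\mathfrak{n}_-)$ are the subalgebras generated by the $E_i$, resp. the $F_i$, and $U_q^\lambda(\mathfrak{n}_\pm)=\{f\in U_q(\mathfrak{n}_\pm): K_\mu fK_\mu^{-1}=q^{\langle\lambda,\mu\rangle}f\ \forall\mu\in\mathbf{L}\}$. $\mathbb{C}_q[G]$ is the Hopf subalgebra of the Hopf dual $U_q(\mathfrak{g})^\circ$ spanned by the matrix coefficients $c_{u,v}(f)=u(fv)$, where $v$ is a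 vector in the irreducible representation $V_\lambda$ of $U_q(\mathfrak{g})$ with highest weight $\lambda\in\mathbf{L}$ dominant ($K_\mu$ acts on weight vectors of weight $\nu$ by $q^{\langle\mu,\nu\rangle}$), and $u\in V_\lambda^*$. The universal r-form $r$ on $\mathbb{C}_q[G]$ is $r(c_{u,v}\otimes c_{u',v'})=(u\otimes u')(R(v\otimes v'))$, where on a tensor product of two such representations $R=D\circ\Theta$, $D$ acts on the tensor product of the weight spaces of weights $\nu,\nu'$ by $q^{\langle\nu,\nu'\rangle}$, and $\Theta=\sum_\gamma\Theta_\gamma$ ($\gamma$ running over $\sum_i\mathbb{N}_0\alpha_i$) with $\Theta_0=1\otimes1$, $\Theta_\gamma\in U_q^\gamma(\mathfrak{n}_+)\otimes U_q^{-\gamma}(\mathfrak{n}_-)$ is the unique family such that $R\,\Delta(f)=\Delta^{\mathrm{op}}(f)\,R$ for all $f\in U_q(\mathfrak{g})$. **FRT-dual.** For a coquasitriangular Hopf algebra $\mathcal{A}$ with universal r-form $r$ (convention: $r(ab\otimes c)=r(a\otimes c_{(1)})r(b\otimes c_{(2)})$, $r(a\otimes bc)=r(a_{(1)}\otimes c)r(a_{(2)}\otimes b)$, $r(a_{(1)}\otimes b_{(1)})a_{(2)}b_{(2)}=b_{(1)}a_{(1)}r(a_{(2)}\otimes b_{(2)})$), with convolution inverse $\bar r$, the l-functionals are $l^+(a)=r(\cdot\otimes a)$, $l^-(a)=\bar r(a\otimes\cdot)$, $a\in\mathcal{A}$. The FRT-dual $\mathcal{U}(\mathcal{A})$ is the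 Hopf subalgebra of the Hopf dual $\mathcal{A}^\circ$ generated by all $l^\pm(a)$. For $\mathcal{A}=\mathbb{C}_q[G]$, $\mathcal{U}(\mathcal{A})$ is identified with $U_q(\mathfrak{g})$, where $f\in U_q(\mathfrak{g})$ is regarded as the functional $c\mapsto c(f)$. **Quantum double.** $\mathcal{A}\bowtie\mathcal{A}$ is the tensor product coalgebra $\mathcal{A}\otimes\mathcal{A}$ with product $(a\otimes b)(c\otimes d)=(ac_{(2)}\otimes b_{(2)}d)\,\bar r(b_{(1)}\otimes c_{(1)})\,r(b_{(3)}\otimes c_{(3)})$ and antipode $S(a\otimes b)=(1\otimes S(b))(S(a)\otimes1)$. It is coquasitriangular with universal r-form $\hat r((a\otimes b)\otimes(c\otimes d))=\bar r(c_{(1)}d_{(1)}\otimes a)\,r(b\otimes c_{(2)}d_{(2)})$, and $\mathcal{U}(\mathcal{A}\bowtie\mathcal{A})$ is the FRT-dual with respect to $\hat r$. **The map $\iota$.** For $f\in\mathcal{U}(\mathcal{A}\bowtie\mathcal{A})$ the functionals $a\mapsto\langle f_{(1)},a\otimes1\rangle$ and $a\mapsto\langle f_{(2)},1\otimes a\rangle$ define an element $\iota(f)\in\mathcal{A}^\circ\otimes\mathcal{A}^\circ$; it is known that $\iota$ is an injective algebra homomorphism whose image is contained in $\mathcal{U}(\mathcal{A})\otimes\mathcal{U}(\mathcal{A})=U_q(\mathfrak{g})\otimes U_q(\mathfrak{g})$. *)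

(* Defs.v *)
From HB Require Import structures.
From mathcomp Require Import all_boot all_order all_algebra.
From mathcomp Require Import sesquilinear generic_quotient.
From mathcomp Require Import boolp classical_sets functions fsbigop reals complex.

Set Implicit Arguments.
Unset Strict Implicit.
Unset Printing Implicit Defensive.

Import GRing.Theory Num.Theory.

Local Open Scope classical_set_scope.
Local Open Scope quotient_scope.
Local Open Scope ring_scope.

(* Tensor products of arbitrary (infinite-dimensional) vector spaces.  An
   element is a class of finite formal sums of pairs, two formal sums being
   identified when no bilinear map tells them apart. *)
Section Tensor.
Variables (k : fieldType) (V W : lmodType k).

Definition formal_eq (s t : seq (V * W)) : bool :=
  `[< forall (X : lmodType k) (f : {bilinear V -> W -> X}),
      \sum_(p <- s) f p.1 p.2 = \sum_(p <- t) f p.1 p.2 >].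

Lemma formal_eqP s t : reflect (forall (X : lmodType k)
  (f : {bilinear V -> W -> X}),
    \sum_(p <- s) f p.1 p.2 = \sum_(p <- t) f p.1 p.2) (formal_eq s t).
Proof. exact: asboolP. Qed.

Lemma formal_eq_refl : reflexive formal_eq.
Proof. by move=> s; apply/formal_eqP. Qed.

Lemma formal_eq_sym : symmetric formal_eq.
Proof. by move=> s t; apply/formal_eqP/formal_eqP => h X f; rewrite h. Qed.

Lemma formal_eq_trans : transitive formal_eq.
Proof.
move=> t s u /formal_eqP h1 /formal_eqP h2.
by apply/formal_eqP => X f; rewrite h1 h2.
Qed.

Canonical formal_equiv :=
  EquivRel formal_eq formal_eq_refl formal_eq_sym formal_eq_trans.

Definition tensor : Type := {eq_quot formal_equiv}.
HB.instance Definition _ := Choice.on tensor.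
HB.instance Definition _ := Quotient.on tensor.
HB.instance Definition _ := EqQuotient.on tensor.

Definition tens (v : V) (w : W) : tensor := \pi_tensor [:: (v, w)].

(* [tensor_sum f x] is the sum of the f v w over a decomposition of x into pure
   tensors v (x) w; for f bilinear it does not depend on the decomposition
   (lemma [tensor_sum_pi]). *)
Definition tensor_sum (X : nmodType) (f : V -> W -> X) (x : tensor) : X :=
  \sum_(p <- repr x) f p.1 p.2.

Lemma tensor_sum_pi (X : lmodType k) (f : {bilinear V -> W -> X}) s :
  tensor_sum f (\pi_tensor s) = \sum_(p <- s) f p.1 p.2.
Proof.
rewrite /tensor_sum.
have : formal_eq (repr (\pi_tensor s)) s.
  by have /eqquotP := reprK (\pi_tensor s).
by move=> /formal_eqP/(_ _ f).
Qed.

Lemma tensor_eqP (x y : tensor) :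
  (forall (X : lmodType k) (f : {bilinear V -> W -> X}),
      tensor_sum f x = tensor_sum f y) -> x = y.
Proof.
move=> h; rewrite -(reprK x) -(reprK y); apply/eqquotP/formal_eqP => X f.
exact: h.
Qed.

Let t0 : tensor := \pi_tensor [::].
Let tadd (x y : tensor) : tensor := \pi_tensor (repr x ++ repr y).
Let topp (x : tensor) : tensor :=
  \pi_tensor [seq (- p.1, p.2) | p <- repr x].
Let tscale (c : k) (x : tensor) : tensor :=
  \pi_tensor [seq (c *: p.1, p.2) | p <- repr x].

Let sum0 (X : lmodType k) (f : {bilinear V -> W -> X}) : tensor_sum f t0 = 0.
Proof. by rewrite tensor_sum_pi big_nil. Qed.

Let sumD (X : lmodType k) (f : {bilinear V -> W -> X}) x y :
  tensor_sum f (tadd x y) = tensor_sum f x + tensor_sum f y.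
Proof. by rewrite tensor_sum_pi big_cat. Qed.

Let sumN (X : lmodType k) (f : {bilinear V -> W -> X}) x :
  tensor_sum f (topp x) = - tensor_sum f x.
Proof.
rewrite tensor_sum_pi big_map /tensor_sum -sumrN.
by apply: eq_bigr => p _; rewrite linearNl.
Qed.

Let sumZ (X : lmodType k) (f : {bilinear V -> W -> X}) c x :
  tensor_sum f (tscale c x) = c *: tensor_sum f x.
Proof.
rewrite tensor_sum_pi big_map /tensor_sum scaler_sumr.
by apply: eq_bigr => p _; rewrite linearZl_LR.
Qed.

Fact tensor_addA : associative tadd.
Proof. by move=> x y z; apply: tensor_eqP => X f; rewrite !sumD addrA. Qed.
Fact tensor_addC : commutative tadd.
Proof. by move=> x y; apply: tensor_eqP => X f; rewrite !sumD addrC. Qed.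
Fact tensor_add0 : left_id t0 tadd.
Proof. by move=> x; apply: tensor_eqP => X f; rewrite sumD sum0 add0r. Qed.
Fact tensor_addN : left_inverse t0 topp tadd.
Proof.
by move=> x; apply: tensor_eqP => X f; rewrite sumD sumN sum0 addNr.
Qed.

HB.instance Definition _ := GRing.isZmodule.Build tensor
  tensor_addA tensor_addC tensor_add0 tensor_addN.

Fact tensor_scaleA a b (x : tensor) : tscale a (tscale b x) = tscale (a * b) x.
Proof. by apply: tensor_eqP => X f; rewrite !sumZ scalerA. Qed.
Fact tensor_scale1 : left_id 1 tscale.
Proof. by move=> x; apply: tensor_eqP => X f; rewrite sumZ scale1r. Qed.
Fact tensor_scaleDr : right_distributive tscale +%R.
Proof.
by move=> a x y; apply: tensor_eqP => X f;
  rewrite sumZ sumD scalerDr sumD !sumZ.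
Qed.
Fact tensor_scaleDl x : {morph tscale^~ x : a b / a + b}.
Proof.
by move=> a b; apply: tensor_eqP => X f; rewrite sumZ sumD !sumZ scalerDl.
Qed.

HB.instance Definition _ := GRing.Zmodule_isLmodule.Build k tensor
  tensor_scaleA tensor_scale1 tensor_scaleDr tensor_scaleDl.

Lemma tensor_sumE (X : lmodType k) (f : {bilinear V -> W -> X}) v w :
  tensor_sum f (tens v w) = f v w.
Proof. by rewrite tensor_sum_pi big_seq1. Qed.

Fact tens_is_bilinear : bilinear_for *:%R *:%R tens.
Proof.
split=> [w c v v'|v c w w']; apply: tensor_eqP => X f.
  by rewrite sumD sumZ !tensor_sumE linearPl.
by rewrite sumD sumZ !tensor_sumE linearPr.
Qed.

HB.instance Definition _ := bilinear_isBilinear.Build k V W tensor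
  ( *:%R) ( *:%R) tens tens_is_bilinear.

End Tensor.

Notation "V ⊗ W" := (tensor V W)
  (at level 40, left associativity) : type_scope.
Notation "v ⊗ w" := (tens v w)
  (at level 40, left associativity) : ring_scope.
Notation "\tsum_ ( v , w <- x ) F" := (tensor_sum (fun v w => F) x)
  (at level 41, v name, w name, x at level 50, F at level 41,
   format "'[' \tsum_ ( v ,  w  <-  x ) '/  '  F ']'") : ring_scope.

Section Subspaces.
Variables (k : fieldType) (V : lmodType k).

Definition is_subspace (P : set V) : Prop :=
  P 0 /\ forall c x y, P x -> P y -> P (c *: x + y).

Definition lin_span (S : set V) : set V := smallest is_subspace S.

End Subspaces.

Definition is_subalgebra (k : fieldType) (B : algType k) (P : set B) : Prop :=
  [/\ is_subspace P, P 1 & forall x y, P x -> P y -> P (x * y)].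

Section Hopf.
Variable k : fieldType.

Record hopf_data := HopfData {
  hopf_car :> lmodType k;
  hmul : hopf_car -> hopf_car -> hopf_car;
  hone : hopf_car;
  hcomul : hopf_car -> (hopf_car ⊗ hopf_car)%type;
  hcounit : hopf_car -> k;
  hantip : hopf_car -> hopf_car
}.

Record is_hopf (H : hopf_data) : Prop := IsHopf {
  hmul_linr : forall x : H, linear (hmul x);
  hmul_linl : forall y : H, linear (fun x => hmul x y);
  hmulA : associative (@hmul H);
  hmul1l : left_id (hone H) (@hmul H);
  hmul1r : right_id (hone H) (@hmul H);
  hcomul_lin : linear (@hcomul H);
  hcounit_lin : scalar (@hcounit H);
  hantip_lin : linear (@hantip H);
  hcomulA : forall x : H,
    \tsum_(a, b <- hcomul x) (a ⊗ hcomul b)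
    = \tsum_(a, b <- hcomul x) \tsum_(a1, a2 <- hcomul a) (a1 ⊗ (a2 ⊗ b));
  hcounitl : forall x : H, \tsum_(a, b <- hcomul x) (hcounit a *: b) = x;
  hcounitr : forall x : H, \tsum_(a, b <- hcomul x) (hcounit b *: a) = x;
  hcomulM : forall x y : H, hcomul (hmul x y) =
    \tsum_(a, b <- hcomul x) \tsum_(c, d <- hcomul y) (hmul a c ⊗ hmul b d);
  hcomul1 : hcomul (hone H) = hone H ⊗ hone H;
  hcounitM : forall x y : H, hcounit (hmul x y) = hcounit x * hcounit y;
  hcounit1 : hcounit (hone H) = 1;
  hantipl : forall x : H,
    \tsum_(a, b <- hcomul x) hmul (hantip a) b = hcounit x *: hone H;
  hantipr : forall x : H,
    \tsum_(a, b <- hcomul x) hmul a (hantip b) = hcounit x *: hone H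
}.

Definition bilinear_form (V : lmodType k) (r : V -> V -> k) : Prop :=
  (forall x, scalar (r x)) /\ (forall y, scalar (fun x => r x y)).

Section Dual.
Variable H : hopf_data.

Definition hopf_dual : set (H -> k^o) := [set f | scalar (f : H -> k) /\
  exists2 s : seq ((H -> k^o) * (H -> k^o)),
    (forall p, p \in s -> scalar (p.1 : H -> k) /\ scalar (p.2 : H -> k)) &
    forall a b, f (hmul a b) = \sum_(p <- s) (p.1 a * p.2 b : k)].

(* For f in the Hopf dual, the unique x = f_(1) (x) f_(2) with
   f (a b) = f_(1)(a) f_(2)(b). *)
Definition dual_comul (f : H -> k^o) : ((H -> k^o) ⊗ (H -> k^o))%type :=
  xget 0 [set x : ((H -> k^o) ⊗ (H -> k^o))%type |
    forall a b, f (hmul a b) =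
      tensor_sum (fun g h : H -> k^o => (g a * h b : k)) x].

Definition is_hopf_subalgebra (P : set (H -> k^o)) : Prop :=
  [/\ P `<=` hopf_dual /\ is_subspace P,
      P (@hcounit H),
      forall f g, P f -> P g ->
        P (fun x => \tsum_(a, b <- hcomul x) (f a * g b : k)),
      forall f, P f -> P (fun x => f (hantip x)) &
      forall f, P f -> exists2 s : seq ((H -> k^o) * (H -> k^o)),
        (forall p, p \in s -> P p.1 /\ P p.2) &
        forall a b, f (hmul a b) = \sum_(p <- s) (p.1 a * p.2 b : k)].

Definition convolution (r r' : H -> H -> k) (a b : H) : k :=
  \tsum_(a1, a2 <- hcomul a) \tsum_(b1, b2 <- hcomul b) (r a1 b1 * r' a2 b2).

Definition is_conv_inverse (r r' : H -> H -> k) : Prop :=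
  forall a b, convolution r r' a b = hcounit a * hcounit b /\
              convolution r' r a b = hcounit a * hcounit b.

Definition conv_inv (r : H -> H -> k) : H -> H -> k :=
  xget (fun _ _ => 0) [set r' | bilinear_form r' /\ is_conv_inverse r r'].

Definition lplus (r : H -> H -> k) (a : H) : H -> k^o := fun x => r x a.
Definition lminus (r : H -> H -> k) (a : H) : H -> k^o :=
  fun x => conv_inv r a x.

Definition FRT_dual (r : H -> H -> k) : set (H -> k^o) :=
  smallest is_hopf_subalgebra (range (lplus r) `|` range (lminus r)).

End Dual.

Section Double.
Variables (A : hopf_data) (r : A -> A -> k).

Local Notation rb := (conv_inv r).

Definition qdouble_mul (x y : (A ⊗ A)%type) : (A ⊗ A)%type :=
  \tsum_(a, b <- x) \tsum_(c, d <- y)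
    \tsum_(b1, b' <- hcomul b) \tsum_(b2, b3 <- hcomul b')
      \tsum_(c1, c' <- hcomul c) \tsum_(c2, c3 <- hcomul c')
        (rb b1 c1 * r b3 c3) *: (hmul a c2 ⊗ hmul b2 d).

Definition qdouble_comul (x : (A ⊗ A)%type) : ((A ⊗ A) ⊗ (A ⊗ A))%type :=
  \tsum_(a, b <- x) \tsum_(a1, a2 <- hcomul a) \tsum_(b1, b2 <- hcomul b)
    ((a1 ⊗ b1) ⊗ (a2 ⊗ b2)).

Definition qdouble_counit (x : (A ⊗ A)%type) : k :=
  \tsum_(a, b <- x) (hcounit a * hcounit b).

Definition qdouble_antip (x : (A ⊗ A)%type) : (A ⊗ A)%type :=
  \tsum_(a, b <- x)
    qdouble_mul (hone A ⊗ hantip b) (hantip a ⊗ hone A).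

Definition quantum_double : hopf_data :=
  @HopfData (A ⊗ A)%type qdouble_mul (hone A ⊗ hone A)
    qdouble_comul qdouble_counit qdouble_antip.

Definition qdouble_rform (x y : quantum_double) : k :=
  \tsum_(a, b <- x : (A ⊗ A)%type) \tsum_(c, d <- y : (A ⊗ A)%type)
    \tsum_(c1, c2 <- hcomul c) \tsum_(d1, d2 <- hcomul d)
      (rb (hmul c1 d1) a * r b (hmul c2 d2)).

Definition qdouble_iota (f : quantum_double -> k^o) :
    ((A -> k^o) ⊗ (A -> k^o))%type :=
  \tsum_(f1, f2 <- dual_comul f)
    ((fun a : A => f1 (a ⊗ hone A)) ⊗ (fun a : A => f2 (hone A ⊗ a))).

End Double.

End Hopf.

Arguments qdouble_rform [k A] r x y.

(* Connected complex semisimple Lie groups, encoded by their classification: a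
   finite-type Cartan matrix with a symmetrization, and the character lattice of
   a maximal torus, lying between the root lattice and the weight lattice.
   The symmetrizing integers d_i are any positive ones making d_i a_ij symmetric.
   Elements of Q (x) QQ are rational row vectors of coordinates with respect to
   the simple roots. *)
Section RootDatum.
Variables (N : nat) (a : 'M[int]_N) (d : 'I_N -> nat).

Definition simple_root (i : 'I_N) : 'rV[rat]_N := delta_mx 0 i.

Definition weight_form (x y : 'rV[rat]_N) : rat :=
  \sum_i \sum_j x 0 i * y 0 j * ((d i)%:R * (a i j)%:~R).

End RootDatum.

Record semisimple_datum := SemisimpleDatum {
  rk : nat;
  cartan : 'M[int]_rk;
  symd : 'I_rk -> nat;
  lattice : set 'rV[rat]_rk;
  rk_gt0 : (0 < rk)%N;
  cartan_diag : forall i, cartan i i = 2;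
  cartan_offdiag : forall i j, i != j -> cartan i j <= 0;
  symd_gt0 : forall i, (0 < symd i)%N;
  cartan_sym : forall i j,
    (symd i)%:Z * cartan i j = (symd j)%:Z * cartan j i;
  cartan_posdef : forall x, x != 0 -> 0 < weight_form cartan symd x x;
  lattice_root : forall i, lattice (simple_root i);
  lattice_sub : forall x y, lattice x -> lattice y -> lattice (x - y);
  (* <x, alpha_i> = d_i <x, alpha_i^vee> *)
  lattice_weight : forall x, lattice x -> forall i, exists z : int,
    weight_form cartan symd x (simple_root i) = (symd i)%:R * z%:~R
}.

Section QuantumGroup.
Variables (k : fieldType) (G : semisimple_datum) (q : k).

Notation N := (rk G).
Notation weight := 'rV[rat]_(rk G).
Notation L := (lattice (s := G)).
Notation pairing := (weight_form (cartan G) (symd (s := G))).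
Notation alpha := (@simple_root (rk G)).

Definition dominant (la : weight) : Prop :=
  L la /\ forall i, 0 <= pairing la (alpha i).

Record root_of_q := RootOfQ {
  qden : nat;
  qrt : k;
  qden_gt0 : (0 < qden)%N;
  qden_int : forall x y, L x -> L y -> qden%:R * pairing x y \is a Num.int;
  qrtE : qrt ^+ qden = q
}.

Variable s : root_of_q.

(* q^x for x in (1/qden) Z *)
Definition qpow (x : rat) : k := qrt s ^ numq ((qden s)%:R * x).

Definition q_int (p : k) (n : nat) : k := (p ^+ n - p ^- n) / (p - p^-1).
Definition q_fact (p : k) (n : nat) : k := \prod_(1 <= j < n.+1) q_int p j.
Definition q_bin (p : k) (n r : nat) : k :=
  q_fact p n / (q_fact p r * q_fact p (n - r)).

Definition qi (i : 'I_N) : k := q ^+ symd i.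

Definition serre_lhs (B : algType k) (X : 'I_N -> B) (i j : 'I_N) : B :=
  let n := `|1 - cartan G i j|%N in
  \sum_(0 <= r < n.+1)
    ((-1) ^+ r * q_bin (qi i) n r) *: (X i ^+ (n - r) * X j * X i ^+ r).

(* Only the values of Kf on L matter. *)
Record uq_relations (B : algType k) (Kf : weight -> B) (E F : 'I_N -> B) :
    Prop := UqRelations {
  uq_K0 : Kf 0 = 1;
  uq_KD : forall la mu, L la -> L mu -> Kf (la + mu) = Kf la * Kf mu;
  uq_KE : forall la i, L la ->
    Kf la * E i * Kf (- la) = qpow (pairing la (alpha i)) *: E i;
  uq_KF : forall la i, L la ->
    Kf la * F i * Kf (- la) = qpow (- pairing la (alpha i)) *: F i;
  uq_EF : forall i j, E i * F j - F j * E i =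
    if i == j then (qi i - (qi i)^-1)^-1 *: (Kf (alpha i) - Kf (- alpha i))
    else 0;
  uq_serreE : forall i j, i != j -> serre_lhs E i j = 0;
  uq_serreF : forall i j, i != j -> serre_lhs F i j = 0
}.

(* The presentation is expressed by its universal property; [Kf], [E], [F] are
   the generators. *)
Record quantum_env := QuantumEnv {
  qe_alg :> algType k;
  qe_comul : qe_alg -> (qe_alg ⊗ qe_alg)%type;
  qe_counit : qe_alg -> k;
  qe_antip : qe_alg -> qe_alg;
  Kf : weight -> qe_alg;
  Ef : 'I_N -> qe_alg;
  Ff : 'I_N -> qe_alg;
  qe_rel : uq_relations Kf Ef Ff;
  qe_univ : forall (B : algType k) (K' : weight -> B) (E' F' : 'I_N -> B),
    uq_relations K' E' F' -> exists phi : {lrmorphism qe_alg -> B},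
      [/\ forall la, L la -> phi (Kf la) = K' la,
          forall i, phi (Ef i) = E' i,
          forall i, phi (Ff i) = F' i &
          forall psi : {lrmorphism qe_alg -> B},
            (forall la, L la -> psi (Kf la) = K' la) ->
            (forall i, psi (Ef i) = E' i) -> (forall i, psi (Ff i) = F' i) ->
            psi =1 phi];
  qe_hopf : is_hopf (@HopfData k qe_alg (fun x y => x * y) 1
                       qe_comul qe_counit qe_antip);
  qe_comulK : forall la, L la -> qe_comul (Kf la) = Kf la ⊗ Kf la;
  qe_comulE : forall i,
    qe_comul (Ef i) = Ef i ⊗ Kf (alpha i) + 1 ⊗ Ef i;
  qe_comulF : forall i,
    qe_comul (Ff i) = Ff i ⊗ 1 + Kf (- alpha i) ⊗ Ff i;
  qe_counitK : forall la, L la -> qe_counit (Kf la) = 1;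
  qe_counitE : forall i, qe_counit (Ef i) = 0;
  qe_counitF : forall i, qe_counit (Ff i) = 0;
  qe_antipK : forall la, L la -> qe_antip (Kf la) = Kf (- la);
  qe_antipE : forall i, qe_antip (Ef i) = - (Ef i * Kf (- alpha i));
  qe_antipF : forall i, qe_antip (Ff i) = - (Kf (alpha i) * Ff i)
}.

Variable U : quantum_env.

Definition nplus : set U := smallest (@is_subalgebra k U) (range (@Ef U)).
Definition nminus : set U := smallest (@is_subalgebra k U) (range (@Ff U)).

Definition weight_part (P : set U) (la : weight) : set U :=
  [set f | P f /\ forall mu, L mu ->
    Kf U mu * f * Kf U (- mu) = qpow (pairing la mu) *: f].

Record uq_module := UqModule {
  um_car :> lmodType k;
  um_act : U -> um_car -> um_car;
  um_linl : forall v, linear (fun f => um_act f v);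
  um_linr : forall f, linear (um_act f);
  um_act1 : forall v, um_act 1 v = v;
  um_actM : forall f g v, um_act (f * g) v = um_act f (um_act g v)
}.

Definition weight_vector (V : uq_module) (nu : weight) (v : V) : Prop :=
  forall mu, L mu -> um_act (Kf U mu) v = qpow (pairing mu nu) *: v.

Definition irreducible (V : uq_module) : Prop :=
  (exists v : V, v != 0) /\
  forall P : set V, is_subspace P ->
    (forall f v, P v -> P (um_act f v)) -> P = [set 0] \/ P = [set: V].

(* V is (a model of) the irreducible module V_la. *)
Definition irr_highest_weight (V : uq_module) (la : weight) : Prop :=
  irreducible V /\ exists v : V,
    [/\ v != 0, forall i, um_act (Ef U i) v = 0 & weight_vector la v].

Definition type_L (V : uq_module) : Prop :=
  exists2 la, dominant la & irr_highest_weight V la.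

Definition matrix_coeff (V : uq_module) (u : V -> k) (v : V) : U -> k^o :=
  fun f => u (um_act f v).

Definition matrix_coeffs : set (U -> k^o) :=
  [set c | exists (V : uq_module) (u : V -> k) (v : V),
    [/\ type_L V, scalar u & c = matrix_coeff u v]].

(* C_q[G], identified with a space of functionals on U by the injection
   [qc_ev]; its Hopf structure is the one of the Hopf dual of U. *)
Record quantum_coord := QuantumCoord {
  qc_hopf :> hopf_data k;
  qc_ev : qc_hopf -> U -> k;
  qc_is_hopf : is_hopf qc_hopf;
  qc_ev_linl : forall f, scalar (fun c => qc_ev c f);
  qc_ev_inj : forall c c', qc_ev c =1 qc_ev c' -> c = c';
  qc_ev_image : range (qc_ev : qc_hopf -> U -> k^o) = lin_span matrix_coeffs;
  qc_evM : forall c c' f, qc_ev (hmul c c') f =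
    \tsum_(f1, f2 <- qe_comul f) (qc_ev c f1 * qc_ev c' f2);
  qc_ev1 : forall f, qc_ev (hone qc_hopf) f = qe_counit f;
  qc_ev_comul : forall c f g,
    \tsum_(c1, c2 <- hcomul c) (qc_ev c1 f * qc_ev c2 g) = qc_ev c (f * g);
  qc_ev_counit : forall c, hcounit c = qc_ev c 1;
  qc_ev_antip : forall c f, qc_ev (hantip c) f = qc_ev c (qe_antip f)
}.

Definition tensor_act (V V' : uq_module) (t : (U ⊗ U)%type)
    (x : (V ⊗ V')%type) : (V ⊗ V')%type :=
  \tsum_(f, g <- t) \tsum_(v, v' <- x) (um_act f v ⊗ um_act g v').

Definition qroot_lattice (ga : {ffun 'I_N -> nat}) : weight :=
  \row_i (ga i)%:R.

(* [uR_Theta] is the family Theta_gamma and [uR_D V V'] the operator D on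
   V (x) V'; the sum over gamma is locally finite. *)
Record universal_R := UniversalR {
  uR_Theta : {ffun 'I_N -> nat} -> (U ⊗ U)%type;
  uR_D : forall V V' : uq_module, (V ⊗ V')%type -> (V ⊗ V')%type;
  uR_op : forall V V' : uq_module, (V ⊗ V')%type -> (V ⊗ V')%type :=
    fun V V' x => uR_D
      (\sum_(ga \in [set: {ffun 'I_N -> nat}]) tensor_act (uR_Theta ga) x);
  uR_Theta0 : uR_Theta [ffun=> 0%N] = 1 ⊗ 1;
  uR_Theta_weight : forall ga, exists2 t : seq (U * U),
    (forall p, p \in t -> weight_part nplus (qroot_lattice ga) p.1 /\
                          weight_part nminus (- qroot_lattice ga) p.2) &
    uR_Theta ga = \sum_(p <- t) (p.1 ⊗ p.2);
  uR_D_lin : forall V V', type_L V -> type_L V' -> linear (@uR_D V V');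
  uR_D_weight : forall V V', type_L V -> type_L V' ->
    forall nu nu' (v : V) (v' : V'), L nu -> L nu' ->
      weight_vector nu v -> weight_vector nu' v' ->
      uR_D (v ⊗ v') = qpow (pairing nu nu') *: (v ⊗ v');
  uR_intertwine : forall V V', type_L V -> type_L V' ->
    forall (f : U) (x : (V ⊗ V')%type),
      uR_op (tensor_act (qe_comul f) x) =
      tensor_act (\tsum_(f1, f2 <- qe_comul f) (f2 ⊗ f1)) (uR_op x)
}.

Definition is_standard_rform (Rm : universal_R) (A : quantum_coord)
    (r : A -> A -> k) : Prop :=
  bilinear_form r /\
  forall (V V' : uq_module) (u : V -> k) (u' : V' -> k) (v : V) (v' : V')
      (c c' : A), type_L V -> type_L V' -> scalar u -> scalar u' ->
    qc_ev c =1 matrix_coeff u v -> qc_ev c' =1 matrix_coeff u' v' ->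
    r c c' = \tsum_(w, w' <- uR_op Rm (v ⊗ v')) (u w * u' w').

(* f in U is regarded as the functional c |-> c(f) on C_q[G]; this is the
   resulting map from U (x) U to tensors of functionals. *)
Definition env_functional2 (A : quantum_coord) (z : (U ⊗ U)%type) :
    ((A -> k^o) ⊗ (A -> k^o))%type :=
  \tsum_(f, g <- z)
    ((fun c => qc_ev c f : k^o) : A -> k^o)
      ⊗ ((fun c => qc_ev c g : k^o) : A -> k^o).

End QuantumGroup.

(* Main.v *)
From HB Require Import structures.
Require Import Defs.
From Stdlib Require Import Lia.
From mathcomp Require Import all_boot all_order all_algebra.
From mathcomp Require Import sesquilinear generic_quotient.
From mathcomp Require Import boolp classical_sets functions fsbigop reals complex.
From mathcomp Require Import zify ring.

Set Implicit Arguments.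
Unset Strict Implicit.
Unset Printing Implicit Defensive.

Import Order.TTheory GRing.Theory Num.Theory.

Local Open Scope classical_set_scope.
Local Open Scope quotient_scope.
Local Open Scope ring_scope.

(** The idea is a grading. Restrict a functional in the FRT-dual of the double
   to the pairs of equal powers c^n of one matrix coefficient c, the one between
   a highest weight vector of weight la and its dual functional. The image of
   every functional f under the embedding is a sum of tensors x (x) y whose two
   factors have equal parity, for a suitable Z/2-grading of the quantum group on
   each side; hence n |-> f (c^n (x) c^n) is a combination of geometric sequences
   with ratios q^<mu,la>, where mu runs over even weights only. The tensor
   K_mu (x) 1 with mu odd gives the single geometric sequence with ratio
   q^<mu,la>. Since q is not a root of unity and the parity of mu is read off the
   number <mu,la>, this ratio is not among the others, and distinct geometric
   sequences are linearly independent. So no such tensor is in the image.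

   The parity of the image comes from generators. The pairing of the double with
   itself depends on its second argument only through the product map D -> A, so
   the lower and upper functionals it defines lie in the algebra generated by two
   families ([FRT_double]): the functionals [cross e], a (x) b |-> sum of
   r (S e1) a * r b e2, and those that factor through the product of A, which act
   as the coproduct of an element of the quantum group. The second family is even
   because Delta preserves the parity; on the left factor the E_i, and on the
   right factor the F_i, carry the parity of alpha_i, while the F_i on the left
   and the E_i on the right are even. For the first family an explicit formula
   ([cross_formula]) is obtained from R = D o Theta: each term is a product of an
   element of U(n_-) K_mu with one of U(n_+) K_(-mu), and both have the parity of
   mu. That the algebra generated by the two families is closed under coproduct
   and antipode, hence contains the whole FRT-dual, is shown for an arbitrary
   coquasitriangular Hopf algebra; it uses the Yang-Baxter equation.

   The grading is defined on triangular products F_I K_mu E_J: an element is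
   homogeneous if multiplication by it shifts the spans of these products, and
   this does not require their linear independence ([grade]).

   Two further facts have to be proved. The r-form is only known through its
   values on matrix coefficients, so its being a universal r-form is derived from
   the intertwining property of R by induction along words applied to highest
   weight vectors ([standard_coquasitriangular]). And the coefficient c needs an
   irreducible module with a regular highest weight: the generators act on the
   functions on words in the simple roots, and the submodule generated by the
   indicator of the empty word is irreducible and satisfies the Serre relations,
   because the Serre elements of one sign commute with the generators of the
   other sign ([serre_family_comm], [word_highest]). *)

(** * Linear maps and sums over tensors *)

Section LinearFacts.
Variables (k : fieldType) (V W : lmodType k) (f : V -> W).
Hypothesis f_lin : linear f.

Lemma lin0 : f 0 = 0.
Proof. by have := f_lin (-1) 0 0; rewrite scaler0 addr0 scaleN1r addNr. Qed.

Lemma linD x y : f (x + y) = f x + f y.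
Proof. by have := f_lin 1 x y; rewrite !scale1r. Qed.

Lemma linZ c x : f (c *: x) = c *: f x.
Proof. by have := f_lin c x 0; rewrite lin0 !addr0. Qed.

Lemma linN x : f (- x) = - f x.
Proof. by rewrite -scaleN1r linZ scaleN1r. Qed.

Lemma linB x y : f (x - y) = f x - f y.
Proof. by rewrite linD linN. Qed.

Lemma lin_sum I (s : seq I) (P : pred I) (F : I -> V) :
  f (\sum_(i <- s | P i) F i) = \sum_(i <- s | P i) f (F i).
Proof. exact: (big_morph f linD lin0). Qed.

End LinearFacts.

Section TensorSums.
Variables (k : fieldType) (V W : lmodType k).

Definition bilinear_map (X : lmodType k) (f : V -> W -> X) : Prop :=
  (forall v, linear (f v)) /\ (forall w, linear (f^~ w)).

Lemma bilinear_mapP (X : lmodType k) (f : V -> W -> X) :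
  bilinear_map f -> exists g : {bilinear V -> W -> X}, f = g.
Proof.
move=> [fr fl].
have fb : bilinear_for *:%R *:%R f by split=> w c v v'; [exact: fl|exact: fr].
pose m := bilinear_isBilinear.Build k V W X *:%R *:%R f fb.
pose g : {bilinear V -> W -> X} := HB.pack f m.
by exists g.
Qed.

Lemma eq_tsum (X : nmodType) (f g : V -> W -> X) x :
  (forall v w, f v w = g v w) -> tensor_sum f x = tensor_sum g x.
Proof. by move=> fg; apply: eq_bigr => p _; exact: fg. Qed.

Lemma lin_tsum (X Y : lmodType k) (g : X -> Y) (f : V -> W -> X) x :
  linear g -> g (tensor_sum f x) = tensor_sum (fun v w => g (f v w)) x.
Proof. by move=> gl; rewrite /tensor_sum lin_sum. Qed.

Section Bilinear.
Variables (X : lmodType k) (f : V -> W -> X).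
Hypothesis f_bil : bilinear_map f.

Lemma tsum_tens v w : tensor_sum f (v ⊗ w) = f v w.
Proof. by have [g ->] := bilinear_mapP f_bil; exact: tensor_sumE. Qed.

Lemma tsum_pi s : tensor_sum f (\pi_(tensor V W) s) = \sum_(p <- s) f p.1 p.2.
Proof. by have [g ->] := bilinear_mapP f_bil; exact: tensor_sum_pi. Qed.

Lemma tsum_linear : linear (tensor_sum f).
Proof.
move=> c x y.
have addE (u v : V ⊗ W) : u + v = \pi_(tensor V W) (repr u ++ repr v).
  by [].
have scaleE (u : V ⊗ W) :
    c *: u = \pi_(tensor V W) [seq (c *: p.1, p.2) | p <- repr u].
  by [].
have sumD (u v : V ⊗ W) : tensor_sum f (u + v) = tensor_sum f u + tensor_sum f v.
  by rewrite addE tsum_pi big_cat.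
rewrite sumD scaleE tsum_pi big_map /tensor_sum scaler_sumr.
by congr (_ + _); apply: eq_bigr => p _; rewrite (linZ (f_bil.2 p.2)).
Qed.

End Bilinear.

Lemma tens_bilinear : bilinear_map (@tens k V W).
Proof. by split=> [v c w w'|w c v v']; rewrite ?linearPl ?linearPr. Qed.

Lemma tsum_id (x : V ⊗ W) : tensor_sum (@tens k V W) x = x.
Proof.
apply: tensor_eqP => X f.
have fl : linear (tensor_sum f).
  by apply: tsum_linear; split=> [v c w w'|w c v v']; rewrite ?linearPl ?linearPr.
by rewrite (lin_tsum _ _ fl); apply: eq_tsum => v w; exact: tensor_sumE.
Qed.

Lemma tsum_exchange (V' W' : lmodType k) (X : nmodType)
    (f : V -> W -> V' -> W' -> X) x y :
  \tsum_(a, b <- x) \tsum_(c, d <- y) f a b c d =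
  \tsum_(c, d <- y) \tsum_(a, b <- x) f a b c d.
Proof. exact: exchange_big. Qed.

Lemma tsumD (X : nmodType) (f g : V -> W -> X) x :
  tensor_sum (fun v w => f v w + g v w) x = tensor_sum f x + tensor_sum g x.
Proof. exact: big_split. Qed.

End TensorSums.

Section Coalgebra.
Variable k : fieldType.

(** The part of [is_hopf] that makes the linear maps into an algebra a ring
   under convolution. *)
Record is_coalgebra (C : hopf_data k) : Prop := IsCoalgebra {
  coalg_comul_lin : linear (@hcomul _ C);
  coalg_counit_lin : scalar (@hcounit _ C);
  coalg_coassoc : forall x : C,
    \tsum_(a, b <- hcomul x) (a ⊗ hcomul b)
    = \tsum_(a, b <- hcomul x) \tsum_(a1, a2 <- hcomul a) (a1 ⊗ (a2 ⊗ b));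
  coalg_counitl : forall x : C,
    \tsum_(a, b <- hcomul x) (hcounit a *: b) = x;
  coalg_counitr : forall x : C,
    \tsum_(a, b <- hcomul x) (hcounit b *: a) = x;
  coalg_counit1 : exists x : C, hcounit x = 1
}.

Lemma hopf_coalgebra (H : hopf_data k) : is_hopf H -> is_coalgebra H.
Proof.
move=> hH; split; [exact: hcomul_lin|exact: hcounit_lin|exact: hcomulA|
  exact: hcounitl|exact: hcounitr|exists (hone H); exact: hcounit1].
Qed.

Variables (C : hopf_data k) (hC : is_coalgebra C).

Lemma coassoc (X : lmodType k) (F : C -> C -> C -> X) x :
  (forall b c, linear (fun a => F a b c)) ->
  (forall a c, linear (fun b => F a b c)) ->
  (forall a b, linear (F a b)) ->
  \tsum_(a, b <- hcomul x) \tsum_(b1, b2 <- hcomul b) F a b1 b2 =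
  \tsum_(a, b <- hcomul x) \tsum_(a1, a2 <- hcomul a) F a1 a2 b.
Proof.
move=> F1 F2 F3.
have Fab a : bilinear_map (F a) by split.
have G1 (u : C ⊗ C) : linear (fun a => tensor_sum (F a) u).
  move=> c a a'; rewrite /tensor_sum scaler_sumr -big_split /=.
  by apply: eq_bigr => p _; rewrite F1.
have Gb : bilinear_map (fun a (u : C ⊗ C) => tensor_sum (F a) u).
  by split=> [a|u]; [exact: tsum_linear|exact: G1].
have Gl := tsum_linear Gb.
have := congr1 (tensor_sum (fun a (u : C ⊗ C) => tensor_sum (F a) u))
  (coalg_coassoc hC x).
rewrite !(lin_tsum _ _ Gl) => E.
transitivity (\tsum_(v, w <- hcomul x)
  (tensor_sum (fun a (u : C ⊗ C) => tensor_sum (F a) u)) (v ⊗ hcomul w)).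
  by apply: eq_tsum => a b; rewrite tsum_tens.
rewrite E; apply: eq_tsum => a b; rewrite (lin_tsum _ _ Gl).
by apply: eq_tsum => a1 a2; rewrite !tsum_tens.
Qed.

Lemma counit_suml (X : lmodType k) (f : C -> X) x : linear f ->
  \tsum_(a, b <- hcomul x) (hcounit a *: f b) = f x.
Proof.
move=> fl; rewrite -[in RHS](coalg_counitl hC x) (lin_tsum _ _ fl).
by apply: eq_tsum => a b; rewrite linZ.
Qed.

Lemma counit_sumr (X : lmodType k) (f : C -> X) x : linear f ->
  \tsum_(a, b <- hcomul x) (hcounit b *: f a) = f x.
Proof.
move=> fl; rewrite -[in RHS](coalg_counitr hC x) (lin_tsum _ _ fl).
by apply: eq_tsum => a b; rewrite linZ.
Qed.

End Coalgebra.

(** * The convolution algebra *)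

Section Convolution.
Variables (k : fieldType) (C : hopf_data k) (hC : is_coalgebra C).
Variable B : algType k.

Definition linear_pred : {pred C -> B} := [pred f : C -> B | `[< linear f >]].

(** The structure is carried by a type depending on the coalgebra axioms, so
   that convolution algebras can be iterated: bilinear forms on C are the
   elements of the convolution algebra with values in a convolution algebra. *)
Record conv_alg (coalgC : is_coalgebra C) : Type :=
  ConvAlg {cv_fun :> C -> B; _ : cv_fun \in linear_pred}.
Local Notation cv := (conv_alg hC).

HB.instance Definition _ := [isSub of cv for @cv_fun hC].
HB.instance Definition _ := [Choice of cv by <:].

Fact linear_pred_submod : subsemimod_closed linear_pred.
Proof.
split=> [|c f /asboolP fl]; last first.
  apply/asboolP => b x y; rewrite !fctE fl scalerDr !scalerA.
  by rewrite mulrC.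
split=> [|f g /asboolP fl /asboolP gl].
  by apply/asboolP => b x y; rewrite /= scaler0 addr0.
apply/asboolP => b x y; rewrite !fctE fl gl scalerDr !addrA.
by congr (_ + _); rewrite -!addrA; congr (_ + _); rewrite addrC.
Qed.
HB.instance Definition _ := GRing.SubChoice_isSubLmodule.Build k (C -> B)
  linear_pred cv linear_pred_submod.

Lemma cv_linear (f : cv) : linear f.
Proof. by case: f => f fP; apply/asboolP. Qed.

Definition cv_of (f : C -> B) (fl : linear f) : cv :=
  ConvAlg hC (introT (asboolP _) fl).

Lemma cvP (f g : cv) : f =1 g -> f = g.
Proof. by move=> fg; apply: val_inj; apply: funext. Qed.

Lemma cv_ofE (f : C -> B) (fl : linear f) x : cv_of fl x = f x.
Proof. by []. Qed.

Lemma cvD (f g : cv) x : (f + g) x = f x + g x.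
Proof. by []. Qed.
Lemma cvN (f : cv) x : (- f) x = - f x.
Proof. by []. Qed.
Lemma cvZ c (f : cv) x : (c *: f) x = c *: f x.
Proof. by []. Qed.
Lemma cv0 x : (0 : cv) x = 0.
Proof. by []. Qed.

Lemma conv_bilinear (f g : cv) : bilinear_map (fun a b : C => f a * g b).
Proof.
split=> [v c w w'|w c v v'].
  by rewrite (cv_linear g) mulrDr scalerAr.
by rewrite (cv_linear f) mulrDl scalerAl.
Qed.

Definition conv_fun (f g : cv) (x : C) : B := \tsum_(a, b <- hcomul x) (f a * g b).

Fact conv_fun_linear f g : linear (conv_fun f g).
Proof.
move=> c x y; rewrite /conv_fun (coalg_comul_lin hC).
exact: (tsum_linear (conv_bilinear f g)).
Qed.

Definition cv_mul (f g : cv) : cv := cv_of (conv_fun_linear f g).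

Fact cv_one_linear : linear (fun x : C => hcounit x *: (1 : B)).
Proof. by move=> c x y; rewrite (coalg_counit_lin hC) scalerDl scalerA. Qed.

Definition cv_one : cv := cv_of cv_one_linear.

Fact cv_mulA : associative cv_mul.
Proof.
move=> f g h; apply: cvP => x; rewrite !cv_ofE /conv_fun.
transitivity (\tsum_(a, b <- hcomul x) \tsum_(b1, b2 <- hcomul b)
    (f a * (g b1 * h b2))).
  by apply: eq_tsum => a b; rewrite cv_ofE /conv_fun /tensor_sum mulr_sumr.
rewrite (coassoc hC (F := fun a b c => f a * (g b * h c))).
- apply: eq_tsum => a b; rewrite cv_ofE /conv_fun /tensor_sum mulr_suml.
  by apply: eq_bigr => p _; rewrite mulrA.
- by move=> b c d x' y'; rewrite (cv_linear f) mulrDl scalerAl.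
- by move=> b c d x' y'; rewrite (cv_linear g) mulrDl mulrDr -scalerAl -scalerAr.
- by move=> b c d x' y'; rewrite (cv_linear h) !mulrDr !scalerAr.
Qed.

Fact cv_mul1l : left_id cv_one cv_mul.
Proof.
move=> f; apply: cvP => x; rewrite cv_ofE /conv_fun.
rewrite -[RHS](counit_suml hC) ?cv_linear; last exact: cv_linear.
by apply: eq_tsum => a b; rewrite cv_ofE -scalerAl mul1r.
Qed.

Fact cv_mul1r : right_id cv_one cv_mul.
Proof.
move=> f; apply: cvP => x; rewrite cv_ofE /conv_fun.
rewrite -[RHS](counit_sumr hC) ?cv_linear; last exact: cv_linear.
by apply: eq_tsum => a b; rewrite cv_ofE -scalerAr mulr1.
Qed.

Fact cv_mulDl : left_distributive cv_mul +%R.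
Proof.
move=> f g h; apply: cvP => x; rewrite cvD !cv_ofE /conv_fun -tsumD.
by apply: eq_tsum => a b; rewrite cvD mulrDl.
Qed.

Fact cv_mulDr : right_distributive cv_mul +%R.
Proof.
move=> f g h; apply: cvP => x; rewrite cvD !cv_ofE /conv_fun -tsumD.
by apply: eq_tsum => a b; rewrite cvD mulrDr.
Qed.

Fact cv_one_neq0 : cv_one != 0.
Proof.
have [x x1] := coalg_counit1 hC.
apply/eqP => /(congr1 (fun f : cv => f x)) /eqP.
by rewrite cv_ofE x1 scale1r cv0 oner_eq0.
Qed.

HB.instance Definition _ := GRing.Zmodule_isNzRing.Build cv
  cv_mulA cv_mul1l cv_mul1r cv_mulDl cv_mulDr cv_one_neq0.

Fact cv_scaleAl c (f g : cv) : c *: (f * g) = (c *: f) * g.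
Proof.
apply: cvP => x; rewrite cvZ !cv_ofE /conv_fun /tensor_sum scaler_sumr.
by apply: eq_bigr => p _; rewrite cvZ scalerAl.
Qed.

HB.instance Definition _ := GRing.Lmodule_isLalgebra.Build k cv cv_scaleAl.

Fact cv_scaleAr c (f g : cv) : c *: (f * g) = f * (c *: g).
Proof.
apply: cvP => x; rewrite cvZ !cv_ofE /conv_fun /tensor_sum scaler_sumr.
by apply: eq_bigr => p _; rewrite cvZ scalerAr.
Qed.

HB.instance Definition _ := GRing.Lalgebra_isAlgebra.Build k cv cv_scaleAr.

Lemma cvM (f g : cv) x : (f * g) x = \tsum_(a, b <- hcomul x) (f a * g b).
Proof. by []. Qed.

Lemma cv1 x : (1 : cv) x = hcounit x *: 1.
Proof. by []. Qed.

End Convolution.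

(** * Bilinear forms and their convolution inverses *)

Lemma cv_sumE (k : fieldType) (C : hopf_data k) (hC : is_coalgebra C)
    (B : algType k) I (s : seq I) (F : I -> conv_alg B hC) x :
  (\sum_(i <- s) F i) x = \sum_(i <- s) F i x.
Proof. by elim/big_ind2: _ => // f b g c <- <-; rewrite cvD. Qed.

Lemma cv_tsumE (k : fieldType) (C : hopf_data k) (hC : is_coalgebra C)
    (B : algType k) (V W : lmodType k) (F : V -> W -> conv_alg B hC) t x :
  (tensor_sum F t) x = \tsum_(v, w <- t) F v w x.
Proof. by rewrite /tensor_sum cv_sumE. Qed.

Lemma mulr_tsuml (k : fieldType) (V W : lmodType k) (B : pzRingType)
    (F : V -> W -> B) t c : tensor_sum F t * c = \tsum_(v, w <- t) (F v w * c).
Proof. exact: mulr_suml. Qed.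

Lemma mulr_tsumr (k : fieldType) (V W : lmodType k) (B : pzRingType)
    (F : V -> W -> B) t c : c * tensor_sum F t = \tsum_(v, w <- t) (c * F v w).
Proof. exact: mulr_sumr. Qed.

Section Forms.
Variables (k : fieldType) (C : hopf_data k) (hC : is_coalgebra C).
Local Notation C1 B := (conv_alg B hC).

Lemma cv2M (B : algType k) (f g : C1 (C1 B)) a b :
  (f * g) a b = \tsum_(a1, a2 <- hcomul a) \tsum_(b1, b2 <- hcomul b)
    (f a1 b1 * g a2 b2).
Proof. by rewrite cvM /tensor_sum cv_sumE. Qed.

Lemma cv2_1 (B : algType k) a b :
  (1 : C1 (C1 B)) a b = (hcounit a * hcounit b) *: 1.
Proof. by rewrite cv1 cvZ cv1 scalerA. Qed.

Fact cv2_of_linear (B : algType k) (f : C -> C -> B) (fb : bilinear_map f) :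
  linear (fun a => cv_of hC (fb.1 a)).
Proof. by move=> c a b; apply: cvP => x; exact: (fb.2 x). Qed.

Definition cv2_of (B : algType k) (f : C -> C -> B) (fb : bilinear_map f) :
  C1 (C1 B) := cv_of hC (cv2_of_linear fb).

Lemma form_bilinear (r : C -> C -> k) :
  bilinear_form r -> bilinear_map (r : C -> C -> k^o).
Proof. by move=> [rr rl]; split. Qed.

Lemma cv2_bilinear (B : algType k) (f : C1 (C1 B)) : bilinear_map (fun a b => f a b).
Proof.
split=> [a|b c x y]; first exact: cv_linear.
by rewrite (cv_linear f) cvD cvZ.
Qed.

Definition form2 (r : C -> C -> k) (rb : bilinear_form r) : C1 (C1 k^o) :=
  cv2_of (form_bilinear rb).

Lemma cv2P (B : algType k) (f g : C1 (C1 B)) : (forall a b, f a b = g a b) -> f = g.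
Proof. by move=> fg; apply: cvP => a; apply: cvP => b. Qed.

Lemma form2_inverse (r r' : C -> C -> k) (rb : bilinear_form r)
    (rb' : bilinear_form r') : is_conv_inverse r r' <->
  form2 rb * form2 rb' = 1 /\ form2 rb' * form2 rb = 1.
Proof.
split=> [inv|[E1 E2] a b].
  by split; apply: cv2P => a b; rewrite cv2M cv2_1; have [e1 e2] := inv a b;
    rewrite [_ *: _]mulr1; [exact: e1|exact: e2].
have := congr1 (fun f : C1 (C1 k^o) => f a b) E1.
have := congr1 (fun f : C1 (C1 k^o) => f a b) E2.
by rewrite !cv2M !cv2_1 ![_ *: _]mulr1.
Qed.

(** Inverses are unique in the iterated convolution algebra, so the chosen
   inverse is any inverse that can be exhibited. *)
Lemma conv_invE (r r' : C -> C -> k) : bilinear_form r -> bilinear_form r' ->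
  is_conv_inverse r r' -> conv_inv r = r'.
Proof.
move=> rb rb' inv; rewrite /conv_inv.
set P := [set _ | _]; have Pr' : P r' by [].
have [rb'' inv''] := xgetPex (fun _ _ => 0) (ex_intro P r' Pr').
move/(form2_inverse rb rb''): inv'' => [_ E'].
move/(form2_inverse rb rb'): inv => [E _].
have E2 : form2 rb'' = form2 rb' by rewrite -[LHS]mulr1 -E mulrA E' mul1r.
apply: funext => a; apply: funext => b.
exact: (congr1 (fun f : C1 (C1 k^o) => f a b) E2).
Qed.

End Forms.

(** * Antipodes *)

Section Antipode.
Variables (k : fieldType) (H : hopf_data k) (hH : is_hopf H).

Definition hopf_alg (hopfH : is_hopf H) : Type := hopf_car H.
Local Notation HA := (hopf_alg hH).
HB.instance Definition _ := GRing.Lmodule.on HA.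

Fact hopf_alg_mulDl : left_distributive (@hmul _ H : HA -> HA -> HA) +%R.
Proof. by move=> x y z; exact: (linD (hmul_linl hH z)). Qed.
Fact hopf_alg_mulDr : right_distributive (@hmul _ H : HA -> HA -> HA) +%R.
Proof. by move=> x y z; exact: (linD (hmul_linr hH x)). Qed.

Lemma hopf_one_neq0 : hone H != 0.
Proof.
apply/eqP => e; have := hcounit1 hH; rewrite e.
by rewrite (lin0 (W := k^o) (hcounit_lin hH)) => /eqP; rewrite eq_sym oner_eq0.
Qed.

HB.instance Definition _ := GRing.Zmodule_isNzRing.Build HA
  (hmulA hH) (hmul1l hH) (hmul1r hH) hopf_alg_mulDl hopf_alg_mulDr hopf_one_neq0.

Fact hopf_alg_scaleAl c (x y : HA) : c *: (x * y) = (c *: x) * y.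
Proof. exact/esym/(linZ (hmul_linl hH y)). Qed.
HB.instance Definition _ := GRing.Lmodule_isLalgebra.Build k HA hopf_alg_scaleAl.
Fact hopf_alg_scaleAr c (x y : HA) : c *: (x * y) = x * (c *: y).
Proof. exact/esym/(linZ (hmul_linr hH x)). Qed.
HB.instance Definition _ := GRing.Lalgebra_isAlgebra.Build k HA hopf_alg_scaleAr.

Let hC := hopf_coalgebra hH.
Local Notation C2 := (conv_alg (conv_alg HA hC) hC).

Lemma hmul_bilinear : bilinear_map (@hmul _ H).
Proof. by split=> [a|b]; [exact: hmul_linr|exact: hmul_linl]. Qed.

Fact antip_mul_bilinear : bilinear_map (fun x y : H => hantip (hmul x y)).
Proof.
by split=> [a|b] c x y; rewrite ?(hmul_linl hH) ?(hmul_linr hH) (hantip_lin hH).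
Qed.

Fact mul_antip_bilinear : bilinear_map (fun x y : H => hmul (hantip y) (hantip x)).
Proof.
by split=> [a|b] c x y; rewrite (hantip_lin hH) ?(hmul_linl hH) ?(hmul_linr hH).
Qed.

(** Both sides are convolution inverses of the multiplication, as maps from
   the tensor square to the algebra. *)
Lemma antip_mul (x y : H) : hantip (hmul x y) = hmul (hantip y) (hantip x).
Proof.
pose mu : C2 := cv2_of hC (B := HA) hmul_bilinear.
pose n1 : C2 := cv2_of hC (B := HA) antip_mul_bilinear.
pose n2 : C2 := cv2_of hC (B := HA) mul_antip_bilinear.
have n1mu : n1 * mu = 1.
  apply: cv2P => a b; rewrite cv2M cv2_1.
  have Sl := hantipl hH (hmul a b); rewrite (hcounitM hH) in Sl.
  rewrite -[RHS]Sl (hcomulM hH).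
  have f_bil : bilinear_map (fun a b : H => hmul (hantip a) b).
    by split=> [u|v] c z t; rewrite ?(hantip_lin hH) ?(hmul_linl hH) ?(hmul_linr hH).
  rewrite (lin_tsum _ _ (tsum_linear f_bil)); apply: eq_tsum => a1 a2.
  rewrite (lin_tsum _ _ (tsum_linear f_bil)); apply: eq_tsum => b1 b2.
  by rewrite (tsum_tens f_bil).
have mun2 : mu * n2 = 1.
  apply: cv2P => a b; rewrite cv2M cv2_1.
  transitivity (\tsum_(a1, a2 <- hcomul a) (hcounit b *: hmul a1 (hantip a2))).
    apply: eq_tsum => a1 a2.
    have gl : linear (fun z : H => hmul a1 (hmul z (hantip a2))).
      by move=> c z t; rewrite (hmul_linl hH) (hmul_linr hH).
    transitivity (hmul a1 (hmul (hcounit b *: hone H) (hantip a2))).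
      rewrite -(hantipr hH b) (lin_tsum _ _ gl); apply: eq_tsum => b1 b2.
      rewrite -(hmulA hH b1) (hmulA hH a1) /=.
      by [].
    by rewrite (linZ (hmul_linl hH _)) (hmul1l hH) (linZ (hmul_linr hH _)).
  rewrite -(lin_tsum (fun a b => hmul a (hantip b)) _ (g := *:%R (hcounit b))).
    by rewrite (hantipr hH) scalerA mulrC.
  by move=> c z t; rewrite scalerDr !scalerA mulrC.
have E : n1 = n2 by rewrite -[n1]mulr1 -mun2 mulrA n1mu mul1r.
exact: (congr1 (fun f : C2 => f x y) E).
Qed.

Lemma antip1 : hantip (hone H) = hone H.
Proof.
have := hantipl hH (hone H); rewrite (hcomul1 hH) (hcounit1 hH) scale1r tsum_tens.
  by rewrite (hmul1r hH).
by split=> [u|v] c z t; rewrite ?(hantip_lin hH) ?(hmul_linl hH) ?(hmul_linr hH).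
Qed.

Lemma counit_antip (x : H) : hcounit (hantip x) = hcounit x.
Proof.
have cl : linear (@hcounit _ H : H -> k^o) by exact: hcounit_lin.
rewrite -{1}(hcounitr hH x) (lin_tsum _ _ (hantip_lin hH)) (lin_tsum _ _ cl).
have := congr1 (@hcounit _ H : H -> k^o) (hantipl hH x).
rewrite (linZ cl) (hcounit1 hH) (lin_tsum _ _ cl) [_ *: _]mulr1 => <-.
apply: eq_tsum => a b; rewrite (hcounitM hH) (linZ (hantip_lin hH)) (linZ cl).
by rewrite [_ *: _]mulrC.
Qed.

End Antipode.

Section Legs.
Variables (k : fieldType) (C : hopf_data k) (hC : is_coalgebra C).
Variable B : algType k.
Local Notation C1 := (conv_alg B hC).
Local Notation C2 := (conv_alg C1 hC).

Fact counit_scale_linear (V : lmodType k) (x : V) :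
  linear (fun a : C => hcounit a *: x).
Proof. by move=> c a b; rewrite (coalg_counit_lin hC) scalerDl scalerA. Qed.

Fact legl_bilinear (u : C1) : bilinear_map (fun a b : C => hcounit b *: u a).
Proof.
split=> [a|b c x y]; first exact: counit_scale_linear.
by rewrite (cv_linear u) scalerDr !scalerA mulrC.
Qed.

Fact legr_bilinear (u : C1) : bilinear_map (fun a b : C => hcounit a *: u b).
Proof.
split=> [a c x y|b]; last exact: counit_scale_linear.
by rewrite (cv_linear u) scalerDr !scalerA mulrC.
Qed.

Definition legl (u : C1) : C2 := cv2_of hC (legl_bilinear u).
(** The values lie in a noncommutative algebra, so [legl u] and [legr v]
   need not commute; the Yang-Baxter equation is about the two orders. *)
Definition legr (u : C1) : C2 := cv2_of hC (legr_bilinear u).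

Lemma leglE u a b : legl u a b = hcounit b *: u a. Proof. by []. Qed.
Lemma legrE u a b : legr u a b = hcounit a *: u b. Proof. by []. Qed.

Lemma legr_mul (u v : C1) : legr u * legr v = legr (u * v).
Proof.
apply: cv2P => a b; rewrite cv2M legrE cvM.
transitivity (\tsum_(a1, a2 <- hcomul a) (hcounit a1 *: (hcounit a2 *: (u * v) b))).
  apply: eq_tsum => a1 a2; rewrite scalerA cvM (lin_tsum _ _ (g := *:%R _)).
    by apply: eq_tsum => b1 b2; rewrite ?leglE ?legrE -scalerAr -scalerAl !scalerA mulrC.
  by move=> c x y; rewrite scalerDr !scalerA mulrC.
exact: (counit_suml hC (f := fun b2 => hcounit b2 *: _) _ (counit_scale_linear _)).
Qed.

Lemma legr1 : legr 1 = 1.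
Proof. by apply: cv2P => a b; rewrite cv2_1 legrE cv1 scalerA. Qed.

Lemma leglr (u v : C1) a b : (legl u * legr v) a b = u a * v b.
Proof.
rewrite cv2M.
transitivity (\tsum_(a1, a2 <- hcomul a) (hcounit a2 *: (u a1 * v b))).
  apply: eq_tsum => a1 a2.
  transitivity (\tsum_(b1, b2 <- hcomul b) (hcounit b1 *: (hcounit a2 *: (u a1 * v b2)))).
    by apply: eq_tsum => b1 b2; rewrite ?leglE ?legrE -scalerAr -scalerAl !scalerA mulrC.
  apply: (counit_suml hC (f := fun b2 => hcounit a2 *: (u a1 * v b2))).
  by move=> c x y; rewrite (cv_linear v) mulrDr -scalerAr scalerDr !scalerA mulrC.
apply: (counit_sumr hC (f := fun a1 => u a1 * v b)).
by move=> c x y; rewrite (cv_linear u) mulrDl -scalerAl.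
Qed.

Lemma legrl (u v : C1) a b : (legr v * legl u) a b = v b * u a.
Proof.
rewrite cv2M.
transitivity (\tsum_(a1, a2 <- hcomul a) (hcounit a1 *: (v b * u a2))).
  apply: eq_tsum => a1 a2.
  transitivity (\tsum_(b1, b2 <- hcomul b) (hcounit b2 *: (hcounit a1 *: (v b1 * u a2)))).
    by apply: eq_tsum => b1 b2; rewrite ?leglE ?legrE -scalerAr -scalerAl !scalerA mulrC.
  apply: (counit_sumr hC (f := fun b1 => hcounit a1 *: (v b1 * u a2))).
  by move=> c x y; rewrite (cv_linear v) mulrDl -scalerAl scalerDr !scalerA mulrC.
apply: (counit_suml hC (f := fun a2 => v b * u a2)).
by move=> c x y; rewrite (cv_linear u) mulrDr -scalerAr.
Qed.

Lemma mul_legr (f : C2) (v : C1) a b :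
  (f * legr v) a b = \tsum_(b1, b2 <- hcomul b) (f a b1 * v b2).
Proof.
rewrite cv2M tsum_exchange; apply: eq_tsum => b1 b2.
transitivity (\tsum_(a1, a2 <- hcomul a) (hcounit a2 *: (f a1 b1 * v b2))).
  by apply: eq_tsum => a1 a2; rewrite ?leglE ?legrE -scalerAr.
apply: (counit_sumr hC (f := fun a1 => f a1 b1 * v b2)).
by move=> c x y; rewrite (cv_linear f) cvD cvZ mulrDl -scalerAl.
Qed.

Lemma legr_mul_l (f : C2) (v : C1) a b :
  (legr v * f) a b = \tsum_(b1, b2 <- hcomul b) (v b1 * f a b2).
Proof.
rewrite cv2M tsum_exchange; apply: eq_tsum => b1 b2.
transitivity (\tsum_(a1, a2 <- hcomul a) (hcounit a1 *: (v b1 * f a2 b2))).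
  by apply: eq_tsum => a1 a2; rewrite ?leglE ?legrE -scalerAl.
apply: (counit_suml hC (f := fun a2 => v b1 * f a2 b2)).
by move=> c x y; rewrite (cv_linear f) cvD cvZ mulrDr -scalerAr.
Qed.

Lemma mul_legl (f : C2) (v : C1) a b :
  (f * legl v) a b = \tsum_(a1, a2 <- hcomul a) (f a1 b * v a2).
Proof.
rewrite cv2M; apply: eq_tsum => a1 a2.
transitivity (\tsum_(b1, b2 <- hcomul b) (hcounit b2 *: (f a1 b1 * v a2))).
  by apply: eq_tsum => b1 b2; rewrite ?leglE ?legrE -scalerAr.
apply: (counit_sumr hC (f := fun b1 => f a1 b1 * v a2)).
by move=> c x y; rewrite (cv_linear (f a1)) mulrDl -scalerAl.
Qed.

Lemma legl_mul_l (f : C2) (v : C1) a b :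
  (legl v * f) a b = \tsum_(a1, a2 <- hcomul a) (v a1 * f a2 b).
Proof.
rewrite cv2M; apply: eq_tsum => a1 a2.
transitivity (\tsum_(b1, b2 <- hcomul b) (hcounit b1 *: (v a1 * f a2 b2))).
  by apply: eq_tsum => b1 b2; rewrite ?leglE ?legrE -scalerAl.
apply: (counit_suml hC (f := fun b2 => v a1 * f a2 b2)).
by move=> c x y; rewrite (cv_linear (f a2)) mulrDr -scalerAr.
Qed.

End Legs.

(** * Coquasitriangular Hopf algebras *)

Record is_coquasitriangular (k : fieldType) (A : hopf_data k) (r : A -> A -> k) :
    Prop := IsCoquasitriangular {
  cqt_bilinear : bilinear_form r;
  cqt_comm : forall a b,
    \tsum_(a1, a2 <- hcomul a) \tsum_(b1, b2 <- hcomul b)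
      (r a1 b1 *: hmul a2 b2) =
    \tsum_(a1, a2 <- hcomul a) \tsum_(b1, b2 <- hcomul b)
      (r a2 b2 *: hmul b1 a1);
  cqt_mull : forall a b c,
    r (hmul a b) c = \tsum_(c1, c2 <- hcomul c) (r a c1 * r b c2);
  cqt_mulr : forall a b c,
    r a (hmul b c) = \tsum_(a1, a2 <- hcomul a) (r a1 c * r a2 b);
  cqt_1l : forall b, r (hone A) b = hcounit b;
  cqt_1r : forall a, r a (hone A) = hcounit a
}.

Section Coquasitriangular.
Variables (k : fieldType) (A : hopf_data k) (hA : is_hopf A) (r : A -> A -> k).
Hypothesis hr : is_coquasitriangular r.
Hypothesis antip_comul : forall x : A,
  hcomul (hantip x) = \tsum_(a, b <- hcomul x) (hantip b ⊗ hantip a).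

Let hC := hopf_coalgebra hA.
Local Notation C1 := (conv_alg k^o hC).
Local Notation "a ·· b" := (hmul a b) (at level 40, left associativity).

Lemma tsum_antip (X : lmodType k) (F : A -> A -> X) x : bilinear_map F ->
  tensor_sum F (hcomul (hantip x)) = \tsum_(a, b <- hcomul x) F (hantip b) (hantip a).
Proof.
move=> Fb; rewrite antip_comul (lin_tsum _ _ (tsum_linear Fb)).
by apply: eq_tsum => a b; rewrite (tsum_tens Fb).
Qed.

Lemma tsum_mul (X : lmodType k) (F : A -> A -> X) x y : bilinear_map F ->
  tensor_sum F (hcomul (x ·· y)) = \tsum_(a, b <- hcomul x)
    \tsum_(c, d <- hcomul y) F (a ·· c) (b ·· d).
Proof.
move=> Fb; rewrite (hcomulM hA) (lin_tsum _ _ (tsum_linear Fb)).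
apply: eq_tsum => a b; rewrite (lin_tsum _ _ (tsum_linear Fb)).
by apply: eq_tsum => c d; rewrite (tsum_tens Fb).
Qed.

Lemma r_linr a : linear (r a : A -> k^o).
Proof. exact: (cqt_bilinear hr).1. Qed.
Lemma r_linl b : linear (r^~ b : A -> k^o).
Proof. exact: (cqt_bilinear hr).2. Qed.

Definition lam (a : A) : C1 := cv_of hC (r_linr a).
Definition rho (b : A) : C1 := cv_of hC (r_linl b).

Lemma lamM a b : lam (a ·· b) = lam a * lam b.
Proof. by apply: cvP => c; exact: (cqt_mull hr). Qed.

Lemma lam_linear : linear lam.
Proof. by move=> c x y; apply: cvP => z; exact: r_linl. Qed.
Lemma rho_linear : linear rho.
Proof. by move=> c x y; apply: cvP => z; exact: r_linr. Qed.

Definition rinv (a b : A) : k := r (hantip a) b.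

Lemma rinv_bilinear : bilinear_form rinv.
Proof.
split=> [x|y c u v]; first exact: r_linr.
rewrite /rinv (hantip_lin hA); exact: r_linl.
Qed.

Lemma rinv_inverse : is_conv_inverse r rinv.
Proof.
move=> a b; split.
  transitivity (lam (\tsum_(a1, a2 <- hcomul a) (a1 ·· hantip a2)) b).
    rewrite (lin_tsum _ _ lam_linear) /tensor_sum cv_sumE; by apply: eq_bigr => p _; rewrite lamM cvM.
  rewrite (hantipr hA) (linZ lam_linear) cvZ.
  by congr (_ * _); exact: cqt_1l.
transitivity (lam (\tsum_(a1, a2 <- hcomul a) (hantip a1 ·· a2)) b).
  rewrite (lin_tsum _ _ lam_linear) /tensor_sum cv_sumE; by apply: eq_bigr => p _; rewrite lamM cvM.
rewrite (hantipl hA) (linZ lam_linear) cvZ.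
by congr (_ * _); exact: cqt_1l.
Qed.

(** The form (a, b) |-> r (S a) b inverts r, because r is multiplicative in
   its first variable. *)
Lemma conv_inv_r : conv_inv r = rinv.
Proof.
exact: (conv_invE hC (cqt_bilinear hr) rinv_bilinear rinv_inverse).
Qed.

Lemma rinv_linr a : linear (rinv a : A -> k^o).
Proof. exact: rinv_bilinear.1. Qed.
Lemma rinv_linl b : linear (rinv^~ b : A -> k^o).
Proof. exact: rinv_bilinear.2. Qed.

Definition lami (a : A) : C1 := cv_of hC (rinv_linr a).
Definition rhoi (b : A) : C1 := cv_of hC (rinv_linl b).

Lemma lami_linear : linear lami.
Proof. by move=> c x y; apply: cvP => z; exact: rinv_linl. Qed.
Lemma rhoi_linear : linear rhoi.
Proof. by move=> c x y; apply: cvP => z; exact: rinv_linr. Qed.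

Definition lamform : conv_alg C1 hC := cv_of hC lam_linear.
Definition rhoform : conv_alg C1 hC := cv_of hC rho_linear.
Definition lamiform : conv_alg C1 hC := cv_of hC lami_linear.
Definition rhoiform : conv_alg C1 hC := cv_of hC rhoi_linear.

Lemma lam_lami : lamform * lamiform = 1.
Proof.
apply: cv2P => a b; rewrite cv2M cv2_1 [_ *: _]mulr1.
exact: (rinv_inverse a b).1.
Qed.

Lemma lami_lam : lamiform * lamform = 1.
Proof.
apply: cv2P => a b; rewrite cv2M cv2_1 [_ *: _]mulr1.
exact: (rinv_inverse a b).2.
Qed.

Lemma rho_rhoi : rhoform * rhoiform = 1.
Proof.
apply: cv2P => a b; rewrite cv2M cv2_1 [_ *: _]mulr1 tsum_exchange mulrC.
exact: (rinv_inverse b a).1.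
Qed.

Lemma rhoi_rho : rhoiform * rhoform = 1.
Proof.
apply: cv2P => a b; rewrite cv2M cv2_1 [_ *: _]mulr1 tsum_exchange mulrC.
exact: (rinv_inverse b a).2.
Qed.

Lemma rhoiM b c : rhoi (b ·· c) = rhoi b * rhoi c.
Proof.
apply: cvP => a; rewrite cvM.
transitivity (\tsum_(x, y <- hcomul (hantip a)) (r x c * r y b : k^o)).
  exact: (cqt_mulr hr).
rewrite (tsum_antip (F := fun x y => r x c * r y b : k^o)).
  by apply: eq_tsum => a1 a2; rewrite mulrC.
split=> [x d u v|y d u v].
  by rewrite (r_linl b) mulrDr scalerAr.
by rewrite (r_linl c) mulrDl scalerAl.
Qed.

Lemma rinv_1r a : rinv a (hone A) = hcounit a.
Proof. by rewrite /rinv (cqt_1r hr) (counit_antip hA). Qed.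

Fact rinv_antip_bilinear : bilinear_map (fun a b => rinv a (hantip b) : k^o).
Proof.
split=> [a c x y|b c x y]; last exact: rinv_linl.
by rewrite (hantip_lin hA) rinv_linr.
Qed.

(** The form is invariant under the antipode: both sides invert the inverse
   form. *)
Lemma rinv_antip a b : rinv a (hantip b) = r a b.
Proof.
pose T : conv_alg C1 hC := cv2_of hC rinv_antip_bilinear.
suff E : lamiform * T = 1.
  have ET : T = lamform by rewrite -[T]mul1r -lam_lami -mulrA E mulr1.
  exact: (congr1 (fun f : conv_alg C1 hC => f a b) ET).
apply: cv2P => x y; rewrite cv2M cv2_1 [_ *: _]mulr1 tsum_exchange.
transitivity (rhoi (\tsum_(b1, b2 <- hcomul y) (b1 ·· hantip b2)) x).
  rewrite (lin_tsum _ _ rhoi_linear) /tensor_sum cv_sumE; by apply: eq_bigr => p _; rewrite rhoiM cvM.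
rewrite (hantipr hA) (linZ rhoi_linear) cvZ mulrC.
by congr (_ * _); exact: rinv_1r.
Qed.

End Coquasitriangular.

(** * The coalgebra of the quantum double *)

Section MoreTensorSums.
Variables (k : fieldType) (V W : lmodType k).

(** Tensor sums are spanned by pure tensors, so linear maps are compared on
   those. *)
Lemma tens_ext (X : lmodType k) (f g : V ⊗ W -> X) : linear f -> linear g ->
  (forall v w, f (v ⊗ w) = g (v ⊗ w)) -> f =1 g.
Proof.
move=> fl gl fg x; rewrite -(tsum_id x) (lin_tsum _ _ fl) (lin_tsum _ _ gl).
exact: eq_tsum.
Qed.

Lemma tsum_param_linear (Z X : lmodType k) (F : Z -> V -> W -> X) x :
  (forall v w, linear (fun z => F z v w)) -> linear (fun z => tensor_sum (F z) x).
Proof.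
move=> Fl c z z'; rewrite /tensor_sum scaler_sumr -big_split /=.
by apply: eq_bigr => p _; rewrite Fl.
Qed.

Lemma comp_linear (Z X : lmodType k) (f : Z -> X) (g : V -> Z) :
  linear f -> linear g -> linear (fun x => f (g x)).
Proof. by move=> fl gl c x y; rewrite gl fl. Qed.

Lemma tensr_linear (v : V) : linear (fun w : W => v ⊗ w).
Proof. exact: (tens_bilinear V W).1. Qed.
Lemma tensl_linear (w : W) : linear (fun v : V => v ⊗ w).
Proof. exact: (tens_bilinear V W).2. Qed.

Lemma scale_linear (c : k) : linear ( *:%R c : V -> V).
Proof. by move=> d x y; rewrite scalerDr !scalerA mulrC. Qed.

End MoreTensorSums.

Lemma comul_sum_linear (k : fieldType) (C : hopf_data k) (hC : is_coalgebra C)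
    (X : lmodType k) (F : C -> C -> X) : bilinear_map F ->
  linear (fun a => tensor_sum F (hcomul a)).
Proof.
by move=> Fb c x y; rewrite (coalg_comul_lin hC); exact: (tsum_linear Fb).
Qed.

Section DoubleCoalgebra.
Variables (k : fieldType) (A : hopf_data k) (hA : is_hopf A) (r : A -> A -> k).
Let hC := hopf_coalgebra hA.
Local Notation D := (quantum_double r).

Fact dcomul_bilinear : bilinear_map (fun a b : A =>
  \tsum_(a1, a2 <- hcomul a) \tsum_(b1, b2 <- hcomul b)
    ((a1 ⊗ b1) ⊗ (a2 ⊗ b2))).
Proof.
split=> [a|b].
  apply: tsum_param_linear => a1 a2; apply: (comul_sum_linear hC).
  split=> [x|y].
    by apply: comp_linear; [exact: tensr_linear|exact: tensr_linear].
  by apply: (comp_linear (f := fun z => z ⊗ _)); [exact: tensl_linear|exact: tensr_linear].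
apply: (comul_sum_linear hC).
split=> [x|y]; apply: tsum_param_linear => b1 b2.
  by apply: comp_linear; [exact: tensr_linear|exact: tensl_linear].
by apply: (comp_linear (f := fun z => z ⊗ _)); [exact: tensl_linear|exact: tensl_linear].
Qed.

Lemma dcomul_linear : linear (@hcomul _ D).
Proof. exact: (tsum_linear dcomul_bilinear). Qed.

Lemma dcomulE (a b : A) : hcomul (a ⊗ b : D) =
  \tsum_(a1, a2 <- hcomul a) \tsum_(b1, b2 <- hcomul b)
    ((a1 ⊗ b1) ⊗ (a2 ⊗ b2)).
Proof. exact: (tsum_tens dcomul_bilinear). Qed.

Lemma dsum_comul (X : lmodType k) (F : D -> D -> X) (a b : A) : bilinear_map F ->
  tensor_sum F (hcomul (a ⊗ b : D)) =
  \tsum_(a1, a2 <- hcomul a) \tsum_(b1, b2 <- hcomul b) F (a1 ⊗ b1) (a2 ⊗ b2).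
Proof.
move=> Fb; rewrite dcomulE (lin_tsum _ _ (tsum_linear Fb)).
apply: eq_tsum => a1 a2; rewrite (lin_tsum _ _ (tsum_linear Fb)).
by apply: eq_tsum => b1 b2; rewrite (tsum_tens Fb).
Qed.

Fact dsum_bilinear_r (X : lmodType k) (F : D -> D -> X) (a1 a2 : A) :
  bilinear_map F -> bilinear_map (fun b1 b2 : A => F (a1 ⊗ b1) (a2 ⊗ b2)).
Proof.
move=> Fb; split=> z; first exact: (comp_linear (Fb.1 _) (tensr_linear _)).
exact: (comp_linear (Fb.2 _) (tensr_linear _)).
Qed.

Fact dsum_bilinear_l (X : lmodType k) (F : D -> D -> X) (b1 b2 : A) :
  bilinear_map F -> bilinear_map (fun a1 a2 : A => F (a1 ⊗ b1) (a2 ⊗ b2)).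
Proof.
move=> Fb; split=> z; first exact: (comp_linear (Fb.1 _) (tensl_linear _)).
exact: (comp_linear (Fb.2 _) (tensl_linear _)).
Qed.

Lemma dsum_comul_1l (X : lmodType k) (F : D -> D -> X) (b : A) : bilinear_map F ->
  tensor_sum F (hcomul (hone A ⊗ b : D)) =
  \tsum_(b1, b2 <- hcomul b) F (hone A ⊗ b1) (hone A ⊗ b2).
Proof.
move=> Fb; rewrite (dsum_comul _ _ Fb) (hcomul1 hA) tsum_tens //.
split=> z; apply: tsum_param_linear => b1 b2.
  exact: (dsum_bilinear_l b1 b2 Fb).1.
exact: (dsum_bilinear_l b1 b2 Fb).2.
Qed.

Lemma dsum_comul_1r (X : lmodType k) (F : D -> D -> X) (a : A) : bilinear_map F ->
  tensor_sum F (hcomul (a ⊗ hone A : D)) =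
  \tsum_(a1, a2 <- hcomul a) F (a1 ⊗ hone A) (a2 ⊗ hone A).
Proof.
move=> Fb; rewrite (dsum_comul _ _ Fb) (hcomul1 hA); apply: eq_tsum => a1 a2.
by rewrite tsum_tens //; exact: (dsum_bilinear_r a1 a2 Fb).
Qed.

Fact dcounit_bilinear : bilinear_map (fun a b : A => hcounit a * hcounit b : k^o).
Proof.
split=> [a c x y|b c x y]; rewrite (hcounit_lin hA).
  by rewrite mulrDr [_ *: _]mulrCA.
by rewrite mulrDl -mulrA.
Qed.

Lemma dcounit_linear : linear (@hcounit _ D : D -> k^o).
Proof. exact: (tsum_linear dcounit_bilinear). Qed.

Lemma dcounitE (a b : A) : hcounit (a ⊗ b : D) = hcounit a * hcounit b.
Proof. exact: (tsum_tens dcounit_bilinear). Qed.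

Lemma double_coalgebra : is_coalgebra D.
Proof.
split.
- exact: dcomul_linear.
- exact: dcounit_linear.
- have B1 : bilinear_map (fun a b : D => a ⊗ hcomul b).
    split=> [a|b]; last exact: tensl_linear.
    exact: (comp_linear (tensr_linear _) dcomul_linear).
  have B0 (b : D) : bilinear_map (fun a1 a2 : D => a1 ⊗ (a2 ⊗ b)).
    split=> [a1|a2]; last exact: tensl_linear.
    exact: (comp_linear (tensr_linear _) (tensl_linear _)).
  have B2 : bilinear_map (fun a b : D => \tsum_(a1, a2 <- hcomul a) (a1 ⊗ (a2 ⊗ b))).
    split=> [a|b].
      apply: tsum_param_linear => a1 a2.
      exact: (comp_linear (tensr_linear _) (tensr_linear _)).
    apply: (comp_linear (f := tensor_sum _)); last exact: dcomul_linear.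
    exact: (tsum_linear (B0 b)).
  apply: tens_ext.
  + exact: (comp_linear (tsum_linear B1) dcomul_linear).
  + exact: (comp_linear (tsum_linear B2) dcomul_linear).
  move=> a b; rewrite (dsum_comul a b B1) (dsum_comul a b B2).
  pose G a1 a2 a3 b1 b2 b3 := ((a1 ⊗ b1 : D) ⊗ ((a2 ⊗ b2 : D) ⊗ (a3 ⊗ b3 : D))).
  transitivity (\tsum_(a1, a' <- hcomul a) \tsum_(a2, a3 <- hcomul a')
    \tsum_(b1, b' <- hcomul b) \tsum_(b2, b3 <- hcomul b') G a1 a2 a3 b1 b2 b3).
    apply: eq_tsum => a1 a'; rewrite [RHS]tsum_exchange; apply: eq_tsum => b1 b'.
    rewrite dcomulE (lin_tsum _ _ (tensr_linear _)); apply: eq_tsum => a2 a3.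
    by rewrite (lin_tsum _ _ (tensr_linear _)).
  have Gb a1 a2 a3 : \tsum_(b1, b' <- hcomul b) \tsum_(b2, b3 <- hcomul b')
      G a1 a2 a3 b1 b2 b3 = \tsum_(b', b3 <- hcomul b) \tsum_(b1, b2 <- hcomul b')
      G a1 a2 a3 b1 b2 b3.
    rewrite (coassoc hC (F := G a1 a2 a3)) // => x y.
    - by apply: (comp_linear (f := fun z => z ⊗ _)); [exact: tensl_linear|exact: tensr_linear].
    - apply: (comp_linear (f := fun z => _ ⊗ z)); first exact: tensr_linear.
      by apply: (comp_linear (f := fun z => z ⊗ _)); [exact: tensl_linear|exact: tensr_linear].
    - apply: (comp_linear (f := fun z => _ ⊗ z)); first exact: tensr_linear.
      by apply: (comp_linear (f := fun z => _ ⊗ z)); exact: tensr_linear.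
  rewrite (coassoc hC (F := fun a1 a2 a3 => \tsum_(b1, b' <- hcomul b)
    \tsum_(b2, b3 <- hcomul b') G a1 a2 a3 b1 b2 b3)).
  + apply: eq_tsum => a' a3.
    under eq_tsum => a1 a2 do rewrite Gb.
    rewrite tsum_exchange; apply: eq_tsum => b' b3.
    by rewrite (dsum_comul a' b' (B0 _)).
  + move=> x y; apply: tsum_param_linear => b1 b'; apply: tsum_param_linear => b2 b3.
    by apply: (comp_linear (f := fun z => z ⊗ _)); exact: tensl_linear.
  + move=> x y; apply: tsum_param_linear => b1 b'; apply: tsum_param_linear => b2 b3.
    apply: (comp_linear (f := fun z => _ ⊗ z)); first exact: tensr_linear.
    by apply: (comp_linear (f := fun z => z ⊗ _)); exact: tensl_linear.
  + move=> x y; apply: tsum_param_linear => b1 b'; apply: tsum_param_linear => b2 b3.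
    apply: (comp_linear (f := fun z => _ ⊗ z)); first exact: tensr_linear.
    by apply: (comp_linear (f := fun z => _ ⊗ z)); [exact: tensr_linear|exact: tensl_linear].
- have B1 : bilinear_map (fun a b : D => hcounit a *: b).
    split=> [a|b]; first exact: scale_linear.
    by move=> c x y; rewrite dcounit_linear scalerDl scalerA.
  apply: tens_ext => //.
    exact: (comp_linear (tsum_linear B1) dcomul_linear).
  move=> a b; rewrite (dsum_comul a b B1).
  transitivity (\tsum_(a1, a2 <- hcomul a) (hcounit a1 *: (a2 ⊗ b : D))).
    apply: eq_tsum => a1 a2.
    transitivity (\tsum_(b1, b2 <- hcomul b) (hcounit b1 *: (hcounit a1 *: (a2 ⊗ b2 : D)))).
      by apply: eq_tsum => b1 b2; rewrite dcounitE scalerA mulrC.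
    apply: (counit_suml hC (f := fun b2 => hcounit a1 *: (a2 ⊗ b2 : D))).
    exact: (comp_linear (@scale_linear _ _ _) (tensr_linear _)).
  exact: (counit_suml hC (f := fun a2 => a2 ⊗ b : D) _ (tensl_linear _)).
- have B1 : bilinear_map (fun a b : D => hcounit b *: a).
    split=> [a|b]; last exact: scale_linear.
    by move=> c x y; rewrite dcounit_linear scalerDl scalerA.
  apply: tens_ext => //.
    exact: (comp_linear (tsum_linear B1) dcomul_linear).
  move=> a b; rewrite (dsum_comul a b B1).
  transitivity (\tsum_(a1, a2 <- hcomul a) (hcounit a2 *: (a1 ⊗ b : D))).
    apply: eq_tsum => a1 a2.
    transitivity (\tsum_(b1, b2 <- hcomul b) (hcounit b2 *: (hcounit a2 *: (a1 ⊗ b1 : D)))).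
      by apply: eq_tsum => b1 b2; rewrite dcounitE scalerA mulrC.
    apply: (counit_sumr hC (f := fun b1 => hcounit a2 *: (a1 ⊗ b1 : D))).
    exact: (comp_linear (@scale_linear _ _ _) (tensr_linear _)).
  exact: (counit_sumr hC (f := fun a1 => a1 ⊗ b : D) _ (tensl_linear _)).
- by exists (hone A ⊗ hone A); rewrite dcounitE (hcounit1 hA) mulr1.
Qed.

End DoubleCoalgebra.

(** * The algebra of the quantum double *)

Section DoubleAlgebra.
Variables (k : fieldType) (A : hopf_data k) (hA : is_hopf A) (r : A -> A -> k).
Hypothesis hr : is_coquasitriangular r.
Let hC := hopf_coalgebra hA.
Let hD := double_coalgebra hA r.
Local Notation D := (quantum_double r).
Local Notation C1 := (conv_alg k^o hC).
Local Notation C2 := (conv_alg C1 hC).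
Local Notation D1 := (conv_alg k^o hD).
Local Notation "a ·· b" := (hmul a b) (at level 40, left associativity).
Local Notation R := (lamform hA hr).
Local Notation Ri := (lamiform hA hr).

Definition dmul_pure (a b c d : A) : D :=
  \tsum_(b1, b' <- hcomul b) \tsum_(b2, b3 <- hcomul b')
    \tsum_(c1, c' <- hcomul c) \tsum_(c2, c3 <- hcomul c')
      (rinv r b1 c1 * r b3 c3) *: ((a ·· c2) ⊗ (b2 ·· d)).

Lemma hmull_linear (b : A) : linear (fun a : A => a ·· b).
Proof. exact: hmul_linl. Qed.
Lemma hmulr_linear (a : A) : linear (fun b : A => a ·· b).
Proof. exact: hmul_linr. Qed.

Lemma dmul_pure_lin1 b c d : linear (fun a => dmul_pure a b c d).
Proof.
do 4! apply: tsum_param_linear => ? ?; apply: comp_linear; first exact: scale_linear.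
by apply: (comp_linear (f := fun z => z ⊗ _)); [exact: tensl_linear|exact: hmull_linear].
Qed.

Lemma dmul_pure_lin4 a b c : linear (fun d => dmul_pure a b c d).
Proof.
do 4! apply: tsum_param_linear => ? ?; apply: comp_linear; first exact: scale_linear.
by apply: (comp_linear (f := fun z => _ ⊗ z)); [exact: tensr_linear|exact: hmulr_linear].
Qed.

Lemma scaler_lin (V W : lmodType k) (f : V -> k^o) (w : W) :
  linear f -> linear (fun v => f v *: w).
Proof. by move=> fl c x y; rewrite fl scalerDl scalerA. Qed.

Lemma mulr_linl (V : lmodType k) (f : V -> k^o) (c : k) :
  linear f -> linear (fun v => f v * c : k^o).
Proof. by move=> fl d x y; rewrite fl mulrDl -mulrA. Qed.

Lemma mulr_linr (V : lmodType k) (f : V -> k^o) (c : k) :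
  linear f -> linear (fun v => c * f v : k^o).
Proof. by move=> fl d x y; rewrite fl mulrDr; congr (_ + _); exact: mulrCA. Qed.

Lemma dmul_pure_lin2 a c d : linear (fun b => dmul_pure a b c d).
Proof.
apply: (comul_sum_linear hC); split=> [b1|b'].
  apply: (comul_sum_linear hC); split=> [b2|b3]; do 2! apply: tsum_param_linear => ? ?.
    apply: scaler_lin; apply: mulr_linr; exact: (r_linl hr).
  apply: comp_linear; first exact: scale_linear.
  by apply: (comp_linear (f := fun z => _ ⊗ z)); [exact: tensr_linear|exact: hmull_linear].
do 3! apply: tsum_param_linear => ? ?.
apply: scaler_lin; apply: (mulr_linl (f := fun b1 => rinv r b1 _)).
exact: (rinv_linl hA hr).
Qed.

Lemma dmul_pure_lin3 a b d : linear (fun c => dmul_pure a b c d).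
Proof.
do 2! apply: tsum_param_linear => ? ?.
apply: (comul_sum_linear hC); split=> [c1|c'].
  apply: (comul_sum_linear hC); split=> [c2|c3].
    apply: scaler_lin; apply: mulr_linr; exact: (r_linr hr).
  apply: comp_linear; first exact: scale_linear.
  by apply: (comp_linear (f := fun z => z ⊗ _)); [exact: tensl_linear|exact: hmulr_linear].
apply: tsum_param_linear => ? ?.
apply: scaler_lin; apply: (mulr_linl (f := fun b1 => rinv r _ b1)).
exact: (rinv_linr hA hr).
Qed.

Lemma dmul_sumE (x y : D) :
  hmul x y = \tsum_(a, b <- x) \tsum_(c, d <- y) dmul_pure a b c d.
Proof. by rewrite /= /qdouble_mul (conv_inv_r hA hr). Qed.

Lemma dmul_bilinear : bilinear_map (@hmul _ D).
Proof.
have B a b : bilinear_map (dmul_pure a b).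
  by split=> ?; [exact: dmul_pure_lin4|exact: dmul_pure_lin3].
have E : @hmul _ D = fun x y => \tsum_(a, b <- x) \tsum_(c, d <- y) dmul_pure a b c d.
  by apply: funext => x; apply: funext => y; rewrite dmul_sumE.
rewrite E; split=> [x|y].
  by apply: tsum_param_linear => a b; exact: (tsum_linear (B a b)).
apply: (tsum_linear (f := fun a b => _)).
by split=> ?; apply: tsum_param_linear => c d; [exact: dmul_pure_lin2|exact: dmul_pure_lin1].
Qed.

Lemma dmulE a b c d : hmul (a ⊗ b : D) (c ⊗ d : D) = dmul_pure a b c d.
Proof.
have B x y : bilinear_map (dmul_pure x y).
  by split=> ?; [exact: dmul_pure_lin4|exact: dmul_pure_lin3].
rewrite dmul_sumE tsum_tens; first by rewrite (tsum_tens (B a b)).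
by split=> ?; apply: tsum_param_linear => ? ?; [exact: dmul_pure_lin2|exact: dmul_pure_lin1].
Qed.

Fact twist_bilinear (phi : D1) a d :
  bilinear_map (fun b c : A => phi ((a ·· c) ⊗ (b ·· d) : D)).
Proof.
split=> [b|c].
  apply: (comp_linear (f := phi)); first exact: cv_linear.
  by apply: (comp_linear (f := fun z => z ⊗ _)); [exact: tensl_linear|exact: hmulr_linear].
apply: (comp_linear (f := phi)); first exact: cv_linear.
by apply: (comp_linear (f := fun z => _ ⊗ z)); [exact: tensr_linear|exact: hmull_linear].
Qed.

(** For fixed outer legs a and d, the functional phi evaluated at the naive
   product (a c) (x) (b d), as a form in the inner legs b and c. *)
Definition twist (phi : D1) a d : C2 := cv2_of hC (twist_bilinear phi a d).

(** In the middle two legs the product of the double is the tensor product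
   conjugated by the r-form. *)
Lemma dmul_eval (phi : D1) a b c d :
  phi (hmul (a ⊗ b : D) (c ⊗ d : D)) = (Ri * (twist phi a d * R)) b c.
Proof.
rewrite dmulE cv2M (lin_tsum _ _ (cv_linear phi)); apply: eq_tsum => b1 b'.
transitivity (\tsum_(b2, b3 <- hcomul b') \tsum_(c1, c' <- hcomul c)
   \tsum_(c2, c3 <- hcomul c')
   (rinv r b1 c1 * (twist phi a d b2 c2 * r b3 c3) : k^o)).
  rewrite (lin_tsum _ _ (cv_linear phi)); apply: eq_tsum => b2 b3.
  rewrite (lin_tsum _ _ (cv_linear phi)); apply: eq_tsum => c1 c'.
  rewrite (lin_tsum _ _ (cv_linear phi)); apply: eq_tsum => c2 c3.
  by rewrite (linZ (cv_linear phi)) [_ *: _]mulrAC mulrA.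
rewrite [LHS]tsum_exchange.
apply: eq_tsum => c1 c'; rewrite cv2M.
rewrite (lin_tsum _ _ (g := fun z : k^o => Ri b1 c1 * z : k^o)).
  apply: eq_tsum => b2 b3.
  rewrite (lin_tsum _ _ (g := fun z : k^o => Ri b1 c1 * z : k^o)) //.
  by move=> ? ? ?; rewrite mulrDr; congr (_ + _); exact: mulrCA.
by move=> ? ? ?; rewrite mulrDr; congr (_ + _); exact: mulrCA.
Qed.

Lemma dsum_conv (phi psi : D1) (a b : A) : (phi * psi) (a ⊗ b : D) =
  \tsum_(a1, a2 <- hcomul a) \tsum_(b1, b2 <- hcomul b)
    (phi (a1 ⊗ b1 : D) * psi (a2 ⊗ b2 : D)).
Proof. by rewrite cvM (dsum_comul hA a b (conv_bilinear phi psi)). Qed.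

Lemma d1_ext (phi psi : D1) :
  (forall a b, phi (a ⊗ b : D) = psi (a ⊗ b : D)) -> phi = psi.
Proof.
move=> E; apply: cvP; apply: (tens_ext _ _ E).
  exact: (cv_linear phi).
exact: (cv_linear psi).
Qed.

Fact dmul_form_bilinear (phi psi : D1) (x1 x2 : D) :
  bilinear_map (fun y1 y2 => phi (hmul x1 y1) * psi (hmul x2 y2) : k^o).
Proof.
split=> ?.
  apply: (mulr_linr (f := fun y => psi (hmul x2 y))).
  by apply: (comp_linear (f := psi)); [exact: cv_linear|exact: dmul_bilinear.1].
apply: (mulr_linl (f := fun y => phi (hmul x1 y))).
by apply: (comp_linear (f := phi)); [exact: cv_linear|exact: dmul_bilinear.1].
Qed.

Fact dmul_form_bilinear_l (phi psi : D1) (y : D) :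
  bilinear_map (fun x1 x2 : D =>
    \tsum_(y1, y2 <- hcomul y) (phi (hmul x1 y1) * psi (hmul x2 y2) : k^o)).
Proof.
split=> ?; apply: tsum_param_linear => y1 y2.
  apply: (mulr_linr (f := fun x => psi (hmul x y2))).
  by apply: (comp_linear (f := psi)); [exact: cv_linear|exact: dmul_bilinear.2].
apply: (mulr_linl (f := fun x => phi (hmul x y1))).
by apply: (comp_linear (f := phi)); [exact: cv_linear|exact: dmul_bilinear.2].
Qed.

Lemma twist_mul (phi psi : D1) a d :
  twist (phi * psi) a d = \tsum_(a1, a2 <- hcomul a) \tsum_(d1, d2 <- hcomul d)
    (twist phi a1 d1 * twist psi a2 d2).
Proof.
apply: cv2P => b c; rewrite /tensor_sum 2!cv_sumE.
transitivity (\tsum_(a1, a2 <- hcomul a) \tsum_(d1, d2 <- hcomul d)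
   (twist phi a1 d1 * twist psi a2 d2) b c); last first.
  by apply: eq_bigr => p _; rewrite /tensor_sum 2!cv_sumE.
transitivity ((phi * psi) ((a ·· c) ⊗ (b ·· d) : D)); first by [].
have Bc u1 u2 : bilinear_map (fun x y : A => phi (u1 ⊗ x : D) * psi (u2 ⊗ y : D) : k^o).
  split=> ?.
    apply: (mulr_linr (f := fun y => psi (u2 ⊗ y : D))).
    by apply: (comp_linear (f := psi)); [exact: cv_linear|exact: tensr_linear].
  apply: (mulr_linl (f := fun y => phi (u1 ⊗ y : D))).
  by apply: (comp_linear (f := phi)); [exact: cv_linear|exact: tensr_linear].
have Bd v : bilinear_map (fun x y : A =>
    \tsum_(v1, v2 <- hcomul v) (phi (x ⊗ v1 : D) * psi (y ⊗ v2 : D) : k^o)).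
  split=> ?; apply: tsum_param_linear => v1 v2.
    apply: (mulr_linr (f := fun y => psi (y ⊗ v2 : D))).
    by apply: (comp_linear (f := psi)); [exact: cv_linear|exact: tensl_linear].
  apply: (mulr_linl (f := fun y => phi (y ⊗ v1 : D))).
  by apply: (comp_linear (f := phi)); [exact: cv_linear|exact: tensl_linear].
rewrite dsum_conv (tsum_mul hA _ _ (Bd _)); apply: eq_tsum => a1 a2.
rewrite -[RHS](eq_tsum _ (f := fun d1 d2 => \tsum_(c1, c2 <- hcomul c)
   \tsum_(b1, b2 <- hcomul b)
   (phi ((a1 ·· c1) ⊗ (b1 ·· d1) : D) * psi ((a2 ·· c2) ⊗ (b2 ·· d2) : D)))); last first.
  by move=> d1 d2; rewrite cv2M tsum_exchange.
rewrite tsum_exchange; apply: eq_tsum => c1 c2.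
by rewrite (tsum_mul hA _ _ (Bc _ _)) tsum_exchange.
Qed.

(** The coproduct of the double is multiplicative; on functionals this
   follows from [dmul_eval], where the conjugation by the r-form cancels
   between neighbouring factors. *)
Lemma dcomulM (phi psi : D1) (x y : D) : (phi * psi) (hmul x y) =
  \tsum_(x1, x2 <- hcomul x) \tsum_(y1, y2 <- hcomul y)
    (phi (hmul x1 y1) * psi (hmul x2 y2)).
Proof.
pose G x y := \tsum_(x1, x2 <- hcomul (x : D)) \tsum_(y1, y2 <- hcomul (y : D))
    (phi (hmul x1 y1) * psi (hmul x2 y2) : k^o).
have Gl y' : linear (G ^~ y').
  apply: (comul_sum_linear hD); exact: dmul_form_bilinear_l.
have Gr x' : linear (G x').
  apply: tsum_param_linear => x1 x2; apply: (comul_sum_linear hD).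
  exact: dmul_form_bilinear.
suff E a b c d : (phi * psi) (hmul (a ⊗ b : D) (c ⊗ d : D)) = G (a ⊗ b) (c ⊗ d).
  have Hl z : linear (fun x : D => (phi * psi) (hmul x z)).
    by apply: (comp_linear (f := phi * psi)); [exact: cv_linear|exact: dmul_bilinear.2].
  have Hr z : linear (fun y : D => (phi * psi) (hmul z y)).
    by apply: (comp_linear (f := phi * psi)); [exact: cv_linear|exact: dmul_bilinear.1].
  apply: (tens_ext (Hl y) (Gl y)) => a b.
  exact: (tens_ext (Hr _) (Gr _)).
rewrite dmul_eval twist_mul.
transitivity (\tsum_(a1, a2 <- hcomul a) \tsum_(d1, d2 <- hcomul d)
  ((Ri * (twist phi a1 d1 * R)) * (Ri * (twist psi a2 d2 * R))) b c).
  have RRi : R * Ri = 1 := lam_lami hA hr.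
  rewrite /tensor_sum mulr_suml mulr_sumr 2!cv_sumE; apply: eq_bigr => p _.
  rewrite mulr_suml mulr_sumr 2!cv_sumE; apply: eq_bigr => p' _.
  by rewrite !mulrA -(mulrA (Ri * _) R) RRi mulr1.
rewrite /G (dsum_comul hA a b (dmul_form_bilinear_l _ _ _)).
apply: eq_tsum => a1 a2.
under [RHS]eq_tsum => b1 b2 do
  rewrite (dsum_comul hA c d (dmul_form_bilinear _ _ _ _)).
rewrite -[LHS](eq_tsum _ (f := fun d1 d2 => \tsum_(c1, c2 <- hcomul c)
   \tsum_(b1, b2 <- hcomul b) (phi (hmul (a1 ⊗ b1 : D) (c1 ⊗ d1 : D)) *
      psi (hmul (a2 ⊗ b2 : D) (c2 ⊗ d2 : D))))); last first.
  move=> d1 d2; rewrite cv2M tsum_exchange; apply: eq_tsum => c1 c2.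
  by apply: eq_tsum => b1 b2; rewrite !dmul_eval.
rewrite tsum_exchange [RHS]tsum_exchange; apply: eq_tsum => c1 c2.
by rewrite tsum_exchange.
Qed.

End DoubleAlgebra.

(** * The FRT-dual of the quantum double *)

Section DoubleDual.
Variables (k : fieldType) (A : hopf_data k) (hA : is_hopf A) (r : A -> A -> k).
Hypothesis hr : is_coquasitriangular r.
Hypothesis antip_comul : forall x : A,
  hcomul (hantip x) = \tsum_(a, b <- hcomul x) (hantip b ⊗ hantip a).
Let hC := hopf_coalgebra hA.
Let hD := double_coalgebra hA r.
Local Notation D := (quantum_double r).
Local Notation C1 := (conv_alg k^o hC).
Local Notation C2 := (conv_alg C1 hC).
Local Notation K2 := (conv_alg C2 hC).
Local Notation D1 := (conv_alg k^o hD).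
Local Notation "a ·· b" := (hmul a b) (at level 40, left associativity).
Local Notation R := (lamform hA hr).
Local Notation Ri := (lamiform hA hr).
Local Notation lam := (lam hA hr).
Local Notation rho := (rho hA hr).
Local Notation rhoi := (rhoi hA hr).
Local Notation lami := (lami hA hr).

Definition dual_of (f : A -> A -> k^o) (fb : bilinear_map f) : D1 :=
  cv_of hD (tsum_linear fb : linear (tensor_sum f : D -> k^o)).

Lemma dual_ofE f (fb : bilinear_map f) a b : dual_of fb (a ⊗ b : D) = f a b.
Proof. exact: (tsum_tens fb). Qed.

Fact cross_bilinear (e : A) : bilinear_map (fun a b => (rhoi a * lam b) e).
Proof.
split=> [a c x y|b c x y].
  by rewrite (lam_linear hA hr) mulrDr -scalerAr.
by rewrite (rhoi_linear hA hr) mulrDl -scalerAl.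
Qed.

(** The first family of generators: pairings of a lower with an upper
   l-functional, taken at an element e. *)
Definition cross (e : A) : D1 := dual_of (cross_bilinear e).

Lemma crossE e a b : cross e (a ⊗ b : D) = (rhoi a * lam b) e.
Proof. exact: dual_ofE. Qed.

Definition dprod (x : D) : A := \tsum_(a, b <- x) (a ·· b).

Lemma dprod_linear : linear dprod.
Proof. exact: (tsum_linear (hmul_bilinear hA)). Qed.

Lemma dprodE a b : dprod (a ⊗ b) = a ·· b.
Proof. exact: (tsum_tens (hmul_bilinear hA)). Qed.

(** The second family, the functionals that factor through the
   multiplication of A; the multiplication is multiplicative on the double. *)
Definition through (g : C1) : D1 :=
  cv_of hD (comp_linear (cv_linear g) dprod_linear).

Lemma throughE g x : through g x = g (dprod x). Proof. by []. Qed.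

Fact scalar2_bilinear (f : C2) : bilinear_map (fun b c => (f b c : k) *: (1 : C1)).
Proof.
split=> [b|c]; apply: scaler_lin; first exact: cv_linear.
exact: (cv2_bilinear f).2.
Qed.

Definition scalar2 (f : C2) : K2 := cv2_of hC (scalar2_bilinear f).

Lemma scalar2E (f : C2) b c : scalar2 f b c = (f b c : k) *: (1 : C1). Proof. by []. Qed.

Lemma scalar2M f g : scalar2 f * scalar2 g = scalar2 (f * g).
Proof.
apply: cv2P => b c; rewrite cv2M scalar2E cv2M.
rewrite (lin_tsum _ _ (g := fun z : k^o => (z : k) *: (1 : C1))).
  apply: eq_tsum => b1 b2; rewrite (lin_tsum _ _ (g := fun z : k^o => (z : k) *: (1 : C1))).
    by apply: eq_tsum => c1 c2; rewrite !scalar2E -scalerAl mul1r scalerA.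
  by move=> ? ? ?; rewrite scalerDl scalerA.
by move=> ? ? ?; rewrite scalerDl scalerA.
Qed.

Lemma scalar2_1 : scalar2 1 = 1.
Proof.
by apply: cv2P => b c; rewrite cv2_1 scalar2E cv2_1 [(_ * _) *: (1 : k^o)]mulr1.
Qed.

(** The commutation rule of A, seen through r (b, -). *)
Lemma comm_eval (b c e : A) :
  \tsum_(c1, c2 <- hcomul c) \tsum_(e1, e2 <- hcomul e)
     (r b (c1 ·· e1) * r e2 c2 : k^o) =
  \tsum_(c1, c2 <- hcomul c) \tsum_(e1, e2 <- hcomul e)
     (r e1 c1 * r b (e2 ·· c2)).
Proof.
have := congr1 (r b : A -> k^o) (cqt_comm hr e c).
rewrite !(lin_tsum _ _ (r_linr hr b)) => E.
rewrite tsum_exchange [RHS]tsum_exchange.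
transitivity (\tsum_(e1, e2 <- hcomul e) (r b : A -> k^o)
    (\tsum_(c1, c2 <- hcomul c) (r e2 c2 *: (c1 ·· e1)))).
  apply: eq_tsum => e1 e2; rewrite (lin_tsum _ _ (r_linr hr b)).
  by apply: eq_tsum => c1 c2; rewrite (linZ (r_linr hr b)) [_ *: _]mulrC.
rewrite -E; apply: eq_tsum => e1 e2; rewrite (lin_tsum _ _ (r_linr hr b)).
by apply: eq_tsum => c1 c2; rewrite (linZ (r_linr hr b)).
Qed.

(** Both sides compute r (b, -) on the two sides of the commutation rule of
   A, as r is antimultiplicative in its second variable. *)
Lemma yang_baxter :
  legl (lamform hA hr) * scalar2 R * legr (rhoform hA hr) =
  legr (rhoform hA hr) * scalar2 R * legl (lamform hA hr).
Proof.
apply: cv2P => b c; rewrite mul_legr mul_legl; apply: cvP => e.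
rewrite !cv_tsumE.
transitivity (\tsum_(c1, c2 <- hcomul c) \tsum_(e1, e2 <- hcomul e)
     (r b (c1 ·· e1) * r e2 c2 : k^o)).
  apply: eq_tsum => c1 c2; rewrite legl_mul_l cvM.
  apply: eq_tsum => e1 e2; congr (_ * _); rewrite (cqt_mulr hr) cv_tsumE.
  by apply: eq_tsum => b1 b2; rewrite scalar2E -scalerAr mulr1 cvZ [_ *: _]mulrC.
rewrite comm_eval.
transitivity (\tsum_(b1, b2 <- hcomul b) \tsum_(c1, c2 <- hcomul c)
   \tsum_(e1, e2 <- hcomul e) (r e1 c1 * (r b1 c2 * r b2 e2) : k^o)).
  rewrite [RHS]tsum_exchange; apply: eq_tsum => c1 c2.
  rewrite [RHS]tsum_exchange; apply: eq_tsum => e1 e2.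
  by rewrite (cqt_mulr hr) mulr_tsumr.
apply: eq_tsum => b1 b2; rewrite legr_mul_l cvM.
rewrite tsum_exchange; apply: eq_tsum => e1 e2.
rewrite cv_tsumE mulr_tsuml; apply: eq_tsum => c1 c2.
by rewrite scalar2E -scalerAr mulr1 cvZ [_ *: _]mulrC mulrA.
Qed.

(** The Yang-Baxter equation with one of its factors moved to the other side
   by inversion; this is the form in which conjugation by r exchanges the
   two kinds of l-functionals. *)
Lemma cross_exchange :
  scalar2 Ri * (legr (rhoiform hA hr) * legl (lamform hA hr) * scalar2 R) =
  legl (lamform hA hr) * legr (rhoiform hA hr).
Proof.
have S1 : scalar2 Ri * scalar2 R = 1 by rewrite scalar2M (lami_lam hA hr) scalar2_1.
have W1 : legr (rhoiform hA hr) * legr (rhoform hA hr) = 1.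
  by rewrite legr_mul (rhoi_rho hA hr) legr1.
have W2 : legr (rhoform hA hr) * legr (rhoiform hA hr) = 1.
  by rewrite legr_mul (rho_rhoi hA hr) legr1.
have YB := yang_baxter; set L := legl _ in YB *; set S := scalar2 R in YB S1 *.
set W := legr (rhoform hA hr) in YB W1 W2 *; set Wi := legr _ in W1 W2 *.
have E : Wi * L * S = S * L * Wi.
  rewrite -[LHS]mulr1 -W2 !mulrA -(mulrA (Wi * L * S)) -!mulrA (mulrA L) (mulrA (L * S)).
  by rewrite YB !mulrA W1 mul1r.
by rewrite E !mulrA S1 mul1r.
Qed.

Lemma cross_mul_pure e a b c d :
  cross e (hmul (a ⊗ b : D) (c ⊗ d : D)) = (rhoi a * lam b * (rhoi c * lam d)) e.
Proof.
transitivity ((rhoi a * (scalar2 Ri * (legr (rhoiform hA hr) *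
    legl (lamform hA hr) * scalar2 R)) b c * lam d) e); last first.
  by rewrite cross_exchange leglr !mulrA.
rewrite (dmul_eval hr).
rewrite 2!cv2M mulr_tsumr mulr_tsuml cv_tsumE; apply: eq_tsum => b1 b'.
rewrite mulr_tsumr mulr_tsuml cv_tsumE; apply: eq_tsum => c1 c'.
rewrite scalar2E -scalerAl mul1r -scalerAr -scalerAl cvZ; congr (_ * _).
rewrite 2!cv2M mulr_tsumr mulr_tsuml cv_tsumE; apply: eq_tsum => b2 b3.
rewrite mulr_tsumr mulr_tsuml cv_tsumE; apply: eq_tsum => c2 c3.
rewrite scalar2E -scalerAr mulr1 -scalerAr -scalerAl cvZ [_ *: _]mulrC; congr (_ * _).
rewrite legrl -[LHS]/(cross e ((a ·· c2) ⊗ (b2 ·· d) : D)).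
by rewrite crossE (rhoiM hA hr antip_comul) lamM !mulrA.
Qed.

(** The exchange rule turns the twisted product of the double into the
   convolution product of functionals of e. *)
Lemma cross_mul e (x y : D) :
  cross e (hmul x y) = \tsum_(e1, e2 <- hcomul e) (cross e1 x * cross e2 y).
Proof.
have crossl u : linear (cross u : D -> k^o) by exact: cv_linear.
have Hl z : linear (fun x : D => cross e (hmul x z)).
  by apply: (comp_linear (crossl e)); exact: (dmul_bilinear hA hr).2.
have Hr z : linear (fun y : D => cross e (hmul z y)).
  by apply: (comp_linear (crossl e)); exact: (dmul_bilinear hA hr).1.
pose G (x y : D) := \tsum_(e1, e2 <- hcomul e) (cross e1 x * cross e2 y : k^o).
have Gl z : linear (G ^~ z).
  apply: tsum_param_linear => e1 e2; apply: (mulr_linl (f := fun x => cross e1 x)).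
  exact: crossl.
have Gr z : linear (G z).
  apply: tsum_param_linear => e1 e2; apply: (mulr_linr (f := fun x => cross e2 x)).
  exact: crossl.
apply: (tens_ext (Hl y) (Gl y)) => a b; apply: (tens_ext (Hr _) (Gr _)) => c d.
rewrite cross_mul_pure cvM; apply: eq_tsum => e1 e2.
by rewrite !crossE.
Qed.

Lemma through_mul (g : C1) (x y : D) :
  through g (hmul x y) = g (dprod x ·· dprod y).
Proof.
have gl : linear (g : A -> k^o) by exact: cv_linear.
have tl : linear (through g : D -> k^o) by exact: cv_linear.
have Hl z : linear (fun x : D => through g (hmul x z)).
  by apply: (comp_linear tl); exact: (dmul_bilinear hA hr).2.
have Hr z : linear (fun y : D => through g (hmul z y)).
  by apply: (comp_linear tl); exact: (dmul_bilinear hA hr).1.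
have Gl z : linear (fun x : D => g (dprod x ·· dprod z)).
  apply: (comp_linear gl); apply: (comp_linear (f := fun u => u ·· _)).
    exact: hmull_linear.
  exact: dprod_linear.
have Gr z : linear (fun y : D => g (dprod z ·· dprod y)).
  by apply: (comp_linear gl); apply: (comp_linear (hmulr_linear hA _)); exact: dprod_linear.
apply: (tens_ext (Hl y) (Gl y)) => a b; apply: (tens_ext (Hr _) (Gr _)) => c d.
rewrite !dprodE (dmul_eval hr).
have F2_bil : bilinear_map (fun b c => g ((a ·· (b ·· c)) ·· d)).
  split=> u; apply: (comp_linear gl); apply: (comp_linear (f := fun v => v ·· d));
    (try exact: hmull_linear); apply: (comp_linear (hmulr_linear hA _)).
    exact: hmulr_linear.
  exact: hmull_linear.
pose F2 : C2 := cv2_of hC F2_bil.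
have gal : linear (fun u => g ((a ·· u) ·· d)).
  apply: (comp_linear gl); apply: (comp_linear (f := fun v => v ·· d)).
    exact: hmull_linear.
  exact: hmulr_linear.
have -> : twist (through g) a d * R = R * F2.
  apply: cv2P => b' c'; rewrite !cv2M.
  have := congr1 (fun u => g ((a ·· u) ·· d) : k^o) (esym (cqt_comm hr b' c')).
  rewrite /= !(lin_tsum _ _ gal) => E.
  transitivity (\tsum_(a1, a2 <- hcomul b') g ((a ·· \tsum_(b1, b2 <- hcomul c')
       (r a2 b2 *: (b1 ·· a1))) ·· d) : k^o).
    apply: eq_tsum => b1 b2; rewrite (lin_tsum _ _ gal); apply: eq_tsum => c1 c2.
    rewrite (linZ gal) [_ *: _]mulrC; congr (_ * _).
    rewrite -[LHS]/(g (dprod ((a ·· c1) ⊗ (b1 ·· d)))) dprodE.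
    by rewrite !(hmulA hA).
  rewrite E; apply: eq_tsum => b1 b2; rewrite (lin_tsum _ _ gal).
  by apply: eq_tsum => c1 c2; rewrite (linZ gal).
rewrite mulrA (lami_lam hA hr) mul1r.
by rewrite -[LHS]/(g ((a ·· (b ·· c)) ·· d)) !(hmulA hA).
Qed.

Lemma dantip_linear : linear (@hantip _ D).
Proof.
apply: tsum_linear; split=> [a|b].
  apply: (comp_linear (f := fun z : D => hmul z (hantip a ⊗ hone A : D))).
    exact: (dmul_bilinear hA hr).2.
  by apply: (comp_linear (tensr_linear _)); exact: hantip_lin.
apply: (comp_linear (f := fun z : D => hmul (hone A ⊗ hantip b : D) z)).
  exact: (dmul_bilinear hA hr).1.
by apply: (comp_linear (f := fun z => z ⊗ hone A)); [exact: tensl_linear|exact: hantip_lin].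
Qed.

Lemma dantipE a b : hantip (a ⊗ b : D) =
  hmul (hone A ⊗ hantip b : D) (hantip a ⊗ hone A : D).
Proof.
apply: (tsum_tens (f := fun a b : A =>
  hmul (hone A ⊗ hantip b : D) (hantip a ⊗ hone A : D))).
split=> [x|y].
  apply: (comp_linear (f := fun z : D => hmul z (hantip x ⊗ hone A : D))).
    exact: (dmul_bilinear hA hr).2.
  by apply: (comp_linear (tensr_linear _)); exact: hantip_lin.
apply: (comp_linear (f := fun z : D => hmul (hone A ⊗ hantip y : D) z)).
  exact: (dmul_bilinear hA hr).1.
by apply: (comp_linear (f := fun z => z ⊗ hone A)); [exact: tensl_linear|exact: hantip_lin].
Qed.

(** The antipode of the double reverses convolution products of functionals. *)
Lemma conv_dantip (phi psi : D1) (x : D) : (phi * psi) (hantip x) =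
  \tsum_(x1, x2 <- hcomul x) (psi (hantip x1) * phi (hantip x2)).
Proof.
have antl (u : D1) : linear (fun x : D => u (hantip x)).
  by apply: (comp_linear (f := u)); [exact: cv_linear|exact: dantip_linear].
have B : bilinear_map (fun x1 x2 : D => psi (hantip x1) * phi (hantip x2) : k^o).
  split=> z.
    by apply: (mulr_linr (f := fun x2 => phi (hantip x2))); exact: antl.
  by apply: (mulr_linl (f := fun x2 => psi (hantip x2))); exact: antl.
apply: (tens_ext (antl _) (g := fun x : D => tensor_sum _ (hcomul x))).
  exact: (comul_sum_linear hD B).
move=> a b; rewrite (dsum_comul hA a b B).
rewrite dantipE (dcomulM hr).
rewrite (dsum_comul_1l hA _ (dmul_form_bilinear_l hr phi psi _)).
transitivity (\tsum_(b1, b2 <- hcomul (hantip b)) \tsum_(a1, a2 <- hcomul (hantip a))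
    (phi (hmul (hone A ⊗ b1 : D) (a1 ⊗ hone A : D)) *
     psi (hmul (hone A ⊗ b2 : D) (a2 ⊗ hone A : D)) : k^o)).
  apply: eq_tsum => b1 b2.
  exact: (dsum_comul_1r hA _ (dmul_form_bilinear hr phi psi _ _)).
rewrite (tsum_antip antip_comul); last first.
  split=> z; apply: tsum_param_linear => a1 a2.
    apply: (comp_linear (f := fun x => phi _ * psi (hmul x _) : k^o)); last exact: tensr_linear.
    apply: (mulr_linr (f := fun x => psi (hmul x _))); apply: (comp_linear (cv_linear psi)).
    exact: (dmul_bilinear hA hr).2.
  apply: (comp_linear (f := fun x => phi (hmul x _) * psi _ : k^o)); last exact: tensr_linear.
  apply: (mulr_linl (f := fun x => phi (hmul x _))); apply: (comp_linear (cv_linear phi)).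
  exact: (dmul_bilinear hA hr).2.
rewrite [RHS]tsum_exchange; apply: eq_tsum => b1 b2.
rewrite (tsum_antip antip_comul); last first.
  split=> z.
    apply: (comp_linear (f := fun x => phi _ * psi (hmul _ x) : k^o)); last exact: tensl_linear.
    apply: (mulr_linr (f := fun x => psi (hmul _ x))); apply: (comp_linear (cv_linear psi)).
    exact: (dmul_bilinear hA hr).1.
  apply: (comp_linear (f := fun x => phi (hmul _ x) * psi _ : k^o)); last exact: tensl_linear.
  apply: (mulr_linl (f := fun x => phi (hmul _ x))); apply: (comp_linear (cv_linear phi)).
  exact: (dmul_bilinear hA hr).1.
by apply: eq_tsum => a1 a2; rewrite !dantipE mulrC.
Qed.

End DoubleDual.

Section DoubleGenerators.
Variables (k : fieldType) (A : hopf_data k) (hA : is_hopf A) (r : A -> A -> k).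
Hypothesis hr : is_coquasitriangular r.
Hypothesis antip_comul : forall x : A,
  hcomul (hantip x) = \tsum_(a, b <- hcomul x) (hantip b ⊗ hantip a).
Let hC := hopf_coalgebra hA.
Let hD := double_coalgebra hA r.
Local Notation D := (quantum_double r).
Local Notation C1 := (conv_alg k^o hC).
Local Notation C2 := (conv_alg C1 hC).
Local Notation D1 := (conv_alg k^o hD).
Local Notation "a ·· b" := (hmul a b) (at level 40, left associativity).
Local Notation R := (lamform hA hr).
Local Notation Ri := (lamiform hA hr).
Local Notation lam := (lam hA hr).
Local Notation rho := (rho hA hr).
Local Notation rhoi := (rhoi hA hr).
Local Notation lami := (lami hA hr).
Local Notation cross := (cross hA hr).
Local Notation through := (@through k A hA r).

Lemma lam1 : lam (hone A) = 1.
Proof. by apply: cvP => x; rewrite cv1 [_ *: _]mulr1; exact: (cqt_1l hr). Qed.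
Lemma rhoi1 : rhoi (hone A) = 1.
Proof. by apply: cvP => x; rewrite cv1 [_ *: _]mulr1; exact: (rinv_1r hA hr). Qed.

(** The two factors are reversed by the antipode of the double and again by
   the exchange rule, so that [cross] is invariant. *)
Lemma cross_antip e x : cross (hantip e) (hantip x) = cross e x.
Proof.
have cl u : linear (cross u : D -> k^o) by exact: cv_linear.
apply: (tens_ext (comp_linear (cl _) (dantip_linear hA hr)) (cl e)) => a b.
rewrite (dantipE hA hr) (cross_mul hA hr antip_comul).
rewrite (tsum_antip antip_comul); last first.
  split=> z.
    apply: (mulr_linr (f := fun u => cross u (hantip a ⊗ hone A : D))).
    move=> c x' y'; rewrite !crossE; exact: (cv_linear (_ * _)).
  apply: (mulr_linl (f := fun u => cross u (hone A ⊗ hantip b : D))).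
  move=> c x' y'; rewrite !crossE; exact: (cv_linear (_ * _)).
rewrite crossE cvM; apply: eq_tsum => e1 e2; rewrite !crossE lam1 rhoi1 mul1r mulr1.
rewrite mulrC; congr (_ * _).
  by rewrite -[LHS]/(rinv r (hantip e1) (hantip a)) (rinv_antip hA hr antip_comul).
by rewrite -[LHS]/(rinv r b (hantip e2)) (rinv_antip hA hr antip_comul).
Qed.

Lemma through_antip (g : C1) x : through g (hantip x) = g (hantip (dprod x)).
Proof.
have tl : linear (through g : D -> k^o) by exact: cv_linear.
have gl : linear (fun x : D => g (hantip (dprod x))).
  apply: (comp_linear (cv_linear g)); apply: (comp_linear (hantip_lin hA)).
  exact: dprod_linear.
apply: (tens_ext (comp_linear tl (dantip_linear hA hr)) gl) => a b.
by rewrite (dantipE hA hr) (through_mul hr) !(dprodE hA) (hmul1l hA) (hmul1r hA) (antip_mul hA).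
Qed.

Lemma through1 : through 1 = 1.
Proof.
apply: cvP => x; rewrite throughE !cv1 ![_ *: 1]mulr1.
have cl : linear (fun x : D => hcounit (dprod x) : k^o).
  by apply: (comp_linear (f := @hcounit _ A : A -> k^o)); [exact: hcounit_lin|exact: dprod_linear].
have dl := dcounit_linear hA (r := r).
suff E (a b : A) : (hcounit (dprod (a ⊗ b : D)) : k^o) = @hcounit _ D (a ⊗ b : D).
  exact (tens_ext cl dl E x).
by rewrite (dprodE hA) (hcounitM hA); rewrite (dcounitE hA).
Qed.

Lemma one_dprod x : (1 : D1) x = hcounit (dprod x).
Proof. by rewrite -through1 throughE cv1 [_ *: 1]mulr1. Qed.

Variable G : set (A -> k^o).
Hypothesis G_hopf : is_hopf_subalgebra G.
Hypothesis G_lplus : range (lplus r) `<=` G.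
Hypothesis G_lminus : range (lminus r) `<=` G.
Hypothesis antip_surj : forall x : A, exists y, hantip y = x.

Definition double_gens : set D1 := range cross `|`
  [set phi | exists2 g : C1, G g & phi = through g].

(** The algebra of functionals that turns out to contain the FRT-dual. *)
Definition double_alg : set D1 := smallest (@is_subalgebra k D1) double_gens.

Lemma double_alg_subalgebra : is_subalgebra double_alg.
Proof.
split; first split.
- by move=> P [[[P0 _] _ _] _].
- by move=> c x y Px Py P hP; have [[[_ Pl] _ _] _] := hP; apply: Pl; [exact: Px|exact: Py].
- by move=> P [[_ P1 _] _].
- by move=> x y Px Py P hP; have [[_ _ PM] _] := hP; apply: PM; [exact: Px|exact: Py].
Qed.

Lemma double_alg_gen phi : double_gens phi -> double_alg phi.
Proof. by move=> gphi P [_ gP]; exact: gP. Qed.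

Lemma subspace_sum (V : lmodType k) (P : set V) I (s : seq I) (F : I -> V) :
  is_subspace P -> (forall i, P (F i)) -> P (\sum_(i <- s) F i).
Proof.
move=> [P0 Pl] PF; elim/big_rec: _ => [//|i x _ Px].
by rewrite -[F i]scale1r; exact: Pl.
Qed.

Lemma subspace_sum_in (V : lmodType k) (P : set V) (I : eqType) (s : seq I) (F : I -> V) :
  is_subspace P -> (forall i, i \in s -> P (F i)) -> P (\sum_(i <- s) F i).
Proof.
move=> [P0 Pl] PF; rewrite big_seq; elim/big_rec: _ => [//|i x si Px].
by rewrite -[F i]scale1r; apply: Pl => //; exact: PF.
Qed.

(** Being a matrix coefficient of the multiplication, with both components
   again in the algebra: the condition for lying in the Hopf dual and for
   closure under coproduct. *)
Definition splits (phi : D1) : Prop := exists2 s : seq (D1 * D1),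
  (forall p, p \in s -> double_alg p.1 /\ double_alg p.2) &
  forall x y, phi (hmul x y) = \sum_(p <- s) p.1 x * p.2 y.

Lemma splits_subalgebra : is_subalgebra splits.
Proof.
have [[A0 Al] A1 AM] := double_alg_subalgebra.
split; first split.
- by exists [::] => // x y; rewrite big_nil.
- move=> c f g [s sP sE] [t tP tE].
  exists ([seq (c *: p.1, p.2) | p <- s] ++ t).
    move=> p; rewrite mem_cat => /orP[/mapP[p' /sP[p1 p2] ->]|/tP//].
    by split=> //=; rewrite -[c *: _]addr0; exact: Al.
  move=> x y; rewrite big_cat big_map cvD cvZ sE tE /=; congr (_ + _).
  rewrite [_ *: _]mulr_sumr; apply: eq_bigr => p _; exact: mulrA.
- exists [:: (1, 1)] => [p|x y]; first by rewrite inE => /eqP->.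
  rewrite big_seq1.
  transitivity ((1 : D1) x * (1 : D1) y); last by [].
  transitivity (through 1 (hmul x y)); first by rewrite through1.
  by rewrite (through_mul hr) cv1 [_ *: 1]mulr1 (hcounitM hA) -!one_dprod.
- move=> f g [s sP sE] [t tP tE].
  exists [seq (p.1 * p'.1, p.2 * p'.2) | p <- s, p' <- t].
    move=> q /allpairsP[[p p'] [/sP[p1 p2] /tP[p'1 p'2] ->]].
    by split; exact: AM.
  move=> x y; rewrite (dcomulM hr) big_allpairs_dep.
  transitivity (\sum_(p <- s) \sum_(p' <- t) \tsum_(x1, x2 <- hcomul x)
    \tsum_(y1, y2 <- hcomul y) ((p.1 x1 * p'.1 x2) * (p.2 y1 * p'.2 y2) : k^o)).
    under [RHS]eq_bigr do rewrite exchange_big.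
    rewrite [RHS]exchange_big; apply: eq_bigr => -[x1 x2] _ /=.
    under [RHS]eq_bigr do rewrite exchange_big.
    rewrite [RHS]exchange_big; apply: eq_bigr => -[y1 y2] _ /=.
    rewrite sE tE mulr_suml; apply: eq_bigr => p _.
    rewrite mulr_sumr; apply: eq_bigr => p' _.
    by rewrite mulrACA.
  apply: eq_bigr => p _; apply: eq_bigr => p' _; rewrite !cvM mulr_tsuml.
  by apply: eq_tsum => x1 x2; rewrite mulr_tsumr.
Qed.

Definition antip_stable (phi : D1) : Prop :=
  exists2 psi : D1, double_alg psi & forall x, phi (hantip x) = psi x.

Lemma antip_stable_subalgebra : is_subalgebra antip_stable.
Proof.
have [[A0 Al] A1 AM] := double_alg_subalgebra.
split; first split.
- by exists 0.
- move=> c f g [f' f'A f'E] [g' g'A g'E]; exists (c *: f' + g'); first exact: Al.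
  by move=> x; rewrite !cvD !cvZ f'E g'E.
- exists 1 => // x.
  transitivity (through 1 (hantip x)); first by rewrite through1.
  rewrite through_antip [RHS]one_dprod -(counit_antip hA).
  exact: mulr1.
- move=> f g [f' f'A f'E] [g' g'A g'E]; exists (g' * f'); first exact: AM.
  by move=> x; rewrite (conv_dantip hr antip_comul) cvM; apply: eq_tsum => x1 x2; rewrite f'E g'E.
Qed.

Lemma G_scalar g : G g -> linear (g : A -> k^o).
Proof. by have [[GD _] _ _ _ _] := G_hopf => /GD[]. Qed.

Lemma double_gens_splits phi : double_gens phi -> splits phi.
Proof.
case=> [[e _ <-]|[g Gg ->]].
  exists [seq (cross p.1, cross p.2) | p <- repr (hcomul e)].
    by move=> q /mapP[p _ ->]; split; apply: double_alg_gen; left; [exists p.1|exists p.2].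
  by move=> x y; rewrite (cross_mul hA hr antip_comul) big_map.
have [_ _ _ _ Gsplit] := G_hopf; have [s sG sE] := Gsplit g Gg.
pose cvG (h : A -> k^o) : C1 := if pselect (linear h) is left hl then cv_of hC hl else 0.
have cvGE h : G h -> cvG h = h :> (A -> k^o).
  by move=> /G_scalar hl; rewrite /cvG; case: pselect.
exists [seq (through (cvG p.1), through (cvG p.2)) | p <- s].
  move=> q /mapP[p /sG[G1 G2] ->]; split; apply: double_alg_gen; right.
    by exists (cvG p.1) => //; rewrite cvGE.
  by exists (cvG p.2) => //; rewrite cvGE.
move=> x y; rewrite (through_mul hr) sE big_map big_seq [RHS]big_seq.
by apply: eq_bigr => p /sG[G1 G2]; rewrite !throughE !cvGE.
Qed.

Lemma double_gens_antip phi : double_gens phi -> antip_stable phi.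
Proof.
case=> [[e _ <-]|[g Gg ->]].
  have [e' <-] := antip_surj e; exists (cross e'); last exact: cross_antip.
  by apply: double_alg_gen; left; exists e'.
have [_ _ _ Gantip _] := G_hopf.
have gl : linear (fun x => g (hantip x)) by exact: (comp_linear (cv_linear g) (hantip_lin hA)).
exists (through (cv_of hC gl)); last by move=> x; rewrite through_antip.
by apply: double_alg_gen; right; exists (cv_of hC gl) => //; exact: Gantip.
Qed.

Lemma double_alg_splits phi : double_alg phi -> splits phi.
Proof. by apply; split; [exact: splits_subalgebra|exact: double_gens_splits]. Qed.

Lemma double_alg_antip phi : double_alg phi -> antip_stable phi.
Proof. by apply; split; [exact: antip_stable_subalgebra|exact: double_gens_antip]. Qed.

(** Closure under coproduct and antipode only has to be checked on the two
   families, as both conditions define subalgebras. *)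
Lemma double_alg_hopf :
  is_hopf_subalgebra [set f : D -> k^o | exists2 phi : D1, double_alg phi & f = phi].
Proof.
have [[A0 Al] A1 AM] := double_alg_subalgebra.
split.
- split; last first.
    split; first by exists 0.
    move=> c f g [phi phiA ->] [psi psiA ->]; exists (c *: phi + psi) => //.
    exact: Al.
  move=> f [phi phiA ->]; split; first exact: (cv_linear phi).
  have [s sA sE] := double_alg_splits phiA.
  exists [seq (cv_fun p.1, cv_fun p.2) | p <- s].
    by move=> q /mapP[p _ ->]; split; [exact: (cv_linear p.1)|exact: (cv_linear p.2)].
  by move=> x y; rewrite sE big_map.
- by exists 1 => //; apply: funext => x; rewrite cv1 [_ *: 1]mulr1.
- by move=> f g [phi phiA ->] [psi psiA ->]; exists (phi * psi) => //; exact: AM.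
- move=> f [phi phiA ->]; have [psi psiA E] := double_alg_antip phiA.
  by exists psi => //; apply: funext.
- move=> f [phi phiA ->]; have [s sA sE] := double_alg_splits phiA.
  exists [seq (cv_fun p.1, cv_fun p.2) | p <- s].
    move=> q /mapP[p /sA[p1 p2] ->].
    by split; [exists p.1|exists p.2].
  by move=> x y; rewrite sE big_map.
Qed.

End DoubleGenerators.

Section DoubleFRT.
Variables (k : fieldType) (A : hopf_data k) (hA : is_hopf A) (r : A -> A -> k).
Hypothesis hr : is_coquasitriangular r.
Hypothesis antip_comul : forall x : A,
  hcomul (hantip x) = \tsum_(a, b <- hcomul x) (hantip b ⊗ hantip a).
Let hC := hopf_coalgebra hA.
Let hD := double_coalgebra hA r.
Local Notation D := (quantum_double r).
Local Notation C1 := (conv_alg k^o hC).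
Local Notation C2 := (conv_alg C1 hC).
Local Notation D1 := (conv_alg k^o hD).
Local Notation "a ·· b" := (hmul a b) (at level 40, left associativity).
Local Notation R := (lamform hA hr).
Local Notation Ri := (lamiform hA hr).
Local Notation lam := (lam hA hr).
Local Notation rho := (rho hA hr).
Local Notation rhoi := (rhoi hA hr).
Local Notation lami := (lami hA hr).
Local Notation cross := (cross hA hr).
Local Notation through := (@through k A hA r).
Variable G : set (A -> k^o).
Hypothesis G_hopf : is_hopf_subalgebra G.
Hypothesis G_lplus : range (lplus r) `<=` G.
Hypothesis G_lminus : range (lminus r) `<=` G.
Hypothesis antip_surj : forall x : A, exists y, hantip y = x.

Fact anticross_bilinear (e : A) : bilinear_map (fun a b => (lami b * rho a) e).
Proof.
split=> [a c x y|b c x y].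
  by rewrite (lami_linear hA hr) mulrDl -scalerAl.
by rewrite (rho_linear hA hr) mulrDr -scalerAr.
Qed.

(** The convolution inverse of [cross], in the variable e. *)
Definition anticross (e : A) : D1 := dual_of hA r (anticross_bilinear e).

Lemma anticrossE e a b : anticross e (a ⊗ b : D) = (lami b * rho a) e.
Proof. exact: dual_ofE. Qed.

Lemma cross_linear : linear cross.
Proof.
move=> c x y; apply: d1_ext => a b; rewrite cvD cvZ !crossE.
exact: (cv_linear (rhoi a * lam b)).
Qed.

Lemma anticross_linear : linear anticross.
Proof.
move=> c x y; apply: d1_ext => a b; rewrite cvD cvZ !anticrossE.
exact: (cv_linear (lami b * rho a)).
Qed.

Lemma cross_anticross e :
  \tsum_(e1, e2 <- hcomul e) (cross e1 * anticross e2) = hcounit e *: 1.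
Proof.
apply: d1_ext => a b; rewrite cv_tsumE cvZ.
transitivity (\tsum_(a1, a2 <- hcomul a) \tsum_(b1, b2 <- hcomul b)
    (rhoi a1 * (lam b1 * lami b2) * rho a2) e).
  under eq_tsum => e1 e2 do rewrite dsum_conv.
  rewrite [LHS]tsum_exchange; apply: eq_tsum => a1 a2.
  rewrite [LHS]tsum_exchange; apply: eq_tsum => b1 b2.
  rewrite !mulrA -mulrA cvM; apply: eq_tsum => e1 e2.
  by rewrite crossE anticrossE.
transitivity (\tsum_(a1, a2 <- hcomul a) (hcounit b *: (rhoi a1 * rho a2)) e).
  apply: eq_tsum => a1 a2.
  transitivity ((rhoi a1 * (R * Ri) b * rho a2) e).
    by rewrite [(R * Ri) b]cvM mulr_tsumr mulr_tsuml cv_tsumE.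
  by rewrite (lam_lami hA hr) cv1 -scalerAr mulr1 -scalerAl cvZ.
transitivity (hcounit b *: ((rhoiform hA hr * rhoform hA hr) a) e).
  rewrite [(rhoiform hA hr * _) a]cvM cv_tsumE (lin_tsum _ _ (@scale_linear _ _ _)).
  by apply: eq_tsum => a1 a2.
rewrite (rhoi_rho hA hr) !cv1 cvZ cv1 (dcounitE hA) ![_ *: (1 : k^o)]mulr1.
by rewrite [hcounit b *: _]mulrA [RHS]mulrC [hcounit b * _]mulrC.
Qed.

Lemma anticross_cross e :
  \tsum_(e1, e2 <- hcomul e) (anticross e1 * cross e2) = hcounit e *: 1.
Proof.
apply: d1_ext => a b; rewrite cv_tsumE cvZ.
transitivity (\tsum_(a1, a2 <- hcomul a) \tsum_(b1, b2 <- hcomul b)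
    (lami b1 * (rho a1 * rhoi a2) * lam b2) e).
  under eq_tsum => e1 e2 do rewrite dsum_conv.
  rewrite [LHS]tsum_exchange; apply: eq_tsum => a1 a2.
  rewrite [LHS]tsum_exchange; apply: eq_tsum => b1 b2.
  rewrite !mulrA -mulrA cvM; apply: eq_tsum => e1 e2.
  by rewrite crossE anticrossE.
rewrite tsum_exchange.
transitivity (\tsum_(b1, b2 <- hcomul b) (hcounit a *: (lami b1 * lam b2)) e).
  apply: eq_tsum => b1 b2.
  transitivity ((lami b1 * (rhoform hA hr * rhoiform hA hr) a * lam b2) e).
    by rewrite [(rhoform hA hr * _) a]cvM mulr_tsumr mulr_tsuml cv_tsumE.
  by rewrite (rho_rhoi hA hr) cv1 -scalerAr mulr1 -scalerAl cvZ.
transitivity (hcounit a *: ((Ri * R) b) e).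
  rewrite [(Ri * _) b]cvM cv_tsumE (lin_tsum _ _ (@scale_linear _ _ _)).
  by apply: eq_tsum => b1 b2.
rewrite (lami_lam hA hr) !cv1 cvZ cv1 (dcounitE hA) ![_ *: (1 : k^o)]mulr1.
by rewrite [hcounit a *: _]mulrA [RHS]mulrC.
Qed.

Lemma tsum_dprod (X : lmodType k) (F : A -> A -> X) (y : D) : bilinear_map F ->
  tensor_sum F (hcomul (dprod y)) =
  \tsum_(y1, y2 <- hcomul y) F (dprod y1) (dprod y2).
Proof.
move=> Fb.
have B : bilinear_map (fun y1 y2 : D => F (dprod y1) (dprod y2)).
  split=> z; first exact: (comp_linear (Fb.1 _) (@dprod_linear k A hA r)).
  exact: (comp_linear (Fb.2 _) (@dprod_linear k A hA r)).
have Hl : linear (fun y : D => tensor_sum F (hcomul (dprod y))).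
  exact: (comp_linear (comul_sum_linear hC Fb) (@dprod_linear k A hA r)).
have Hr : linear (fun y : D => \tsum_(y1, y2 <- hcomul y) F (dprod y1) (dprod y2)).
  exact: (comul_sum_linear hD B).
apply: (tens_ext Hl Hr) => a b; rewrite (dsum_comul hA a b B) (dprodE hA).
rewrite (tsum_mul hA _ _ Fb); apply: eq_tsum => a1 a2; apply: eq_tsum => b1 b2.
by rewrite !(dprodE hA).
Qed.

Definition rhat_inv (x y : D) : k := anticross (dprod y) x.

Lemma rhatE (x y : D) : qdouble_rform r x y = cross (dprod y) x.
Proof.
rewrite /qdouble_rform (conv_inv_r hA hr).
transitivity (\tsum_(a, b <- x) (rhoi a * lam b) (dprod y)); last by [].
apply: eq_tsum => a b; rewrite (lin_tsum _ _ (cv_linear (rhoi a * lam b))).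
apply: eq_tsum => c d.
by rewrite cvM (tsum_mul hA _ _ (conv_bilinear (rhoi a) (lam b))).
Qed.

Lemma rhat_bilinear : bilinear_form (@qdouble_rform k A r : D -> D -> k).
Proof.
have E : qdouble_rform r = fun x y => cross (dprod y) x.
  by apply: funext => x; apply: funext => y; rewrite rhatE.
rewrite E; split=> [x|y]; last exact: (cv_linear (cross (dprod y))).
move=> c u v; rewrite (dprod_linear hA) cross_linear cvD cvZ.
by [].
Qed.

Lemma rhat_inv_bilinear : bilinear_form rhat_inv.
Proof.
split=> [x|y]; last exact: (cv_linear (anticross (dprod y))).
by move=> c u v; rewrite /rhat_inv (dprod_linear hA) anticross_linear cvD cvZ.
Qed.

(** The r-form of the double is [cross] at the product of the second
   argument, so it is inverted by [anticross]. *)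
Lemma rhat_inverse : is_conv_inverse (@qdouble_rform k A r : D -> D -> k) rhat_inv.
Proof.
have D1b (u v : A -> D1) x : linear u -> linear v ->
    bilinear_map (fun e1 e2 => (u e1 * v e2) x : k^o).
  move=> ul vl; split=> z c s t.
    by rewrite vl mulrDr -scalerAr cvD cvZ.
  by rewrite ul mulrDl -scalerAl cvD cvZ.
move=> x y; split.
  transitivity ((\tsum_(e1, e2 <- hcomul (dprod y)) (cross e1 * anticross e2)) x : k^o).
    rewrite cv_tsumE (tsum_dprod _ (D1b _ _ x cross_linear anticross_linear)).
    rewrite /convolution tsum_exchange; apply: eq_tsum => y1 y2.
    by rewrite cvM; apply: eq_tsum => x1 x2; rewrite rhatE.
  rewrite cross_anticross cvZ cv1 [_ *: (1 : k^o)]mulr1 mulrC; congr (_ * _).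
  by rewrite -(one_dprod hA) cv1 [_ *: (1 : k^o)]mulr1.
transitivity ((\tsum_(e1, e2 <- hcomul (dprod y)) (anticross e1 * cross e2)) x : k^o).
  rewrite cv_tsumE (tsum_dprod _ (D1b _ _ x anticross_linear cross_linear)).
  rewrite /convolution tsum_exchange; apply: eq_tsum => y1 y2.
  by rewrite cvM; apply: eq_tsum => x1 x2; rewrite rhatE.
rewrite anticross_cross cvZ cv1 [_ *: (1 : k^o)]mulr1 mulrC; congr (_ * _).
by rewrite -(one_dprod hA) cv1 [_ *: (1 : k^o)]mulr1.
Qed.

Lemma conv_inv_rhat : conv_inv (@qdouble_rform k A r : D -> D -> k) = rhat_inv.
Proof. exact: (conv_invE hD rhat_bilinear rhat_inv_bilinear rhat_inverse). Qed.

(** Both l-functionals of the double depend on one argument only through its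
   product in A; the upper ones are in the first family and the lower ones
   in the second, provided that the latter is taken over a Hopf algebra of
   functionals containing the l-functionals of A. *)
Lemma FRT_double (f : D -> k^o) : FRT_dual (@qdouble_rform k A r : D -> D -> k) f ->
  exists2 phi : D1, double_alg hr G phi & f = phi.
Proof.
move=> /(_ [set g : D -> k^o | exists2 phi : D1, double_alg hr G phi & g = phi]).
apply; split; first exact: double_alg_hopf.
have [[GD [G0 Gl]] _ GM _ _] := G_hopf.
have [A_sub _ _] := double_alg_subalgebra hA hr G.
move=> _ [[y _ <-]|[x _ <-]].
  exists (cross (dprod y)); first by apply: double_alg_gen; left; exists (dprod y).
  by apply: funext => x; rewrite -rhatE.
exists (\sum_(p <- repr x) through (lami p.2 * rho p.1)).
  apply: (subspace_sum _ A_sub) => p; apply: double_alg_gen; right.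
  exists (lami p.2 * rho p.1) => //.
  have G1 : G (lami p.2).
    apply: G_lminus; exists p.2 => //.
    by apply: funext => z; rewrite /lminus (conv_inv_r hA hr).
  have G2 : G (rho p.1) by apply: G_lplus; exists p.1.
  exact: (GM _ _ G1 G2).
apply: funext => y; rewrite /lminus conv_inv_rhat cv_sumE.
by [].
Qed.

(** ** Recovering a functional from its image under the embedding *)

Fact pair_bilinear (a b : A) :
  bilinear_map (fun g h : A -> k^o => g a * h b : k^o).
Proof.
split=> z c s t; rewrite !fctE.
  by rewrite mulrDr -scalerAr.
by rewrite mulrDl -scalerAl.
Qed.

Definition pair_eval (a b : A) (t : (A -> k^o) ⊗ (A -> k^o)) : k :=
  \tsum_(g, h <- t) (g a * h b).

(** The pure tensor a (x) b is the product of a (x) 1 and 1 (x) b, with no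
   twist left. *)
Lemma iota_eval (f : D -> k^o) a b : hopf_dual f ->
  pair_eval a b (qdouble_iota f) = f (a ⊗ b).
Proof.
move=> [fl [s sl sE]].
have Dpair (x y : D) : bilinear_map (fun g h : D -> k^o => g x * h y : k^o).
  split=> z c u v; rewrite !fctE; first by rewrite mulrDr -scalerAr.
  by rewrite mulrDl -scalerAl.
have comulE x y : f (hmul x y) =
    tensor_sum (fun g h : D -> k^o => g x * h y : k) (dual_comul f).
  rewrite /dual_comul; set P := [set _ | _].
  have ex : exists t, P t.
    exists (\sum_(p <- s) (p.1 ⊗ p.2)) => x' y' /=; rewrite sE.
    rewrite [RHS](lin_sum (tsum_linear (Dpair x' y'))); apply: eq_bigr => p _.
    by rewrite (tsum_tens (Dpair x' y')).
  exact: (xgetPex 0 ex).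
transitivity (f (hmul (a ⊗ hone A : D) (hone A ⊗ b : D))).
  rewrite comulE /qdouble_iota /pair_eval.
  rewrite [LHS](lin_tsum _ _ (tsum_linear (pair_bilinear a b))).
  by apply: eq_tsum => g h; rewrite (tsum_tens (pair_bilinear a b)).
have fl' : linear (f : D -> k^o) by exact: fl.
pose phi : D1 := cv_of hD fl'.
rewrite -[LHS]/(phi _) -[RHS]/(phi _) (dmul_eval hr).
have mul1 (u v : C2) : (u * v) (hone A) (hone A) = u (hone A) (hone A) * v (hone A) (hone A).
  rewrite cv2M (hcomul1 hA) tsum_tens.
    by rewrite tsum_tens //; split=> z; [apply: mulr_linr|apply: mulr_linl]; exact: cv_linear.
  split=> z; apply: tsum_param_linear => x y.
    apply: (mulr_linr (f := fun t => v t y)); exact: (cv2_bilinear v).2.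
  apply: (mulr_linl (f := fun t => u t x)); exact: (cv2_bilinear u).2.
rewrite !mul1 -[Ri _ _]/(rinv r _ _) -[R _ _]/(r _ _) (rinv_1r hA hr) (cqt_1l hr).
rewrite (hcounit1 hA) mul1r mulr1 -[LHS]/(phi ((a ·· hone A) ⊗ (hone A ·· b))).
by rewrite (hmul1r hA) (hmul1l hA).
Qed.

Lemma FRT_double_dual (f : D -> k^o) :
  FRT_dual (@qdouble_rform k A r : D -> D -> k) f -> hopf_dual f.
Proof.
move=> /FRT_double [phi phiA ->].
have [[sub _] _ _ _ _] := double_alg_hopf hA hr antip_comul G_hopf antip_surj.
by apply: sub; exists phi.
Qed.

End DoubleFRT.

(** * Weights and powers of q *)

Section Weights.
Variables (k : fieldType) (G : semisimple_datum) (q : k).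
Hypothesis q_neq0 : q != 0.
Hypothesis q_not_root : forall n : nat, (0 < n)%N -> q ^+ n != 1.
Variable s : root_of_q G q.

Local Notation N := (rk G).
Local Notation weight := 'rV[rat]_(rk G).
Local Notation L := (lattice (s := G)).
Local Notation pairing := (weight_form (cartan G) (symd (s := G))).
Local Notation alpha := (@simple_root (rk G)).
Local Notation d := (symd (s := G)).

Lemma pairingDl (x y z : weight) : pairing (x + y) z = pairing x z + pairing y z.
Proof.
rewrite /weight_form -big_split; apply: eq_bigr => i _ /=.
by rewrite -big_split; apply: eq_bigr => j _ /=; rewrite !mxE !mulrDl.
Qed.

Lemma pairingDr (x y z : weight) : pairing x (y + z) = pairing x y + pairing x z.
Proof.
rewrite /weight_form -big_split; apply: eq_bigr => i _ /=.
by rewrite -big_split; apply: eq_bigr => j _ /=; rewrite !mxE mulrDr mulrDl.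
Qed.

Lemma pairingZl (c : rat) (x y : weight) : pairing (c *: x) y = c * pairing x y.
Proof.
rewrite /weight_form mulr_sumr; apply: eq_bigr => i _.
by rewrite mulr_sumr; apply: eq_bigr => j _; rewrite !mxE -!mulrA.
Qed.

Lemma pairingNl (x y : weight) : pairing (- x) y = - pairing x y.
Proof. by rewrite -scaleN1r pairingZl mulN1r. Qed.

Lemma pairing0l (x : weight) : pairing 0 x = 0.
Proof. by rewrite -(scale0r 0) pairingZl mul0r. Qed.

Lemma pairingC (x y : weight) : pairing x y = pairing y x.
Proof.
rewrite /weight_form exchange_big; apply: eq_bigr => i _; apply: eq_bigr => j _.
rewrite [y 0 i * _]mulrC; congr (_ * _).
have := congr1 (fun z : int => z%:~R : rat) (cartan_sym i j).
by rewrite !intrM !pmulrn => ->.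
Qed.

Lemma pairingNr (x y : weight) : pairing x (- y) = - pairing x y.
Proof. by rewrite pairingC pairingNl pairingC. Qed.

Lemma pairing0r (x : weight) : pairing x 0 = 0.
Proof. by rewrite pairingC pairing0l. Qed.

Lemma pairingBr (x y z : weight) : pairing x (y - z) = pairing x y - pairing x z.
Proof. by rewrite pairingDr pairingNr. Qed.

Lemma pairing_root (i j : 'I_N) : pairing (alpha i) (alpha j) = (d i)%:R * (cartan G i j)%:~R.
Proof.
rewrite /weight_form (bigD1 i) //= [X in _ + X]big1 => [|i' ne].
  rewrite addr0 (bigD1 j) //= [X in _ + X]big1 => [|j' ne].
    by rewrite addr0 !mxE !eqxx !mul1r.
  by rewrite !mxE (negbTE ne) andbF mulr0 mul0r.
by rewrite big1 // => j' _; rewrite !mxE (negbTE ne) andbF !mul0r.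
Qed.

Lemma L0 : L 0.
Proof.
have i0 : 'I_N by exact: Ordinal (rk_gt0 G).
by rewrite -(subrr (alpha i0)); apply: lattice_sub; exact: lattice_root.
Qed.

Lemma LN x : L x -> L (- x).
Proof. by move=> Lx; rewrite -sub0r; apply: lattice_sub => //; exact: L0. Qed.

Lemma LD x y : L x -> L y -> L (x + y).
Proof. by move=> Lx Ly; rewrite -[y]opprK; apply: lattice_sub => //; exact: LN. Qed.

Lemma LB x y : L x -> L y -> L (x - y).
Proof. exact: lattice_sub. Qed.

Lemma La i : L (alpha i). Proof. exact: lattice_root. Qed.

Lemma LMn x n : L x -> L (x *+ n).
Proof. by move=> Lx; elim: n => [|n IH]; [exact: L0|rewrite mulrS; exact: LD]. Qed.

Lemma L_sum I (t : seq I) (F : I -> weight) : (forall i, L (F i)) -> L (\sum_(i <- t) F i).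
Proof. by move=> LF; elim/big_rec: _ => [|i x _ Lx]; [exact: L0|exact: LD]. Qed.

Lemma qrt_neq0 : qrt s != 0.
Proof.
apply/eqP => z; have := qrtE s; rewrite z expr0n.
by rewrite eqn0Ngt (qden_gt0 s) => e; move: q_neq0; rewrite -e eqxx.
Qed.

Lemma qrt_not_root n : (0 < n)%N -> qrt s ^+ n != 1.
Proof.
move=> n0; apply/eqP => e; have /eqP := q_not_root n0; apply.
by rewrite -(qrtE s) -exprM mulnC exprM e expr1n.
Qed.

Lemma qrt_inj (m n : int) : qrt s ^ m = qrt s ^ n -> m = n.
Proof.
move=> e; apply/eqP; rewrite -subr_eq0; apply/eqP.
have : qrt s ^ (m - n) = 1 by rewrite expfzDr ?qrt_neq0 // e -expfzDr ?qrt_neq0 // subrr.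
case: (m - n) => [[//|j]|j] /eqP; first by rewrite (negbTE (@qrt_not_root _ _)).
by rewrite NegzE -invr_expz invr_eq1 (negbTE (@qrt_not_root _ _)).
Qed.

Definition chi (x y : weight) : k := qpow s (pairing x y).

(** The exponent of [chi] as a power of the chosen root of q; an integer on
   the lattice. *)
Definition lexp (x y : weight) : int := numq ((qden s)%:R * pairing x y).

Lemma chiE x y : chi x y = qrt s ^ lexp x y. Proof. by []. Qed.

Lemma lexpE x y : L x -> L y -> (lexp x y)%:~R = (qden s)%:R * pairing x y.
Proof.
move=> Lx Ly; have /intrP[z ez] := qden_int s Lx Ly.
by rewrite /lexp ez numq_int.
Qed.

Lemma lexpDl x y z : L x -> L y -> L z -> lexp (x + y) z = lexp x z + lexp y z.
Proof.
move=> Lx Ly Lz; apply: (@intr_inj rat); rewrite rmorphD /= !lexpE //; last exact: LD.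
by rewrite pairingDl mulrDr.
Qed.

Lemma lexpC x y : lexp x y = lexp y x. Proof. by rewrite /lexp pairingC. Qed.

Lemma chiC x y : chi x y = chi y x. Proof. by rewrite !chiE lexpC. Qed.

Lemma chi_neq0 x y : chi x y != 0. Proof. by rewrite chiE expfz_neq0 ?qrt_neq0. Qed.

Lemma chiDl x y z : L x -> L y -> L z -> chi (x + y) z = chi x z * chi y z.
Proof. by move=> Lx Ly Lz; rewrite !chiE lexpDl // expfzDr ?qrt_neq0. Qed.

Lemma chiDr x y z : L x -> L y -> L z -> chi x (y + z) = chi x y * chi x z.
Proof. by move=> Lx Ly Lz; rewrite !(chiC x) chiDl. Qed.

Lemma chi0l x : chi 0 x = 1. Proof. by rewrite chiE /lexp pairing0l mulr0. Qed.
Lemma chi0r x : chi x 0 = 1. Proof. by rewrite chiC chi0l. Qed.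

Lemma chiNl x y : chi (- x) y = (chi x y)^-1.
Proof.
by rewrite !chiE /lexp pairingNl mulrN numqN invr_expz.
Qed.

Lemma chiNr x y : chi x (- y) = (chi x y)^-1.
Proof. by rewrite chiC chiNl chiC. Qed.

Lemma chiE_N x y : qpow s (- pairing x y) = chi x (- y).
Proof. by rewrite /chi pairingNr. Qed.

Lemma chi_inj x y z t : L x -> L y -> L z -> L t ->
  chi x y = chi z t -> pairing x y = pairing z t.
Proof.
move=> Lx Ly Lz Lt /qrt_inj e.
have D0 : (qden s)%:R != 0 :> rat by rewrite pnatr_eq0 -lt0n (qden_gt0 s).
by apply: (mulfI D0); rewrite -!lexpE // /lexp e.
Qed.

Lemma chi_roots i j : chi (alpha i) (alpha j) = qi q i ^ cartan G i j.
Proof.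
have e : lexp (alpha i) (alpha j) = (qden s)%:Z * ((d i)%:Z * cartan G i j).
  apply: (@intr_inj rat); rewrite lexpE; try exact: La.
  by rewrite pairing_root !rmorphM /= !pmulrn.
by rewrite chiE e -!exprz_exp -!exprnP (qrtE s).
Qed.

Lemma qi_neq0 (i : 'I_N) : qi q i != 0. Proof. by rewrite expf_neq0. Qed.

Lemma qi_not_root (i : 'I_N) n : (0 < n)%N -> qi q i ^+ n != 1.
Proof. by move=> n0; rewrite -exprM q_not_root // muln_gt0 symd_gt0. Qed.

(** A multiple of the sum of the positive roots: the Gram matrix of the
   simple roots is positive definite, hence invertible, and clearing
   denominators puts the solution in the root lattice. *)
Lemma regular_weight : exists (M : nat) (la : weight),
  [/\ (0 < M)%N, L la & forall i, pairing la (alpha i) = (2 * M * d i)%:R].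
Proof.
pose B : 'M[rat]_N := \matrix_(i, j) ((d i)%:R * (cartan G i j)%:~R).
have formE x y : pairing x y = (x *m B *m y^T) 0 0.
  rewrite mxE /weight_form exchange_big; apply: eq_bigr => j _ /=.
  rewrite !mxE mulr_suml; apply: eq_bigr => i _.
  by rewrite !mxE mulrAC.
have Bu : B \in unitmx.
  rewrite -row_free_unit -kermx_eq0; apply/rowV0P => v /sub_kermxP vB.
  apply/eqP; apply: contraT => v0; have := cartan_posdef v0.
  by rewrite formE vB mul0mx mxE ltxx.
pose b : 'rV[rat]_N := \row_i (2 * d i)%:R.
pose x := b *m invmx B.
pose M := `|(\prod_i denq (x 0 i))%R|%N.
have M0 : (0 < M)%N.
  by rewrite absz_gt0; apply/prodf_neq0 => i _; exact: denq_neq0.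
exists M, (M%:R *: x); split=> //.
  have -> : M%:R *: x = \sum_i (M%:R * x 0 i) *: alpha i.
    by rewrite [LHS]row_sum_delta; apply: eq_bigr => i _; rewrite mxE.
  apply: L_sum => i.
  have [z ->] : exists z : int, M%:R * x 0 i = z%:~R.
    exists (sgz (\prod_j denq (x 0 j)) * (\prod_(j | j != i) denq (x 0 j)) * numq (x 0 i)).
    have -> : (M%:R : rat) = (sgz (\prod_j denq (x 0 j)) * \prod_j denq (x 0 j))%:~R.
      by rewrite -abszEsg pmulrn.
    rewrite (bigD1 i) //= !rmorphM /=.
    rewrite -!mulrA; congr (_ * _); rewrite mulrCA; congr (_ * _).
    by rewrite numqE mulrC.
  rewrite scaler_int; case: z => n; first exact/LMn/La.
  by rewrite NegzE mulrNz; apply: LN; exact/LMn/La.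
move=> i; rewrite pairingZl.
have -> : pairing x (alpha i) = (2 * d i)%:R.
  rewrite formE mulmxKV // mxE (bigD1 i) //= big1 => [|j ne].
    by rewrite addr0 !mxE !eqxx mulr1.
  by rewrite !mxE (negbTE ne) andbF mulr0.
by rewrite -natrM mulnCA mulnA.
Qed.

End Weights.

(** * Generation by the Chevalley generators *)

Section SubAlgebra.
Variables (k : fieldType) (B : algType k) (P : set B) (hP : is_subalgebra P).

Definition subalg_pred : {pred B} := [pred x | `[< P x >]].

Record subalg (h : is_subalgebra P) : Type :=
  SubAlg {subalg_val :> B; _ : subalg_val \in subalg_pred}.
Local Notation SB := (subalg hP).

HB.instance Definition _ := [isSub of SB for @subalg_val hP].
HB.instance Definition _ := [Choice of SB by <:].

Fact subalg_closed : GRing.subsemialg_closed subalg_pred.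
Proof.
have [[P0 Pl] P1 PM] := hP.
split; first exact/asboolP.
- split; first exact/asboolP.
  move=> x y /asboolP Px /asboolP Py; apply/asboolP.
  by rewrite -[x]scale1r; exact: Pl.
- by move=> c x /asboolP Px; apply/asboolP; rewrite -[_ *: _]addr0; exact: Pl.
- by move=> x y /asboolP Px /asboolP Py; apply/asboolP; exact: PM.
Qed.

HB.instance Definition _ := GRing.SubChoice_isSubAlgebra.Build k B subalg_pred SB
  subalg_closed.

Fact subalg_val_linear : linear (val : SB -> B).
Proof. by []. Qed.
Fact subalg_val_monoid : monoid_morphism (val : SB -> B).
Proof. by []. Qed.

HB.instance Definition _ := GRing.isLinear.Build k SB B _ (@subalg_val hP)
  subalg_val_linear.
HB.instance Definition _ := GRing.isMonoidMorphism.Build SB B (@subalg_val hP)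
  subalg_val_monoid.

Definition subalg_incl : {lrmorphism SB -> B} := @subalg_val hP.

Lemma subalg_valP (x : SB) : P (val x).
Proof. by case: x => x xP; apply/asboolP. Qed.

Definition subalg_of (x : B) (Px : P x) : SB := SubAlg hP (introT (asboolP _) Px).

End SubAlgebra.

Section Generation.
Variables (k : fieldType) (G : semisimple_datum) (q : k).
Hypothesis q_neq0 : q != 0.
Variable s : root_of_q G q.
Local Notation N := (rk G).
Local Notation weight := 'rV[rat]_(rk G).
Local Notation L := (lattice (s := G)).

Lemma serre_morph (B B' : algType k) (f : {lrmorphism B -> B'}) (X : 'I_N -> B) i j :
  f (serre_lhs q X i j) = serre_lhs q (fun i => f (X i)) i j.
Proof.
have fl : linear f by exact: linearP.
rewrite /serre_lhs (lin_sum fl); apply: eq_bigr => r _.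
by rewrite (linZ fl) !rmorphM !rmorphXn.
Qed.

Variable U : quantum_env s.

(** By the universal property the identity factors through the subalgebra. *)
Lemma env_ind (P : set U) : is_subalgebra P ->
  (forall la, L la -> P (Kf U la)) -> (forall i, P (Ef U i)) ->
  (forall i, P (Ff U i)) -> forall x, P x.
Proof.
move=> hP PK PE PF.
pose K' la : subalg hP :=
  if pselect (L la) is left Lla then subalg_of hP (PK la Lla) else 0.
pose E' i := subalg_of hP (PE i); pose F' i := subalg_of hP (PF i).
have K'E la : L la -> val (K' la) = Kf U la.
  by rewrite /K'; case: pselect.
have rel := qe_rel U.
have rel' : uq_relations s K' E' F'.
  split.
  - by apply: val_inj; rewrite K'E ?(uq_K0 rel) //; exact: L0.
  - move=> la mu Lla Lmu; apply: val_inj; rewrite /= !K'E //; last exact: LD.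
    exact: (uq_KD rel).
  - move=> la i Lla; apply: val_inj; rewrite /= !K'E //; last exact: LN.
    exact: (uq_KE rel).
  - move=> la i Lla; apply: val_inj; rewrite /= !K'E //; last exact: LN.
    exact: (uq_KF rel).
  - move=> i j; apply: val_inj; rewrite /= (uq_EF rel).
    by case: ifP => // _; rewrite /= !K'E //; [exact/LN/La|exact: La].
  - move=> i j ij; apply: val_inj.
    by rewrite [LHS](serre_morph (subalg_incl hP) E') [LHS](uq_serreE rel).
  - move=> i j ij; apply: val_inj.
    by rewrite [LHS](serre_morph (subalg_incl hP) F') [LHS](uq_serreF rel).
have [phi [phiK phiE phiF _]] := qe_univ U rel'.
have [id' [_ _ _ uniq]] := qe_univ U rel.
pose vphi : {lrmorphism U -> U} := (subalg_incl hP) \o phi.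
pose idU : {lrmorphism U -> U} := idfun.
move=> x; have -> : x = vphi x.
  rewrite (uniq vphi) => [|la Lla|i|i]; last 3 first.
  - by rewrite /= phiK // K'E.
  - by rewrite /= phiE.
  - by rewrite /= phiF.
  by rewrite -(uniq idU).
exact: subalg_valP.
Qed.

Lemma KD la mu : L la -> L mu -> Kf U (la + mu) = Kf U la * Kf U mu.
Proof. exact: (uq_KD (qe_rel U)). Qed.

Lemma K0 : Kf U 0 = 1. Proof. exact: (uq_K0 (qe_rel U)). Qed.

Lemma KNK la : L la -> Kf U (- la) * Kf U la = 1.
Proof. by move=> Lla; rewrite -KD ?addNr ?K0 //; exact: LN. Qed.

Lemma KKN la : L la -> Kf U la * Kf U (- la) = 1.
Proof. by move=> Lla; rewrite -KD ?subrr ?K0 //; exact: LN. Qed.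

Lemma KC la mu : L la -> L mu -> Kf U la * Kf U mu = Kf U mu * Kf U la.
Proof. by move=> Ll Lm; rewrite -!KD // addrC. Qed.

Lemma KE la i : L la ->
  Kf U la * Ef U i = chi s la (simple_root i) *: (Ef U i * Kf U la).
Proof.
move=> Ll; rewrite -[LHS]mulr1 -(KNK Ll) mulrA (uq_KE (qe_rel U)) //.
by rewrite -scalerAl.
Qed.

Lemma KF la i : L la ->
  Kf U la * Ff U i = (chi s la (simple_root i))^-1 *: (Ff U i * Kf U la).
Proof.
move=> Ll; rewrite -[LHS]mulr1 -(KNK Ll) mulrA (uq_KF (qe_rel U)) //.
by rewrite -scalerAl chiE_N chiNr.
Qed.

Lemma EF i j : Ef U i * Ff U j = Ff U j * Ef U i + (if i == j then
  (qi q i - (qi q i)^-1)^-1 *: (Kf U (simple_root i) - Kf U (- simple_root i)) else 0).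
Proof. by rewrite -(uq_EF (qe_rel U)) addrC subrK. Qed.

Definition Ew (J : seq 'I_N) : U := \prod_(i <- J) Ef U i.
Definition Fw (I : seq 'I_N) : U := \prod_(i <- I) Ff U i.
Definition wt (I : seq 'I_N) : weight := \sum_(i <- I) simple_root i.

Lemma Lwt I : L (wt I). Proof. by apply: L_sum => i; exact: La. Qed.

Lemma Ew_cons i J : Ew (i :: J) = Ef U i * Ew J. Proof. exact: big_cons. Qed.
Lemma Fw_cons i J : Fw (i :: J) = Ff U i * Fw J. Proof. exact: big_cons. Qed.
Lemma Ew_nil : Ew [::] = 1. Proof. exact: big_nil. Qed.
Lemma Fw_nil : Fw [::] = 1. Proof. exact: big_nil. Qed.
Lemma Ew_rcons J i : Ew (rcons J i) = Ew J * Ef U i. Proof. by rewrite /Ew -cats1 big_cat big_seq1. Qed.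
Lemma wt_cons i J : wt (i :: J) = simple_root i + wt J. Proof. exact: big_cons. Qed.
Lemma wt_nil : wt [::] = 0. Proof. exact: big_nil. Qed.

Lemma KEw la J : L la -> Kf U la * Ew J = chi s la (wt J) *: (Ew J * Kf U la).
Proof.
move=> Ll; elim: J => [|i J IH].
  by rewrite Ew_nil wt_nil chi0r scale1r mulr1 mul1r.
rewrite Ew_cons wt_cons mulrA KE // -scalerAl -(mulrA _ (Kf U la)) IH -scalerAr scalerA mulrA.
by rewrite (chiDr q_neq0 s Ll (La i) (Lwt J)).
Qed.

Lemma KFw la I : L la -> Kf U la * Fw I = (chi s la (wt I))^-1 *: (Fw I * Kf U la).
Proof.
move=> Ll; elim: I => [|i J IH].
  by rewrite Fw_nil wt_nil chi0r invr1 scale1r mulr1 mul1r.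
rewrite Fw_cons wt_cons mulrA KF // -scalerAl -(mulrA _ (Kf U la)) IH -scalerAr scalerA mulrA.
by rewrite (chiDr q_neq0 s Ll (La i) (Lwt J)) invfM.
Qed.

Lemma env_hopf : is_hopf (@HopfData k (qe_alg U) (fun x y => x * y) 1
  (@qe_comul _ _ _ _ U) (@qe_counit _ _ _ _ U) (@qe_antip _ _ _ _ U)).
Proof. exact: qe_hopf. Qed.

Lemma env_antipM (x y : U) : qe_antip (x * y) = qe_antip y * qe_antip x.
Proof. exact: (antip_mul env_hopf x y). Qed.

Lemma env_antip1 : qe_antip (1 : U) = 1.
Proof. exact: (antip1 env_hopf). Qed.

Lemma env_antip_linear : linear (@qe_antip _ _ _ _ U).
Proof. exact: (hantip_lin env_hopf). Qed.

Lemma env_counitM (x y : U) : qe_counit (x * y) = qe_counit x * qe_counit y.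
Proof. exact: (hcounitM env_hopf). Qed.

Lemma env_antip_surj (x : U) : exists y, qe_antip y = x.
Proof.
have lin := env_antip_linear.
apply: (env_ind (P := [set x | exists y, qe_antip y = x])).
- split; first split.
  + by exists 0; rewrite (lin0 lin).
  + by move=> c _ _ [u <-] [v <-]; exists (c *: u + v); rewrite lin.
  + by exists 1; exact: env_antip1.
  + by move=> _ _ [u <-] [v <-]; exists (v * u); rewrite env_antipM.
- move=> la Ll; exists (Kf U (- la)); rewrite qe_antipK ?opprK //; exact: LN.
- move=> i; exists (- (Kf U (- simple_root i) * Ef U i)).
  rewrite (linN lin) env_antipM qe_antipE qe_antipK; last exact/LN/La.
  by rewrite opprK mulNr opprK -mulrA KNK ?mulr1 //; exact: La.
- move=> i; exists (- (Ff U i * Kf U (simple_root i))).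
  rewrite (linN lin) env_antipM qe_antipF qe_antipK; last exact: La.
  by rewrite mulrN opprK mulrA KNK ?mul1r //; exact: La.
Qed.

End Generation.

(** * Highest weight modules *)

Section LinSpan.
Variables (k : fieldType) (V : lmodType k).

Lemma lin_span_subspace (S : set V) : is_subspace (lin_span S).
Proof.
split; first by move=> P [[P0 _] _].
by move=> c x y Sx Sy P hP; have [[_ Pl] _] := hP; apply: Pl; [exact: Sx|exact: Sy].
Qed.

Lemma lin_span_gen (S : set V) x : S x -> lin_span S x.
Proof. by move=> Sx P [_ SP]; exact: SP. Qed.

Lemma lin_span_min (S P : set V) : is_subspace P -> S `<=` P -> lin_span S `<=` P.
Proof. by move=> hP SP x; apply. Qed.

Lemma subspaceD (P : set V) x y : is_subspace P -> P x -> P y -> P (x + y).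
Proof. by move=> [_ Pl] Px Py; rewrite -[x]scale1r; exact: Pl. Qed.

Lemma subspaceZ (P : set V) c x : is_subspace P -> P x -> P (c *: x).
Proof. by move=> [P0 Pl] Px; rewrite -[_ *: _]addr0; exact: Pl. Qed.

Lemma subspaceB (P : set V) x y : is_subspace P -> P x -> P y -> P (x - y).
Proof. by move=> hP Px Py; apply: subspaceD => //; rewrite -scaleN1r; exact: subspaceZ. Qed.

Lemma lin_span_seq (I : eqType) (F : I -> V) (Q : I -> Prop) x :
  lin_span [set v | exists2 i, Q i & v = F i] x ->
  exists2 t : seq (k * I), (forall p, p \in t -> Q p.2) & x = \sum_(p <- t) p.1 *: F p.2.
Proof.
set W := [set x | exists2 t : seq (k * I), (forall p, p \in t -> Q p.2) &
  x = \sum_(p <- t) p.1 *: F p.2].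
apply: (lin_span_min (P := W)).
  split; first by exists [::] => //; rewrite big_nil.
  move=> c u v [t tQ ->] [t' t'Q ->]; exists ([seq (c * p.1, p.2) | p <- t] ++ t').
    by move=> p; rewrite mem_cat => /orP[/mapP[p' /tQ ? ->]|/t'Q].
  rewrite big_cat big_map scaler_sumr; congr (_ + _).
  by apply: eq_bigr => p _; rewrite scalerA.
move=> v [i Qi ->]; exists [:: (1, i)]; last by rewrite big_seq1 scale1r.
by move=> p; rewrite inE => /eqP->.
Qed.

(** Applying T - e i removes the summand i and rescales the others. *)
Lemma eigen_separate (T : V -> V) (I : eqType) (t : seq I) (F : I -> V) (e : I -> k) a x :
  linear T -> T x = a *: x -> (forall i, i \in t -> T (F i) = e i *: F i) ->
  (forall i, i \in t -> e i != a) -> x = \sum_(i <- t) F i -> x = 0.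
Proof.
move=> Tl; elim: t F x => [|i t IH] F x Tx TF ne; first by rewrite big_nil.
move=> xE; have ai : a - e i != 0 by rewrite subr_eq0 eq_sym ne // mem_head.
apply: (scalerI ai); rewrite scaler0.
apply: (IH (fun j => (e j - e i) *: F j)) => [|j jt|j jt|].
- by rewrite (linZ Tl) Tx !scalerA mulrC.
- by rewrite (linZ Tl) TF ?inE ?jt ?orbT // !scalerA mulrC.
- by apply: ne; rewrite inE jt orbT.
have : T x - e i *: x = (a - e i) *: x by rewrite Tx scalerBl.
move=> <-; rewrite xE (lin_sum Tl) scaler_sumr -sumrB big_cons.
rewrite TF ?mem_head // subrr add0r big_seq [RHS]big_seq.
by apply: eq_bigr => j jt; rewrite TF ?inE ?jt ?orbT // -scalerBl.
Qed.

End LinSpan.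

Section HighestWeight.
Variables (k : fieldType) (G : semisimple_datum) (q : k).
Hypothesis q_neq0 : q != 0.
Hypothesis q_not_root : forall n : nat, (0 < n)%N -> q ^+ n != 1.
Variables (s : root_of_q G q) (U : quantum_env s).
Local Notation N := (rk G).
Local Notation weight := 'rV[rat]_(rk G).
Local Notation L := (lattice (s := G)).
Local Notation pairing := (weight_form (cartan G) (symd (s := G))).
Local Notation alpha := (@simple_root (rk G)).
Local Notation d := (symd (s := G)).
Local Notation "f • v" := (um_act f v) (at level 40).
Local Notation chi := (chi s).
Local Notation Fw := (Fw U).
Local Notation Ew := (Ew U).
Local Notation K := (Kf U).

Lemma um_act0r (V : uq_module U) (f : U) : f • (0 : V) = 0.
Proof. exact: (lin0 (um_linr f)). Qed.
Lemma um_act0l (V : uq_module U) (v : V) : (0 : U) • v = 0.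
Proof. exact: (lin0 (um_linl v)). Qed.

Section WeightVectors.
Variable V : uq_module U.

Lemma wvK nu (v : V) mu : weight_vector nu v -> L mu -> K mu • v = chi mu nu *: v.
Proof. by move=> h Lm; exact: h. Qed.

Lemma wv_Ff nu (v : V) i : L nu -> weight_vector nu v ->
  weight_vector (nu - alpha i) (Ff U i • v).
Proof.
move=> Ln wv mu Lmu; rewrite -um_actM KF // (linZ (um_linl v)) um_actM (wvK wv) //.
rewrite (linZ (um_linr _)) scalerA -/(chi _ _) (chiDr q_neq0 s Lmu Ln (LN (La i))) chiNr.
by rewrite mulrC.
Qed.

Lemma wv_Ef nu (v : V) i : L nu -> weight_vector nu v ->
  weight_vector (nu + alpha i) (Ef U i • v).
Proof.
move=> Ln wv mu Lmu; rewrite -um_actM KE // (linZ (um_linl v)) um_actM (wvK wv) //.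
rewrite (linZ (um_linr _)) scalerA -/(chi _ _) (chiDr q_neq0 s Lmu Ln (La i)).
by rewrite mulrC.
Qed.

Lemma wv_Fw nu (v : V) I : L nu -> weight_vector nu v ->
  weight_vector (nu - wt I) (Fw I • v).
Proof.
move=> Ln wv; elim: I => [|i I IH].
  by rewrite Fw_nil um_act1 wt_nil subr0.
rewrite Fw_cons um_actM wt_cons opprD [- _ + _]addrC addrA.
by apply: wv_Ff IH; exact: LB (Lwt I).
Qed.

Lemma wv_Ew nu (v : V) I : L nu -> weight_vector nu v ->
  weight_vector (nu + wt I) (Ew I • v).
Proof.
move=> Ln wv; elim: I => [|i I IH].
  by rewrite Ew_nil um_act1 wt_nil addr0.
rewrite Ew_cons um_actM wt_cons [_ + wt I]addrC addrA.
by apply: wv_Ef IH; exact: LD (Lwt I).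
Qed.

Lemma wv_weight_part (P : set U) ga nu p (v : V) : L ga -> L nu ->
  weight_part P ga p -> weight_vector nu v -> weight_vector (nu + ga) (p • v).
Proof.
move=> Lg Ln [_ pw] wv mu Lmu.
have Kp : K mu * p = chi ga mu *: (p * K mu).
  rewrite -[LHS]mulr1 -(KNK U Lmu) mulrA pw // -scalerAl.
  by [].
rewrite -um_actM Kp (linZ (um_linl v)) um_actM (wvK wv) // (linZ (um_linr _)) scalerA.
by rewrite -/(chi _ _) (chiDr q_neq0 s Lmu Ln Lg) mulrC (chiC s ga).
Qed.

End WeightVectors.

(** Proportional to the pairing of the regular weight with the weight of the
   word, see [rg_wt]. *)
Definition ht (I : seq 'I_N) : nat := \sum_(i <- I) d i.

Lemma ht_cons i I : ht (i :: I) = (d i + ht I)%N. Proof. exact: big_cons. Qed.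
Lemma ht_nil : ht [::] = 0%N. Proof. exact: big_nil. Qed.

Lemma ht_eq0 I : (ht I == 0%N) = (I == [::]).
Proof. by case: I => [|i I]; rewrite ?ht_nil // ht_cons addn_eq0 eqn0Ngt symd_gt0. Qed.

Variables (M : nat) (rg : weight).
Hypothesis M_gt0 : (0 < M)%N.
Hypothesis Lrg : L rg.
Hypothesis rgE : forall i, pairing rg (alpha i) = (2 * M * d i)%:R.

Lemma rg_wt I : pairing rg (wt I) = (2 * M * ht I)%:R.
Proof.
elim: I => [|i I IH]; first by rewrite wt_nil pairing0r ht_nil muln0.
by rewrite wt_cons pairingDr IH rgE ht_cons mulnDr natrD.
Qed.

Definition htq (ga : {ffun 'I_N -> nat}) : nat := \sum_i d i * ga i.

Lemma Lqroot ga : L (qroot_lattice ga : weight).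
Proof.
have -> : (qroot_lattice ga : weight) = \sum_i alpha i *+ ga i.
  rewrite [LHS]row_sum_delta; apply: eq_bigr => i _; rewrite mxE scaler_nat.
  by [].
by apply: L_sum => i; apply: LMn; exact: La.
Qed.

Lemma rg_qroot ga : pairing rg (qroot_lattice ga) = (2 * M * htq ga)%:R.
Proof.
have -> : (qroot_lattice ga : weight) = \sum_i alpha i *+ ga i.
  rewrite [LHS]row_sum_delta; apply: eq_bigr => i _; rewrite mxE scaler_nat.
  by [].
have sumE (F : 'I_N -> weight) : pairing rg (\sum_i F i) = \sum_i pairing rg (F i).
  by rewrite (big_morph _ (@pairingDr _ rg) (@pairing0r _ rg)).
rewrite sumE /htq big_distrr /= natr_sum; apply: eq_bigr => i _.
have -> : alpha i *+ ga i = (ga i)%:R *: alpha i by rewrite scaler_nat.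
by rewrite pairingC pairingZl pairingC rgE mulnA -natrM mulnC.
Qed.

Variables (V : uq_module U) (la : weight) (v0 : V).
Hypothesis Lla : L la.
Hypothesis V_irr : irreducible V.
Hypothesis v0_neq0 : v0 != 0.
Hypothesis v0_E : forall i, Ef U i • v0 = 0.
Hypothesis v0_wt : weight_vector la v0.

Lemma wv_Fv0 I : weight_vector (la - wt I) (Fw I • v0).
Proof. exact: wv_Fw. Qed.

Lemma um_stable (P : set V) : is_subspace P ->
  (forall mu v, L mu -> P v -> P (K mu • v)) ->
  (forall i v, P v -> P (Ef U i • v)) -> (forall i v, P v -> P (Ff U i • v)) ->
  forall f v, P v -> P (f • v).
Proof.
move=> Psub PK PE PF f; apply: (env_ind (P := [set f | forall v, P v -> P (f • v)])).
- split; first split.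
  + by move=> v _; rewrite um_act0l; exact: Psub.1.
  + by move=> c x y Px Py v Pv; rewrite um_linl; apply: Psub.2; [exact: Px|exact: Py].
  + by move=> v; rewrite um_act1.
  + by move=> x y Px Py v Pv; rewrite um_actM; apply: Px; exact: Py.
- by move=> mu Lmu v; exact: PK.
- by move=> i v; exact: PE.
- by move=> i v; exact: PF.
Qed.

Lemma irr_full (P : set V) x : is_subspace P -> (forall f v, P v -> P (f • v)) ->
  x != 0 -> P x -> forall v, P v.
Proof.
move=> Psub Pst x0 Px v; have [E|->//] := V_irr.2 P Psub Pst.
by move: Px; rewrite E => /= e; rewrite e eqxx in x0.
Qed.

Lemma E_Fv0 i I : lin_span [set v | exists2 I, True & v = Fw I • v0] (Ef U i • (Fw I • v0)).
Proof.
set P := lin_span _; have Psub : is_subspace P by exact: lin_span_subspace.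
have PF I' : P (Fw I' • v0) by apply: lin_span_gen; exists I'.
elim: I => [|j I IH]; first by rewrite Fw_nil um_act1 v0_E; exact: Psub.1.
have FP v : P v -> P (Ff U j • v).
  move=> Pv; apply: (lin_span_min (P := [set v | P (Ff U j • v)])) Pv.
    split; first by rewrite /= um_act0r; exact: Psub.1.
    by move=> c x y; rewrite /= um_linr; exact: Psub.2.
  by move=> _ [I' _ ->] /=; rewrite -um_actM -Fw_cons; exact: PF.
rewrite Fw_cons um_actM -um_actM EF (linD (um_linl _)) um_actM.
apply: (subspaceD Psub); first exact: FP.
case: eqP => _; last by rewrite um_act0l; exact: Psub.1.
rewrite (linZ (um_linl _)) (linB (um_linl _)).
apply: (subspaceZ _ Psub); apply: (subspaceB Psub); rewrite (wvK (wv_Fv0 I)).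
- exact: (subspaceZ _ Psub).
- exact: La.
- exact: (subspaceZ _ Psub).
- exact/LN/La.
Qed.

(** The words applied to the highest weight vector span a submodule, since a
   raising operator can be moved through a word. *)
Lemma hw_span (v : V) : lin_span [set v | exists2 I, True & v = Fw I • v0] v.
Proof.
set P := lin_span _; have Psub : is_subspace P by exact: lin_span_subspace.
have PF I' : P (Fw I' • v0) by apply: lin_span_gen; exists I'.
apply: (irr_full (x := v0)) => //; last by rewrite -[v0]um_act1 -(Fw_nil U); exact: PF.
have stab f : (forall I, P (f • (Fw I • v0))) -> forall v, P v -> P (f • v).
  move=> Pf; apply: (lin_span_min (P := [set v | P (f • v)])).
    split; first by rewrite /= um_act0r; exact: Psub.1.
    by move=> c x y; rewrite /= um_linr; exact: Psub.2.
  by move=> _ [I' _ ->] /=; exact: Pf.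
apply: um_stable => // [mu v' Lmu|i v'|i v'].
- by apply: stab => I; rewrite (wvK (wv_Fv0 I)) //; exact: (subspaceZ _ Psub).
- by apply: stab => I; exact: E_Fv0.
- by apply: stab => I; rewrite -um_actM -Fw_cons.
Qed.

Lemma Lhw I : L (la - wt I). Proof. exact: LB (Lwt I). Qed.

(** The element K of the regular weight has different eigenvalues on the
   words that occur and on the vector itself. *)
Lemma wv_separate m (x : V) (Q : seq 'I_N -> Prop) : L m -> weight_vector m x ->
  lin_span [set v | exists2 I, Q I & v = Fw I • v0] x ->
  (forall I, Q I -> pairing rg m != pairing rg la - (2 * M * ht I)%:R) -> x = 0.
Proof.
move=> Lm wx /lin_span_seq[t tQ xE] ne.
apply: (eigen_separate (T := um_act (K rg)) (t := t) (a := chi rg m)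
  (F := fun p => p.1 *: (Fw p.2 • v0)) (e := fun p => chi rg (la - wt p.2))) => //.
- exact: um_linr.
- exact: wvK.
- by move=> p pt; rewrite (linZ (um_linr _)) (wvK (wv_Fv0 _)) // !scalerA mulrC.
move=> p pt; apply/eqP => /(chi_inj q_neq0 q_not_root Lrg (Lhw _) Lrg Lm).
by rewrite pairingBr rg_wt => e; have /eqP := ne _ (tQ _ pt); rewrite e.
Qed.

(** No weight exceeds the highest one, measured against the regular weight. *)
Lemma wv_high m (x : V) : L m -> weight_vector m x -> pairing rg la < pairing rg m -> x = 0.
Proof.
move=> Lm wx lt; apply: (wv_separate Lm wx (hw_span x)) => I _.
by rewrite gt_eqF // (le_lt_trans _ lt) // lerBlDr lerDl.
Qed.

(** The complement of the line of the highest weight vector. *)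
Definition below : set V := lin_span [set v | exists2 I, I != [::] & v = Fw I • v0].

Lemma below_subspace : is_subspace below. Proof. exact: lin_span_subspace. Qed.

Lemma v0_below c : below (c *: v0) -> c = 0.
Proof.
move=> Bc; apply/eqP; apply: contraT => c0.
have B0 : below v0.
  rewrite -[v0]scale1r -(mulVf c0) -scalerA; exact: (subspaceZ _ below_subspace).
have := wv_separate Lla v0_wt B0; move=> h; move: v0_neq0; rewrite h ?eqxx // => I I0.
rewrite -subr_eq0 opprB addrC subrK pnatr_eq0 !muln_eq0.
by rewrite (gtn_eqF M_gt0) /= ht_eq0.
Qed.

Lemma hw_decomp (v : V) : exists c, below (v - c *: v0).
Proof.
have Bsub := below_subspace.
apply: (lin_span_min (P := [set v | exists c, below (v - c *: v0)]) _ _ (hw_span v)).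
  split; first by exists 0; rewrite scale0r subr0; exact: Bsub.1.
  move=> c x y [a Ba] [b Bb]; exists (c * a + b).
  have -> : c *: x + y - (c * a + b) *: v0 = c *: (x - a *: v0) + (y - b *: v0).
    by rewrite scalerDl scalerBr scalerA opprD addrACA.
  exact: Bsub.2.
move=> _ [I _ ->]; have [->|I0] := eqVneq I [::].
  by exists 1; rewrite Fw_nil um_act1 scale1r subrr; exact: Bsub.1.
by exists 0; rewrite scale0r subr0; apply: lin_span_gen; exists I.
Qed.

(** The functional dual to the highest weight vector, vanishing on [below]. *)
Definition u0 (v : V) : k := xget 0 [set c | below (v - c *: v0)].

Lemma u0P v c : below (v - c *: v0) -> u0 v = c.
Proof.
move=> Bc; have /= Bu : below (v - u0 v *: v0) by exact: (xgetPex 0 (hw_decomp v)).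
apply/eqP; rewrite -subr_eq0; apply/eqP; apply: v0_below.
have -> : (u0 v - c) *: v0 = (v - c *: v0) - (v - u0 v *: v0).
  by rewrite scalerBl opprB [RHS]addrC addrA subrK.
exact: (subspaceB below_subspace).
Qed.

Lemma u0_below v : below (v - u0 v *: v0).
Proof. exact: (xgetPex 0 (hw_decomp v)). Qed.

Lemma u0_scalar : scalar u0.
Proof.
move=> c x y; apply: u0P.
have -> : c *: x + y - (c * u0 x + u0 y) *: v0 = c *: (x - u0 x *: v0) + (y - u0 y *: v0).
  by rewrite scalerDl scalerBr scalerA opprD addrACA.
by apply: below_subspace.2; exact: u0_below.
Qed.

Lemma u0_lin : linear (u0 : V -> k^o). Proof. exact: u0_scalar. Qed.

Lemma u0_v0 : u0 v0 = 1.
Proof. by apply: u0P; rewrite scale1r subrr; exact: below_subspace.1. Qed.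

Lemma u0_Fw I : I != [::] -> u0 (Fw I • v0) = 0.
Proof. by move=> I0; apply: u0P; rewrite scale0r subr0; apply: lin_span_gen; exists I. Qed.

Lemma u0_Ff i v : u0 (Ff U i • v) = 0.
Proof.
apply: (lin_span_min (P := [set v | u0 (Ff U i • v) = 0]) _ _ (hw_span v)).
  split; first by rewrite /= um_act0r (lin0 u0_lin).
  by move=> c x y /= ux uy; rewrite um_linr u0_lin ux uy scaler0 addr0.
by move=> _ [I _ ->] /=; rewrite -um_actM -Fw_cons u0_Fw.
Qed.

Lemma u0_K mu v : L mu -> u0 (K mu • v) = chi mu la * u0 v.
Proof.
move=> Lmu.
apply: (lin_span_min (P := [set v | u0 (K mu • v) = chi mu la * u0 v]) _ _ (hw_span v)).
  split; first by rewrite /= um_act0r (lin0 u0_lin) mulr0.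
  move=> c x y /= ux uy; rewrite um_linr !u0_lin ux uy mulrDr.
  by congr (_ + _); exact: mulrCA.
move=> _ [I _ ->] /=; rewrite (wvK (wv_Fv0 I)) // (linZ u0_lin).
have [->|I0] := eqVneq I [::]; first by rewrite wt_nil subr0.
by rewrite u0_Fw // mulr0; exact: mulr0.
Qed.

Lemma u0_wv m x : L m -> weight_vector m x -> pairing rg m != pairing rg la -> u0 x = 0.
Proof.
move=> Lm wx ne; have := u0_K x Lrg; rewrite (wvK wx Lrg) (linZ u0_lin) => e.
have /eqP : (chi rg m - chi rg la) * u0 x = 0 by rewrite mulrBl -e subrr.
rewrite mulf_eq0 subr_eq0 => /orP[/eqP e'|/eqP//].
by move: ne; rewrite (chi_inj q_neq0 q_not_root Lrg Lm Lrg Lla e') eqxx.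
Qed.

(** The vectors killed by the functional after every raising word form a
   submodule, and it does not contain the highest weight vector. *)
Lemma u0_E_separate (v : V) : (forall J, u0 (Ew J • v) = 0) -> v = 0.
Proof.
pose P : set V := [set v | forall J, u0 (Ew J • v) = 0].
move=> Pv; apply/eqP; apply: contraT => v_neq0.
have Psub : is_subspace P.
  split; first by move=> J; rewrite um_act0r (lin0 u0_lin).
  by move=> c x y Px Py J; rewrite um_linr u0_lin Px Py scaler0 addr0.
have PK mu x : L mu -> P x -> P (K mu • x).
  move=> Lmu Px J; rewrite -um_actM.
  have -> : Ew J * K mu = (chi mu (wt J))^-1 *: (K mu * Ew J).
    by rewrite KEw // scalerA mulVf ?chi_neq0 // scale1r.
  by rewrite (linZ (um_linl _)) (linZ u0_lin) um_actM u0_K // Px mulr0 [_ *: _]mulr0.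
have PE i x : P x -> P (Ef U i • x) by move=> Px J; rewrite -um_actM -Ew_rcons.
have PF i x : P x -> P (Ff U i • x).
  move=> Px J; elim/last_ind: J x Px => [|J j IH] x Px.
    by rewrite Ew_nil um_act1 u0_Ff.
  rewrite Ew_rcons um_actM -[Ef U j • _]um_actM EF (linD (um_linl x)) (linD (um_linr _)).
  rewrite (linD u0_lin) um_actM IH ?add0r; last exact: PE.
  case: eqP => _; last by rewrite um_act0l um_act0r (lin0 u0_lin).
  rewrite (linZ (um_linl x)) (linZ (um_linr _)) (linZ u0_lin).
  rewrite (linB (um_linl x)) (linB (um_linr _)) (linB u0_lin).
  by rewrite !PK ?subrr ?scaler0 //; [exact/LN/La|exact: La].
have full := irr_full Psub (um_stable Psub PK PE PF) v_neq0 Pv.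
have := full v0 [::]; rewrite Ew_nil um_act1 u0_v0 => /eqP.
by rewrite oner_eq0.
Qed.

(** The weight of the result would exceed the highest weight. *)
Lemma E_nilpotent_on I ga (P : set U) p : weight_part P (qroot_lattice ga) p ->
  (ht I < htq ga)%N -> p • (Fw I • v0) = 0.
Proof.
move=> pw lt; have Lm := LD (Lhw I) (Lqroot ga).
apply: (wv_high Lm (wv_weight_part (Lqroot ga) (Lhw I) pw (wv_Fv0 I))).
rewrite pairingDr pairingBr rg_wt rg_qroot -addrA ltrDl addrC subr_gt0 ltr_nat.
by rewrite ltn_pmul2l // muln_gt0.
Qed.

Lemma Ew_kills I J : (ht I < ht J)%N -> Ew J • (Fw I • v0) = 0.
Proof.
move=> lt; have Lm := LD (Lhw I) (Lwt J).
apply: (wv_high Lm (wv_Ew J (Lhw I) (wv_Fv0 I))).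
rewrite pairingDr pairingBr !rg_wt -addrA ltrDl addrC subr_gt0 ltr_nat.
by rewrite ltn_pmul2l // muln_gt0.
Qed.

Section Nilpotent.
Variable n : nat.
Hypothesis F_nil : forall I, (n <= ht I)%N -> Fw I • v0 = 0.

(** The weight of the result is lower than that of every word acting
   nontrivially. *)
Lemma F_nilpotent_on I ga (P : set U) p : weight_part P (- qroot_lattice ga) p ->
  (n <= ht I + htq ga)%N -> p • (Fw I • v0) = 0.
Proof.
move=> pw le; have Lg := LN (Lqroot ga); have Lm := LD (Lhw I) Lg.
have wx := wv_weight_part Lg (Lhw I) pw (wv_Fv0 I).
apply: (wv_separate (Q := fun I => (ht I < n)%N) Lm wx).
  apply: (lin_span_min _ _ (hw_span (p • (Fw I • v0)))).
    exact: lin_span_subspace.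
  move=> _ [I' _ ->]; have [lt|ge] := ltnP (ht I') n.
    by apply: lin_span_gen; exists I'.
  by rewrite F_nil //; exact: (lin_span_subspace _).1.
move=> I' lt; rewrite pairingDr pairingBr pairingNr rg_wt rg_qroot -addrA -opprD.
rewrite -natrD -mulnDr (inj_eq (addrI _)) eqr_opp eqr_nat eqn_pmul2l ?muln_gt0 //.
by rewrite gtn_eqF // (leq_trans lt le).
Qed.

End Nilpotent.

End HighestWeight.

(** * The coordinate algebra as functionals *)

Section Coordinates.
Variables (k : fieldType) (G : semisimple_datum) (q : k).
Hypothesis q_neq0 : q != 0.
Hypothesis q_not_root : forall n : nat, (0 < n)%N -> q ^+ n != 1.
Variables (s : root_of_q G q) (U : quantum_env s) (A : quantum_coord U).
Local Notation N := (rk G).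
Local Notation weight := 'rV[rat]_(rk G).
Local Notation L := (lattice (s := G)).
Local Notation pairing := (weight_form (cartan G) (symd (s := G))).
Local Notation alpha := (@simple_root (rk G)).
Local Notation d := (symd (s := G)).
Local Notation "f • v" := (um_act f v) (at level 40).
Local Notation chi := (chi s).
Local Notation Fw := (Fw U).
Local Notation Ew := (Ew U).
Local Notation K := (Kf U).
Local Notation "a ·· b" := (hmul a b) (at level 40, left associativity).
Variables (M : nat) (rg : weight).
Hypothesis M_gt0 : (0 < M)%N.
Hypothesis Lrg : L rg.
Hypothesis rgE : forall i, pairing rg (alpha i) = (2 * M * d i)%:R.

Let hA := qc_is_hopf A.
Let hC := hopf_coalgebra hA.
Local Notation C1 := (conv_alg k^o hC).

Definition is_highest (V : uq_module U) (la : weight) (v0 : V) : Prop :=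
  [/\ L la, irreducible V, v0 != 0, forall i, Ef U i • v0 = 0 & weight_vector la v0].

Lemma type_LP (V : uq_module U) : type_L V ->
  exists (la : weight) (v0 : V), is_highest la v0.
Proof. by move=> [la [Ll _] [irr [v [v0 vE vw]]]]; exists la, v. Qed.

Lemma ev_l (f : U) : linear (fun c : A => qc_ev c f : k^o).
Proof. exact: qc_ev_linl. Qed.

Lemma ev_inj (c c' : A) : (forall f, qc_ev c f = qc_ev c' f) -> c = c'.
Proof. exact: qc_ev_inj. Qed.

Lemma coef_ex (V : uq_module U) (u : V -> k) (v : V) : type_L V -> scalar u ->
  exists c : A, forall f, qc_ev c f = u (f • v).
Proof.
move=> tV us; have := qc_ev_image A.
move=> /(congr1 (fun P : set (U -> k^o) => P (matrix_coeff u v))) E.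
have : lin_span (@matrix_coeffs k G q s U) (matrix_coeff u v).
  by apply: lin_span_gen; exists V, u, v.
by rewrite -E => -[c _ cE]; exists c => f; rewrite cE.
Qed.

(** The coordinate algebra is spanned by coefficients taken at words applied
   to highest weight vectors. *)
Lemma coord_ind (P : set A) : is_subspace P ->
  (forall (V : uq_module U) la (v0 : V) (u : V -> k) I c, type_L V ->
     is_highest la v0 -> scalar u ->
     (forall f, qc_ev c f = u (f • (Fw I • v0))) -> P c) -> forall a, P a.
Proof.
move=> Psub Pc a.
suff [c Pa e] : exists2 c, P c & qc_ev c = qc_ev a :> (U -> k^o).
  by have <- : c = a by apply: ev_inj => f; rewrite e.
have : lin_span (@matrix_coeffs k G q s U) (qc_ev a).
  by rewrite -(qc_ev_image A); exists a.
apply: (lin_span_min (P := [set g : U -> k^o | exists2 c, P c & qc_ev c = g :> (U -> k^o)])).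
  split; first by exists 0; [exact: Psub.1|apply: funext => f; exact: (lin0 (ev_l f))].
  move=> t _ _ [c Pc1 <-] [c' Pc2 <-]; exists (t *: c + c'); first exact: Psub.2.
  by apply: funext => f; rewrite ev_l.
move=> _ [V [u [v [tV us ->]]]].
have [la [v0 hw]] := type_LP tV; have [Ll irr v00 v0E v0w] := hw.
pose W := [set v : V | exists2 c, P c & forall f, qc_ev c f = u (f • v)].
have : W v.
  apply: (lin_span_min _ _ (hw_span q_neq0 Ll irr v00 v0E v0w v)).
    split.
      exists 0; first exact: Psub.1.
      by move=> f; rewrite um_act0r (lin0 (ev_l f)) (lin0 (us : linear (u : V -> k^o))).
    move=> t x y [c Pc1 cE] [c' Pc2 c'E]; exists (t *: c + c'); first exact: Psub.2.
    by move=> f; rewrite um_linr us ev_l cE c'E.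
  move=> _ [I _ ->]; have [c cE] := coef_ex (Fw I • v0) tV us.
  by exists c => //; exact: (Pc V la v0 u I c).
by move=> [c Pc1 cE]; exists c => //; apply: funext => f; rewrite cE.
Qed.

Lemma ev_r (c : A) : linear (qc_ev c : U -> k^o).
Proof.
move: c; apply: (coord_ind (P := [set c | linear (qc_ev c : U -> k^o)])).
  split; first by move=> t x y; rewrite /= !(lin0 (ev_l _)) scaler0 addr0.
  move=> t c c' cl c'l x f g; rewrite !ev_l cl c'l !scalerDr !scalerA.
  by rewrite addrACA mulrC.
move=> V la v0 u I c tV hw us cE t x y.
by rewrite !cE um_linl us.
Qed.

Lemma evM (c c' : A) f : qc_ev (c ·· c') f =
  \tsum_(f1, f2 <- qe_comul f) (qc_ev c f1 * qc_ev c' f2).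
Proof. exact: qc_evM. Qed.

Lemma ev_comul (c : A) f g :
  \tsum_(c1, c2 <- hcomul c) (qc_ev c1 f * qc_ev c2 g) = qc_ev c (f * g).
Proof. exact: qc_ev_comul. Qed.

(** ** Translations and the algebra map to functionals *)

Definition lact (f : U) (c : A) : A := \tsum_(c1, c2 <- hcomul c) (qc_ev c2 f *: c1).
Definition ract (c : A) (f : U) : A := \tsum_(c1, c2 <- hcomul c) (qc_ev c1 f *: c2).

Lemma ev_lact f c g : qc_ev (lact f c) g = qc_ev c (g * f).
Proof.
rewrite -ev_comul; have := lin_tsum (fun c1 c2 => qc_ev c2 f *: c1) (hcomul c) (ev_l g).
by rewrite -/(lact f c) => ->; apply: eq_tsum => c1 c2; rewrite (linZ (ev_l g)) [_ *: _]mulrC.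
Qed.

Lemma ev_ract f c g : qc_ev (ract c f) g = qc_ev c (f * g).
Proof.
rewrite -ev_comul; have := lin_tsum (fun c1 c2 => qc_ev c1 f *: c2) (hcomul c) (ev_l g).
by rewrite -/(ract c f) => ->; apply: eq_tsum => c1 c2; rewrite (linZ (ev_l g)).
Qed.

Lemma lact_linear f : linear (lact f).
Proof.
by move=> t x y; apply: ev_inj => g; rewrite ev_l !ev_lact ev_l.
Qed.

Lemma ract_linear f : linear (ract^~ f).
Proof.
by move=> t x y; apply: ev_inj => g; rewrite ev_l !ev_ract ev_l.
Qed.

(** The map from the quantum group to functionals on its coordinate algebra. *)
Definition kap (f : U) : C1 := cv_of hC (ev_l f).

Lemma mul_kap (phi : C1) f c : (phi * kap f) c = phi (lact f c).
Proof.
rewrite cvM (lin_tsum _ _ (cv_linear phi)); apply: eq_tsum => c1 c2.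
by rewrite (linZ (cv_linear phi)) mulrC.
Qed.

Lemma kap_mul (phi : C1) f c : (kap f * phi) c = phi (ract c f).
Proof.
rewrite cvM (lin_tsum _ _ (cv_linear phi)); apply: eq_tsum => c1 c2.
by rewrite (linZ (cv_linear phi)).
Qed.

Lemma ev_hantip (c : A) f : qc_ev (hantip c) f = qc_ev c (qe_antip f).
Proof. exact: qc_ev_antip. Qed.

(** The quantum group separates tensors: one summand at a time is eliminated
   by Gaussian elimination. *)
Lemma ev_tens_sep (x : (A ⊗ A)%type) :
  (forall f g, \tsum_(a, b <- x) (qc_ev a f * qc_ev b g) = 0) -> x = 0.
Proof.
rewrite -(tsum_id x).
suff H n (t : seq (A * A)) : size t = n ->
    (forall f g, \sum_(p <- t) qc_ev p.1 f * qc_ev p.2 g = 0) ->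
    \sum_(p <- t) p.1 ⊗ p.2 = 0.
  move=> x0; apply: (H (size (repr x)) (repr x)) => // f g.
  by have := x0 f g; rewrite tsum_id.
elim: n t => [|n IH] [|[a b] t] // => [_ _|]; first by rewrite big_nil.
move=> [st] t0; have [a0|a_neq0] := eqVneq a 0.
  rewrite big_cons a0 /= (lin0 (tensl_linear b)) add0r; apply: IH => // f g.
  by have := t0 f g; rewrite big_cons /= a0 (lin0 (ev_l f)) mul0r add0r.
have [f af] : exists f, qc_ev a f != 0.
  apply: contrapT => nex; move/eqP: a_neq0; apply; apply: ev_inj => f.
  rewrite (lin0 (ev_l f)); apply/eqP; apply: contraT => af.
  by exfalso; apply: nex; exists f.
pose e (p : A * A) := qc_ev p.1 f / qc_ev a f.
have bE : b = - \sum_(p <- t) e p *: p.2.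
  apply: ev_inj => g; rewrite (linN (ev_l g)) (lin_sum (ev_l g)).
  apply: (mulfI af); have := t0 f g; rewrite big_cons /= => /eqP; rewrite addr_eq0 => /eqP->.
  rewrite mulrN mulr_sumr; congr (- _); apply: eq_bigr => p _.
  rewrite (linZ (ev_l g)) -[_ *: _]/(e p * qc_ev p.2 g) mulrA /e mulrCA mulfV //.
  by rewrite mulr1.
have {}IH := IH [seq (p.1 - e p *: a, p.2) | p <- t].
rewrite big_cons /= bE (linN (tensr_linear a)) (lin_sum (tensr_linear a)) addrC -sumrB.
rewrite -[RHS]IH ?size_map // => [|f' g'].
  rewrite big_map; apply: eq_bigr => p _ /=.
  by rewrite (linB (tensl_linear p.2)) (linZ (tensl_linear p.2)) (linZ (tensr_linear a)).
have := t0 f' g'; rewrite big_cons /= [in X in X -> _]bE (linN (ev_l g')) (lin_sum (ev_l g')) => e0.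
rewrite big_map -[RHS]e0 addrC mulrN mulr_sumr -sumrB; apply: eq_bigr => p _ /=.
rewrite (linB (ev_l f')) (linZ (ev_l f')) (linZ (ev_l g')) mulrBl; congr (_ - _).
exact: (esym (etrans (mulrCA _ _ _) (mulrA _ _ _))).
Qed.

(** The antipode of the quantum group is antimultiplicative, and the quantum
   group separates tensors. *)
Lemma coord_antip_comul (x : A) :
  hcomul (hantip x) = \tsum_(a, b <- hcomul x) (hantip b ⊗ hantip a).
Proof.
apply/eqP; rewrite -subr_eq0; apply/eqP; apply: ev_tens_sep => f g.
have B : bilinear_map (fun a b : A => qc_ev a f * qc_ev b g : k^o).
  by split=> z; [apply: mulr_linr|apply: mulr_linl]; exact: ev_l.
rewrite [LHS](linB (tsum_linear B)) (lin_tsum _ _ (tsum_linear B)).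
apply/eqP; rewrite subr_eq0; apply/eqP; rewrite [LHS]ev_comul ev_hantip env_antipM -ev_comul.
by apply: eq_tsum => a b; rewrite (tsum_tens B) !ev_hantip mulrC.
Qed.

(** ** Surjectivity of the antipode *)

Local Notation SU := (@qe_antip k G q s U).

Let SU_lin : linear SU.
Proof. exact: env_antip_linear. Qed.

Lemma antip2_E i : SU (SU (Ef U i)) = chi (alpha i) (alpha i) *: Ef U i.
Proof.
have lin := SU_lin.
rewrite qe_antipE (linN lin) env_antipM qe_antipE qe_antipK; last exact/LN/La.
rewrite opprK mulrN opprK mulrA KE; last exact: La.
by rewrite -scalerAl -mulrA KKN ?mulr1 //; exact: La.
Qed.

Lemma antip2_F i : SU (SU (Ff U i)) = (chi (alpha i) (alpha i))^-1 *: Ff U i.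
Proof.
have lin := SU_lin.
rewrite qe_antipF (linN lin) env_antipM qe_antipF qe_antipK; last exact: La.
rewrite mulNr opprK KF; last exact: La.
by rewrite -scalerAl -mulrA KKN ?mulr1 //; exact: La.
Qed.

Lemma antip_iterM n x y : iter n.*2 SU (x * y) = iter n.*2 SU x * iter n.*2 SU y.
Proof. by elim: n => //= n ->; rewrite !env_antipM. Qed.

Lemma antip_iter_linear n : linear (iter n SU).
Proof. by elim: n => [|n IH] //=; exact: (comp_linear SU_lin IH). Qed.

Lemma chi_rg i : chi rg (alpha i) = chi (alpha i) (alpha i) ^+ M.
Proof.
have e : lexp s rg (alpha i) = lexp s (alpha i) (alpha i) * M%:Z.
  apply: (@intr_inj rat); rewrite rmorphM /= !lexpE //; try exact: La.
  by rewrite rgE pairing_root cartan_diag !natrM -!pmulrn; ring.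
by rewrite !chiE e -exprz_exp.
Qed.

(** On generators the square of the antipode is a scalar power of q, and the
   regular weight was chosen so that conjugation by its K has the same
   effect as a power of that square. *)
Lemma antip_iter_conj x : iter M.*2 SU x = K rg * x * K (- rg).
Proof.
have Ladm := antip_iter_linear M.*2.
move: x; apply: (env_ind (P := [set x | iter M.*2 SU x = K rg * x * K (- rg)])).
- split; first split.
  + by rewrite /= (lin0 Ladm) mulr0 mul0r.
  + by move=> t x y /= Ex Ey; rewrite Ladm Ex Ey mulrDr mulrDl -scalerAr -scalerAl.
  + have e1 : iter M.*2 SU 1 = 1 by elim: (M) => //= n ->; rewrite !env_antip1.
    by rewrite /= e1 mulr1 KKN.
  + move=> x y /= Ex Ey; rewrite antip_iterM Ex Ey !mulrA.
    by rewrite -[_ * K (- rg) * K rg]mulrA KNK // mulr1.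
- move=> la Ll /=; rewrite KC // -mulrA KKN // mulr1.
  by elim: (M) => //= n ->; rewrite !qe_antipK ?opprK //; exact: LN.
- move=> i /=; rewrite KE // -scalerAl -mulrA KKN // mulr1.
  rewrite chi_rg; elim: (M) => [|n IH]; first by rewrite expr0 scale1r.
  rewrite doubleS /= IH !(linZ SU_lin) antip2_E scalerA exprSr.
  by [].
- move=> i /=; rewrite KF // -scalerAl -mulrA KKN // mulr1.
  rewrite chi_rg -exprVn; elim: (M) => [|n IH]; first by rewrite expr0 scale1r.
  rewrite doubleS /= IH !(linZ SU_lin) antip2_F scalerA exprSr.
  by [].
Qed.

Lemma ev_iter_hantip n (c : A) f : qc_ev (iter n (@hantip _ A) c) f = qc_ev c (iter n SU f).
Proof. by elim: n f => //= n IH f; rewrite ev_hantip IH -iterSr. Qed.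

(** A power of the antipode is a conjugation, which is invertible;
   translations by the same group-like element give the preimage. *)
Lemma coord_antip_surj (x : A) : exists y : A, hantip y = x.
Proof.
pose y := ract (lact (K rg) x) (K (- rg)).
have xE : x = iter M.*2 (@hantip _ A) y.
  apply: ev_inj => f; rewrite ev_iter_hantip antip_iter_conj ev_ract ev_lact.
  by rewrite !mulrA KNK // mul1r -mulrA KNK // mulr1.
by exists (iter M.*2.-1 (@hantip _ A) y); rewrite -iterS prednK ?double_gt0.
Qed.

(** ** Nilpotency of the lowering operators *)

(** A coefficient involves one vector, and on it long raising words vanish. *)
Lemma E_nilpotent_coord (a : A) :
  exists n, forall J x, (n <= ht J)%N -> qc_ev a (x * Ew J) = 0.
Proof.
move: a; apply: (coord_ind (P := [set a : A |
    exists n, forall J x, (n <= ht J)%N -> qc_ev a (x * Ew J) = 0])).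
  split; first by exists 0%N => J x _; exact: (lin0 (ev_l _)).
  move=> t a b [n an] [m bm]; exists (maxn n m) => J x; rewrite geq_max => /andP[nJ mJ].
  by rewrite ev_l an // bm // scaler0 addr0.
move=> V la v0 u I c tV [Ll irr v00 v0E v0w] us cE; exists (ht I).+1 => J x lt.
rewrite cE um_actM (Ew_kills q_neq0 q_not_root M_gt0 Lrg rgE Ll irr v00 v0E v0w lt).
by rewrite um_act0r (lin0 (us : linear (u : V -> k^o))).
Qed.

Lemma antip_Ew J : exists t mu, [/\ t != 0 , L mu & SU (Ew J) = t *: (K mu * Ew (rev J))].
Proof.
have lin := SU_lin.
elim: J => [|i J [t [mu [t0 Lmu IH]]]].
  exists 1, 0; split; [exact: oner_neq0|exact: L0|].
  by rewrite /rev /= !Ew_nil env_antip1 K0 mulr1 scale1r.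
set J' := rev J in IH; have Li := LN (La i).
exists (- t * (chi (- alpha i) (wt (rcons J' i)))^-1), (mu - alpha i); split.
- by rewrite mulf_neq0 ?oppr_eq0 ?invr_eq0 ?chi_neq0.
- exact: LB (La i).
rewrite Ew_cons env_antipM IH qe_antipE rev_cons.
have -> : K (mu - alpha i) = K mu * K (- alpha i) by rewrite KD.
rewrite mulrN -scalerAl -/J'.
have -> : K mu * Ew J' * (Ef U i * K (- alpha i)) =
    (chi (- alpha i) (wt (rcons J' i)))^-1 *: (K mu * K (- alpha i) * Ew (rcons J' i)).
  rewrite -(mulrA (K mu)) -(mulrA (K mu)) (KEw q_neq0 U _ Li) -scalerAr scalerA.
  by rewrite mulVf ?scale1r ?chi_neq0 // Ew_rcons !mulrA.
by rewrite scalerA -scaleNr mulNr.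
Qed.

(** The antipode of the coefficient at the highest weight vector is again a
   coefficient; long raising words vanish in it, which bounds the raising
   words that lead back to the highest weight, hence the length of
   nonvanishing lowering words. This stands in for finite-dimensionality. *)
Lemma F_nilpotent (V : uq_module U) la (v0 : V) : type_L V -> is_highest la v0 ->
  exists n, forall I, (n <= ht I)%N -> Fw I • v0 = 0.
Proof.
move=> tV [Ll irr v00 v0E v0w].
pose u := u0 v0.
have us : scalar u by exact: (u0_scalar q_neq0 q_not_root M_gt0 Lrg rgE Ll irr v00 v0E v0w).
have u0l : linear (u : V -> k^o) by exact: us.
have [c cE] := coef_ex v0 tV us.
have [n nE] := E_nilpotent_coord (hantip c).
have ht_rev J : ht (rev J) = ht J by rewrite /ht (perm_big J) // perm_rev.
have uE J v : (n <= ht J)%N -> (exists y, v = y • v0) -> u (Ew J • v) = 0.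
  move=> nJ [y ->]; have [x xE] := env_antip_surj y.
  have := nE (rev J) x; rewrite ht_rev => /(_ nJ); rewrite ev_hantip env_antipM xE.
  have [t [mu [t0 Lmu ->]]] := antip_Ew (rev J); rewrite revK cE -scalerAl.
  rewrite (linZ (um_linl v0)) (linZ u0l) => /eqP; rewrite [_ *: _]/(_ * _) mulf_eq0 (negbTE t0) /=.
  rewrite !um_actM /u (u0_K q_neq0 q_not_root M_gt0 Lrg rgE Ll irr v00 v0E v0w) //.
  by rewrite mulf_eq0 (negbTE (chi_neq0 q_neq0 s _ _)) => /eqP.
exists n => I nI.
apply: (u0_E_separate q_neq0 q_not_root M_gt0 Lrg rgE Ll irr v00 v0E v0w) => J.
have [nJ|Jn] := leqP n (ht J); first by apply: uE => //; exists (Fw I).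
have Fwt : weight_vector (la - wt I) (Fw I • v0) by exact: wv_Fv0.
have LI := LB Ll (Lwt I); have LJ := LD LI (Lwt J).
apply: (u0_wv q_neq0 q_not_root M_gt0 Lrg rgE Ll irr v00 v0E v0w LJ).
  exact: wv_Ew.
rewrite pairingDr pairingBr !(rg_wt rgE) -addrA -subr_eq0 addrAC subrr add0r.
rewrite addrC subr_eq0 eqr_nat eqn_pmul2l ?muln_gt0 //.
by rewrite ltn_eqF // (leq_trans Jn nI).
Qed.

End Coordinates.

(** * The universal r-form *)

Section RForm.
Variables (k : fieldType) (G : semisimple_datum) (q : k).
Hypothesis q_neq0 : q != 0.
Hypothesis q_not_root : forall n : nat, (0 < n)%N -> q ^+ n != 1.
Variables (s : root_of_q G q) (U : quantum_env s) (A : quantum_coord U).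
Local Notation N := (rk G).
Local Notation weight := 'rV[rat]_(rk G).
Local Notation L := (lattice (s := G)).
Local Notation pairing := (weight_form (cartan G) (symd (s := G))).
Local Notation alpha := (@simple_root (rk G)).
Local Notation d := (symd (s := G)).
Local Notation "f • v" := (um_act f v) (at level 40).
Local Notation chi := (chi s).
Local Notation Fw := (Fw U).
Local Notation Ew := (Ew U).
Local Notation K := (Kf U).
Local Notation "a ·· b" := (hmul a b) (at level 40, left associativity).
Local Notation qr ga := (qroot_lattice ga : weight).
Local Notation ev := (@qc_ev k G q s U A).
Variables (M : nat) (rg : weight).
Hypothesis M_gt0 : (0 < M)%N.
Hypothesis Lrg : L rg.
Hypothesis rgE : forall i, pairing rg (alpha i) = (2 * M * d i)%:R.
Variables (Rm : universal_R U) (r : A -> A -> k).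
Hypothesis hr : is_standard_rform Rm r.

Let hA := qc_is_hopf A.
Let hC := hopf_coalgebra hA.
Local Notation C1 := (conv_alg k^o hC).

Section TensorAct.
Variables V V' : uq_module U.

Fact tact_inner_bilinear (f g : U) :
  bilinear_map (fun (v : V) (v' : V') => (f • v) ⊗ (g • v')).
Proof.
split=> z; first exact: (comp_linear (tensr_linear _) (um_linr g)).
by apply: (comp_linear (f := fun x => x ⊗ _)); [exact: tensl_linear|exact: um_linr].
Qed.

Fact tact_outer_bilinear (x : (V ⊗ V')%type) :
  bilinear_map (fun f g : U => \tsum_(v, v' <- x) ((f • v) ⊗ (g • v'))).
Proof.
split=> z; apply: tsum_param_linear => v v'.
  exact: (comp_linear (tensr_linear _) (um_linl v')).
by apply: (comp_linear (f := fun x => x ⊗ _)); [exact: tensl_linear|exact: um_linl].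
Qed.

Lemma tact_lin1 (x : (V ⊗ V')%type) : linear (fun t : (U ⊗ U)%type => tensor_act t x).
Proof. exact: (tsum_linear (tact_outer_bilinear x)). Qed.

Lemma tact_lin2 (t : (U ⊗ U)%type) : linear (@tensor_act k G q s U V V' t).
Proof. apply: tsum_param_linear => f g; exact: (tsum_linear (tact_inner_bilinear f g)). Qed.

Lemma tactE f g v v' : tensor_act (f ⊗ g : (U ⊗ U)%type) (v ⊗ v' : (V ⊗ V')%type) =
  (f • v) ⊗ (g • v').
Proof.
by rewrite /tensor_act (tsum_tens (tact_outer_bilinear _)) (tsum_tens (tact_inner_bilinear f g)).
Qed.

End TensorAct.

(** ** The family Theta *)

Definition theta ga : seq (U * U) := s2val (cid2 (uR_Theta_weight Rm ga)).

Lemma theta_weight ga p : p \in theta ga ->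
  weight_part (nplus (U := U)) (qr ga) p.1 /\ weight_part (nminus (U := U)) (- qr ga) p.2.
Proof. exact: (s2valP (cid2 (uR_Theta_weight Rm ga))). Qed.

Lemma thetaE ga : uR_Theta Rm ga = \sum_(p <- theta ga) (p.1 ⊗ p.2).
Proof. exact: (s2valP' (cid2 (uR_Theta_weight Rm ga))). Qed.

(** A finite set containing all weights of bounded height. *)
Definition gammas n : seq {ffun 'I_N -> nat} :=
  [seq [ffun i => nat_of_ord ((g : {ffun 'I_N -> 'I_n}) i)] | g <- enum {ffun 'I_N -> 'I_n}].

Lemma gammas_uniq n : uniq (gammas n).
Proof.
rewrite map_inj_uniq ?enum_uniq // => g g' /ffunP e; apply/ffunP => i.
by apply: val_inj; have := e i; rewrite !ffunE.
Qed.

Lemma mem_gammas n ga : (htq ga < n)%N -> ga \in gammas n.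
Proof.
move=> lt; have gal i : (ga i < n)%N.
  apply: leq_ltn_trans lt; rewrite /htq (bigD1 i) //=; apply: leq_trans (leq_addr _ _).
  by rewrite leq_pmull // symd_gt0.
apply/mapP; exists [ffun i => Ordinal (gal i)]; first by rewrite mem_enum.
by apply/ffunP => i; rewrite !ffunE.
Qed.

Lemma fsum_gammas (X : zmodType) (F : {ffun 'I_N -> nat} -> X) n :
  (forall ga, (n <= htq ga)%N -> F ga = 0) ->
  \sum_(ga \in [set: {ffun 'I_N -> nat}]) F ga = \sum_(ga <- gammas n) F ga.
Proof.
move=> F0; rewrite (fsbigE (gammas n)) ?gammas_uniq //=.
  by apply: eq_bigl => ga; rewrite in_setT.
move=> ga _ ng; apply: F0; rewrite leqNgt; apply: contra ng; exact: mem_gammas.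
Qed.

Section TypeL.
Variables V V' : uq_module U.
Hypothesis tV : type_L V.
Hypothesis tV' : type_L V'.

(** On a given tensor almost all components of Theta vanish, as their first
   factors raise the weight too much. *)
Lemma Theta_finite (x : (V ⊗ V')%type) :
  exists n, forall ga, (n <= htq ga)%N -> tensor_act (uR_Theta Rm ga) x = 0.
Proof.
have [la [v0 [Ll irr v00 v0E v0w]]] := type_LP tV.
pose P := [set x : (V ⊗ V')%type | exists n, forall ga, (n <= htq ga)%N ->
  tensor_act (uR_Theta Rm ga) x = 0].
have Psub : is_subspace P.
  split; first by exists 0%N => ga _; exact: (lin0 (tact_lin2 _)).
  move=> c y z [n nP] [m mP]; exists (maxn n m) => ga; rewrite geq_max => /andP[ng mg].
  by rewrite tact_lin2 nP // mP // scaler0 addr0.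
rewrite -(tsum_id x); apply: (subspace_sum _ Psub) => -[v v'] /=.
apply: (lin_span_min (P := [set v | P (v ⊗ v')]) _ _ (hw_span q_neq0 Ll irr v00 v0E v0w v)).
  split; first by rewrite /= (lin0 (tensl_linear v')); exact: Psub.1.
  by move=> c y z Py Pz; rewrite /= tensl_linear; exact: Psub.2.
move=> _ [I _ ->] /=; exists (ht I).+1 => ga lt.
rewrite thetaE (lin_sum (tact_lin1 _)) big_seq big1 // => p /theta_weight[pw _].
rewrite tactE (E_nilpotent_on q_neq0 q_not_root M_gt0 Lrg rgE Ll irr v00 v0E v0w pw lt).
exact: (lin0 (tensl_linear _)).
Qed.

Lemma uR_opE n (x : (V ⊗ V')%type) :
  (forall ga, (n <= htq ga)%N -> tensor_act (uR_Theta Rm ga) x = 0) ->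
  uR_op Rm x = uR_D Rm (\sum_(ga <- gammas n) tensor_act (uR_Theta Rm ga) x).
Proof. by move=> x0; rewrite /uR_op (fsum_gammas x0). Qed.

Lemma uR_op_linear : linear (@uR_op k G q s U Rm V V').
Proof.
move=> c x y; have [n nx] := Theta_finite x; have [m my] := Theta_finite y.
pose l := maxn n m.
have xE ga : (l <= htq ga)%N -> tensor_act (uR_Theta Rm ga) x = 0.
  by rewrite geq_max => /andP[ng _]; exact: nx.
have yE ga : (l <= htq ga)%N -> tensor_act (uR_Theta Rm ga) y = 0.
  by rewrite geq_max => /andP[_ mg]; exact: my.
rewrite (uR_opE xE) (uR_opE yE) (@uR_opE l) => [|ga lg]; last first.
  by rewrite tact_lin2 xE // yE // scaler0 addr0.
rewrite -(uR_D_lin Rm tV tV'); congr (uR_D Rm _); rewrite scaler_sumr -big_split /=.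
by apply: eq_bigr => ga _; rewrite tact_lin2.
Qed.

End TypeL.

Definition omega (V V' : uq_module U) (u : V -> k) (u' : V' -> k)
  (t : (V ⊗ V')%type) : k^o := \tsum_(w, w' <- t) (u w * u' w').

Lemma omega_bilinear (V V' : uq_module U) (u : V -> k) (u' : V' -> k) :
  scalar u -> scalar u' -> bilinear_map (fun w w' => u w * u' w' : k^o).
Proof. by move=> us us'; split=> z; [apply: mulr_linr|apply: mulr_linl]. Qed.

Lemma omega_linear (V V' : uq_module U) (u : V -> k) (u' : V' -> k) :
  scalar u -> scalar u' -> linear (omega u u').
Proof. by move=> us us'; exact: (tsum_linear (omega_bilinear us us')). Qed.

Lemma omegaE (V V' : uq_module U) (u : V -> k) (u' : V' -> k) w w' :
  scalar u -> scalar u' -> omega u u' (w ⊗ w') = u w * u' w'.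
Proof. by move=> us us'; exact: (tsum_tens (omega_bilinear us us')). Qed.

Lemma r_omega (V V' : uq_module U) u u' (v : V) (v' : V') c c' :
  type_L V -> type_L V' -> scalar u -> scalar u' ->
  (forall f, ev c f = u (f • v)) -> (forall f, ev c' f = u' (f • v')) ->
  r c c' = omega u u' (uR_op Rm (v ⊗ v')).
Proof. by move=> tV tV' us us' cE cE'; exact: hr.2. Qed.

Lemma r_bilinear : bilinear_form r. Proof. exact: hr.1. Qed.
Lemma r_r a : linear (r a : A -> k^o). Proof. exact: r_bilinear.1. Qed.
Lemma r_l b : linear (r^~ b : A -> k^o). Proof. exact: r_bilinear.2. Qed.

Section Formula.
Variables (V V' : uq_module U) (u : V -> k) (u' : V' -> k) (v : V) (v' : V') (nu nu' : weight).
Variables c c' : A.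
Hypothesis tV : type_L V.
Hypothesis tV' : type_L V'.
Hypothesis us : scalar u.
Hypothesis us' : scalar u'.
Hypothesis cE : forall f, ev c f = u (f • v).
Hypothesis cE' : forall f, ev c' f = u' (f • v').
Hypothesis Ln : L nu.
Hypothesis Ln' : L nu'.
Hypothesis vw : weight_vector nu v.
Hypothesis vw' : weight_vector nu' v'.

(** On weight vectors D acts by a power of q, so only the components of
   Theta remain to be summed. *)
Lemma r_formula n : (forall ga p, p \in theta ga -> (n <= htq ga)%N ->
    p.1 • v = 0 \/ p.2 • v' = 0) ->
  r c c' = \sum_(ga <- gammas n) \sum_(p <- theta ga)
    chi (nu + qr ga) (nu' - qr ga) * (ev c p.1 * ev c' p.2).
Proof.
move=> van; rewrite (r_omega tV tV' us us' cE cE').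
have actE ga : tensor_act (uR_Theta Rm ga) (v ⊗ v') =
    \sum_(p <- theta ga) ((p.1 • v) ⊗ (p.2 • v')).
  by rewrite thetaE (lin_sum (tact_lin1 _)); apply: eq_bigr => p _; rewrite tactE.
rewrite (uR_opE (n := n)) => [|ga ng]; last first.
  rewrite actE big_seq big1 // => p pt; have [->|->] := van ga p pt ng.
    exact: (lin0 (tensl_linear _)).
  exact: (lin0 (tensr_linear _)).
have oDl : linear (fun t => omega u u' (uR_D Rm t)).
  exact: (comp_linear (omega_linear us us') (uR_D_lin Rm tV tV')).
rewrite (lin_sum oDl); apply: eq_bigr => ga _.
rewrite actE (lin_sum oDl) big_seq [RHS]big_seq; apply: eq_bigr => p /theta_weight[pw pw'].
have Lg := Lqroot ga; have Lg' := LN Lg.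
rewrite (uR_D_weight Rm tV tV' (LD Ln Lg) (LD Ln' Lg')).
- by rewrite (linZ (omega_linear us us')) omegaE // cE cE'.
- exact: wv_weight_part pw vw.
- exact: wv_weight_part pw' vw'.
Qed.

End Formula.

End RForm.

Section Hexagons.
Variables (k : fieldType) (G : semisimple_datum) (q : k).
Hypothesis q_neq0 : q != 0.
Hypothesis q_not_root : forall n : nat, (0 < n)%N -> q ^+ n != 1.
Variables (s : root_of_q G q) (U : quantum_env s) (A : quantum_coord U).
Local Notation N := (rk G).
Local Notation weight := 'rV[rat]_(rk G).
Local Notation L := (lattice (s := G)).
Local Notation pairing := (weight_form (cartan G) (symd (s := G))).
Local Notation alpha := (@simple_root (rk G)).
Local Notation d := (symd (s := G)).
Local Notation "f • v" := (um_act f v) (at level 40).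
Local Notation chi := (chi s).
Local Notation Fw := (Fw U).
Local Notation Ew := (Ew U).
Local Notation K := (Kf U).
Local Notation "a ·· b" := (hmul a b) (at level 40, left associativity).
Local Notation qr ga := (qroot_lattice ga : weight).
Local Notation ev := (@qc_ev k G q s U A).
Variables (M : nat) (rg : weight).
Hypothesis M_gt0 : (0 < M)%N.
Hypothesis Lrg : L rg.
Hypothesis rgE : forall i, pairing rg (alpha i) = (2 * M * d i)%:R.
Variables (Rm : universal_R U) (r : A -> A -> k).
Hypothesis hr : is_standard_rform Rm r.

Let hA := qc_is_hopf A.
Let hC := hopf_coalgebra hA.
Local Notation C1 := (conv_alg k^o hC).

Let evr c : linear (ev c : U -> k^o).
Proof. exact: ev_r. Qed.

Local Notation theta := (theta Rm).

Lemma lact_lin_f c : linear (fun f : U => lact f c : A).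
Proof. by move=> t f g; apply: ev_inj => h; rewrite ev_l !ev_lact mulrDr -scalerAr evr. Qed.

Lemma ract_lin_f c : linear (fun f : U => ract c f : A).
Proof. by move=> t f g; apply: ev_inj => h; rewrite ev_l !ev_ract mulrDl -scalerAl evr. Qed.

Lemma gammas1 : gammas G 1 = [:: [ffun=> 0%N]].
Proof.
have : size (gammas G 1) = 1%N by rewrite size_map -cardE card_ffun card_ord exp1n.
have : [ffun=> 0%N] \in gammas G 1.
  by apply: mem_gammas; rewrite /htq big1 // => i _; rewrite ffunE muln0.
by case: (gammas G 1) => [|ga []] //; rewrite inE => /eqP ->.
Qed.

(** Both sums are the sum over all weights. *)
Lemma gammas_shrink (X : zmodType) (F : {ffun 'I_N -> nat} -> X) m n : (m <= n)%N ->
  (forall ga, (m <= htq ga)%N -> F ga = 0) ->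
  \sum_(ga <- gammas G n) F ga = \sum_(ga <- gammas G m) F ga.
Proof.
move=> mn F0; rewrite -!fsum_gammas // => ga ng; apply: F0; exact: leq_trans ng.
Qed.

Lemma qroot0 : qr [ffun=> 0%N] = 0.
Proof. by apply/rowP => i; rewrite !mxE ffunE. Qed.

Lemma theta0_sum (c b : A) :
  \sum_(p <- theta [ffun=> 0%N]) (ev c p.1 * ev b p.2) = ev c 1 * ev b 1.
Proof.
have B : bilinear_map (fun f g : U => ev c f * ev b g : k^o).
  by split=> z; [apply: mulr_linr|apply: mulr_linl]; exact: evr.
have := congr1 (tensor_sum (fun f g : U => ev c f * ev b g : k^o)) (thetaE Rm [ffun=> 0%N]).
rewrite uR_Theta0 (tsum_tens B) => ->; rewrite (lin_sum (tsum_linear B)).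
by apply: eq_bigr => p _; rewrite (tsum_tens B).
Qed.

(** ** The l-functionals are values at elements of the algebra *)

(** With [rho_elt], the elements of the quantum group whose values are the
   two l-functionals of a coefficient at a vector of weight nu. *)
Definition lam_elt n (nu : weight) (a : A) : U :=
  \sum_(ga <- gammas G n) \sum_(p <- theta ga) ev a p.1 *: (K (nu + qr ga) * p.2).

Definition rho_elt n (nu : weight) (b : A) : U :=
  \sum_(ga <- gammas G n) \sum_(p <- theta ga) ev b p.2 *: (K (nu - qr ga) * p.1).

Lemma lam_explicit (V : uq_module U) la (v0 : V) (u : V -> k) I a n : type_L V ->
  is_highest la v0 -> scalar u -> (forall f, ev a f = u (f • (Fw I • v0))) ->
  (ht I < n)%N -> forall b, r a b = ev b (lam_elt n (la - wt I) a).
Proof.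
move=> tV hw us aE In b; have [Ll irr v00 v0E v0w] := hw.
pose nu := la - wt I.
have Lnu : L nu by exact: LB Ll (Lwt I).
move: b; apply: (coord_ind q_neq0 (P := [set b : A | r a b = ev b _])).
  split; first by rewrite /= (lin0 (ev_l _)) (lin0 (r_r hr a)).
  move=> t b b' /= bE b'E; rewrite ev_l -bE -b'E; exact: (r_r hr a).
move=> V' la' v0' u' I' b tV' [Ll' irr' v00' v0E' v0w'] us' bE /=.
have Lnu' : L (la' - wt I') by exact: LB Ll' (Lwt I').
rewrite (r_formula q_neq0 hr tV tV' us us' aE bE Lnu Lnu' (wv_Fv0 q_neq0 Ll v0w I) (wv_Fv0 q_neq0 Ll' v0w' I') (n := n)) //.
- rewrite (lin_sum (evr b)); apply: eq_bigr => ga _.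
  rewrite (lin_sum (evr b)) big_seq [RHS]big_seq; apply: eq_bigr => p /theta_weight[_ pw].
  rewrite (linZ (evr b)) !bE um_actM.
  have wp := wv_weight_part q_neq0 (LN (Lqroot ga)) Lnu' pw (wv_Fv0 q_neq0 Ll' v0w' I').
  rewrite (wvK wp (LD Lnu (Lqroot ga))) (linZ (us' : linear (u' : V' -> k^o))).
  by rewrite mulrCA.
- move=> ga p /theta_weight[pw _] ng; left.
  apply: (E_nilpotent_on q_neq0 q_not_root M_gt0 Lrg rgE Ll irr v00 v0E v0w pw).
  exact: leq_trans ng.
Qed.

Lemma rho_explicit (V' : uq_module U) la' (v0' : V') (u' : V' -> k) I' b n : type_L V' ->
  is_highest la' v0' -> scalar u' -> (forall f, ev b f = u' (f • (Fw I' • v0'))) ->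
  (forall I, (n <= ht I)%N -> Fw I • v0' = 0) ->
  forall a, r a b = ev a (rho_elt n (la' - wt I') b).
Proof.
move=> tV' hw' us' bE nF a; have [Ll' irr' v00' v0E' v0w'] := hw'.
pose nu' := la' - wt I'.
have Lnu' : L nu' by exact: LB Ll' (Lwt I').
move: a; apply: (coord_ind q_neq0 (P := [set a : A | r a b = ev a _])).
  split; first by rewrite /= (lin0 (ev_l _)) (lin0 (r_l hr b)).
  move=> t a a' /= aE a'E; rewrite ev_l -aE -a'E; exact: (r_l hr b).
move=> V la v0 u I a tV [Ll irr v00 v0E v0w] us aE /=.
have Lnu : L (la - wt I) by exact: LB Ll (Lwt I).
rewrite (r_formula q_neq0 hr tV tV' us us' aE bE Lnu Lnu' (wv_Fv0 q_neq0 Ll v0w I) (wv_Fv0 q_neq0 Ll' v0w' I') (n := n)) //.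
- rewrite (lin_sum (evr a)); apply: eq_bigr => ga _.
  rewrite (lin_sum (evr a)) big_seq [RHS]big_seq; apply: eq_bigr => p /theta_weight[pw _].
  rewrite (linZ (evr a)) !aE um_actM.
  have wp := wv_weight_part q_neq0 (Lqroot ga) Lnu pw (wv_Fv0 q_neq0 Ll v0w I).
  rewrite (wvK wp (LB Lnu' (Lqroot ga))) (linZ (us : linear (u : V -> k^o))).
  by rewrite chiC [_ *: _]mulrCA [_ * ev b _]mulrC.
- move=> ga p /theta_weight[_ pw] ng; right.
  apply: (F_nilpotent_on q_neq0 q_not_root M_gt0 Lrg rgE Ll' irr' v00' v0E' v0w' nF pw).
  by rewrite (leq_trans ng) // leq_addl.
Qed.

Lemma lam_kap (a : A) : exists f, forall b, r a b = ev b f.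
Proof.
move: a; apply: (coord_ind q_neq0 (P := [set a : A | exists f, forall b, r a b = ev b f])).
  split; first by exists 0 => b; rewrite (lin0 (evr b)) (lin0 (r_l hr b)).
  move=> t a a' [f fE] [g gE]; exists (t *: f + g) => b.
  by rewrite evr -fE -gE; exact: (r_l hr b).
move=> V la v0 u I a tV hw us aE.
by exists (lam_elt (ht I).+1 (la - wt I) a); exact: (lam_explicit tV hw us aE).
Qed.

Lemma rho_kap (b : A) : exists f, forall a, r a b = ev a f.
Proof.
move: b; apply: (coord_ind q_neq0 (P := [set b : A | exists f, forall a, r a b = ev a f])).
  split; first by exists 0 => a; rewrite (lin0 (evr a)) (lin0 (r_r hr a)).
  move=> t b b' [f fE] [g gE]; exists (t *: f + g) => a.
  by rewrite evr -fE -gE; exact: (r_r hr a).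
move=> V' la' v0' u' I' b tV' hw' us' bE.
have [n nF] := F_nilpotent q_neq0 q_not_root A M_gt0 Lrg rgE tV' hw'.
by exists (rho_elt n (la' - wt I') b); exact: (rho_explicit tV' hw' us' bE).
Qed.

(** At a highest weight vector the components of Theta of positive weight
   vanish, their first factors being raising operators. *)
Lemma r_highest (V : uq_module U) la (v0 : V) (u : V -> k) c b : type_L V ->
  is_highest la v0 -> scalar u -> (forall f, ev c f = u (f • v0)) ->
  r c b = ev c 1 * ev b (K la).
Proof.
move=> tV [Ll irr v00 v0E v0w] us cE; move: b.
apply: (coord_ind q_neq0 (P := [set b : A | r c b = ev c 1 * ev b (K la)])).
  split; first by rewrite /= (lin0 (ev_l _)) mulr0 (lin0 (r_r hr c)).
  move=> t b b' /= bE b'E; rewrite ev_l mulrDr -b'E.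
  have -> : ev c 1 * (t *: (ev b (K la) : k^o)) = t * (ev c 1 * ev b (K la)) by exact: mulrCA.
  by rewrite -bE; exact: (r_r hr c).
move=> V' la' v0' u' I' b tV' [Ll' irr' v00' v0E' v0w'] us' bE /=.
have Lnu' : L (la' - wt I') by exact: LB Ll' (Lwt I').
have cE' f : ev c f = u (f • (Fw [::] • v0)) by rewrite Fw_nil um_act1.
have Ln : L (la - wt [::]) by rewrite wt_nil subr0.
rewrite (r_formula q_neq0 hr tV tV' us us' cE' bE Ln Lnu' (wv_Fv0 q_neq0 Ll v0w [::]) (wv_Fv0 q_neq0 Ll' v0w' I') (n := 1)).
- rewrite gammas1 big_seq1 qroot0 addr0 subr0 wt_nil subr0 -mulr_sumr theta0_sum.
  rewrite !bE um_act1 (wvK (wv_Fv0 q_neq0 Ll' v0w' I') Ll).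
  by rewrite (linZ (us' : linear (u' : V' -> k^o))) mulrCA.
- move=> ga p /theta_weight[pw _] ng; left.
  by apply: (E_nilpotent_on q_neq0 q_not_root M_gt0 Lrg rgE Ll irr v00 v0E v0w pw); rewrite ht_nil.
Qed.

(** Against the dual functional the second factors of Theta, which are
   lowering operators, vanish. *)
Lemma r_dual (V : uq_module U) la (v0 v : V) a c : type_L V ->
  is_highest la v0 -> (forall f, ev c f = u0 v0 (f • v)) ->
  r a c = ev a (K la) * u0 v0 v.
Proof.
move=> tV hw; have [Ll irr v00 v0E v0w] := hw.
have us : scalar (u0 v0) by exact: (u0_scalar q_neq0 q_not_root M_gt0 Lrg rgE Ll irr v00 v0E v0w).
have ul : linear (u0 v0 : V -> k^o) by exact: us.
pose P := [set v : V | forall c, (forall f, ev c f = u0 v0 (f • v)) ->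
  r a c = ev a (K la) * u0 v0 v].
move: c; suff : P v by [].
apply: (lin_span_min (P := P) _ _ (hw_span q_neq0 Ll irr v00 v0E v0w v)).
  split.
    move=> c cE; rewrite (lin0 ul) mulr0.
    have -> : c = 0; last exact: (lin0 (r_r hr a)).
    by apply: ev_inj => f; rewrite cE um_act0r (lin0 ul) (lin0 (ev_l f)).
  move=> t x y Px Py c cE.
  have [cx cxE] := coef_ex A x tV us; have [cy cyE] := coef_ex A y tV us.
  have -> : c = t *: cx + cy.
    by apply: ev_inj => f; rewrite cE um_linr ul ev_l cxE cyE.
  rewrite ul mulrDr -(Py cy cyE).
  have -> : ev a (K la) * (t *: (u0 v0 x : k^o)) = t * (ev a (K la) * u0 v0 x) by exact: mulrCA.
  by rewrite -(Px cx cxE); exact: (r_r hr a).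
move=> _ [I _ ->] c cE; clear P; move: a.
apply: (coord_ind q_neq0 (P := [set a : A | r a c = ev a (K la) * u0 v0 (Fw I • v0)])).
  split; first by rewrite /= (lin0 (ev_l _)) mul0r (lin0 (r_l hr c)).
  move=> t b b' /= bE b'E; rewrite ev_l mulrDl -b'E -mulrA -bE.
  exact: (r_l hr c).
move=> V' la' v0' u' I' a tV' [Ll' irr' v00' v0E' v0w'] us' aE /=.
have Lnu' : L (la' - wt I') by exact: LB Ll' (Lwt I').
have Lnu : L (la - wt I) by exact: LB Ll (Lwt I).
rewrite (r_formula q_neq0 hr tV' tV us' us aE cE Lnu' Lnu (wv_Fv0 q_neq0 Ll' v0w' I') (wv_Fv0 q_neq0 Ll v0w I) (n := (ht I').+1)).
- rewrite (gammas_shrink (m := 1)) // => [|ga ng].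
    rewrite gammas1 big_seq1 qroot0 addr0 subr0 -mulr_sumr theta0_sum.
    rewrite !aE cE !um_act1 (wvK (wv_Fv0 q_neq0 Ll' v0w' I') Ll).
    rewrite (linZ (us' : linear (u' : V' -> k^o))).
    have [->|I0] := eqVneq I [::].
      by rewrite wt_nil subr0 mulrA chiC.
    by rewrite (u0_Fw q_neq0 q_not_root M_gt0 Lrg rgE Ll irr v00 v0E v0w I0) !mulr0.
  rewrite big_seq big1 // => p /theta_weight[_ pw].
  rewrite [ev c _]cE.
  have wp := wv_weight_part q_neq0 (LN (Lqroot ga)) Lnu pw (wv_Fv0 q_neq0 Ll v0w I).
  rewrite (u0_wv q_neq0 q_not_root M_gt0 Lrg rgE Ll irr v00 v0E v0w _ wp) ?mulr0 //.
    exact: LD Lnu (LN (Lqroot ga)).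
  rewrite pairingDr pairingBr pairingNr (rg_wt rgE) (rg_qroot rgE) -addrA -opprD -natrD -mulnDr.
  rewrite -subr_eq0 addrAC subrr add0r oppr_eq0 pnatr_eq0 !muln_eq0 (gtn_eqF M_gt0) /=.
  by rewrite addn_eq0 negb_and (gtn_eqF ng) orbT.
- move=> ga p /theta_weight[pw _] ng; left.
  exact: (E_nilpotent_on q_neq0 q_not_root M_gt0 Lrg rgE Ll' irr' v00' v0E' v0w' pw).
Qed.

End Hexagons.

Section Coquasitriangularity.
Variables (k : fieldType) (G : semisimple_datum) (q : k).
Hypothesis q_neq0 : q != 0.
Hypothesis q_not_root : forall n : nat, (0 < n)%N -> q ^+ n != 1.
Variables (s : root_of_q G q) (U : quantum_env s) (A : quantum_coord U).
Local Notation N := (rk G).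
Local Notation weight := 'rV[rat]_(rk G).
Local Notation L := (lattice (s := G)).
Local Notation pairing := (weight_form (cartan G) (symd (s := G))).
Local Notation alpha := (@simple_root (rk G)).
Local Notation d := (symd (s := G)).
Local Notation "f • v" := (um_act f v) (at level 40).
Local Notation chi := (chi s).
Local Notation Fw := (Fw U).
Local Notation Ew := (Ew U).
Local Notation K := (Kf U).
Local Notation "a ·· b" := (hmul a b) (at level 40, left associativity).
Local Notation qr ga := (qroot_lattice ga : weight).
Local Notation ev := (@qc_ev k G q s U A).
Variables (M : nat) (rg : weight).
Hypothesis M_gt0 : (0 < M)%N.
Hypothesis Lrg : L rg.
Hypothesis rgE : forall i, pairing rg (alpha i) = (2 * M * d i)%:R.
Variables (Rm : universal_R U) (r : A -> A -> k).
Hypothesis hr : is_standard_rform Rm r.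

Let hA := qc_is_hopf A.
Let hC := hopf_coalgebra hA.
Local Notation C1 := (conv_alg k^o hC).

Let evr c : linear (ev c : U -> k^o).
Proof. exact: ev_r. Qed.

Lemma tact_pure (V V' : uq_module U) (t : (U ⊗ U)%type) (v : V) (v' : V') :
  tensor_act t (v ⊗ v' : (V ⊗ V')%type) = \tsum_(f, g <- t) ((f • v) ⊗ (g • v')).
Proof. by apply: eq_tsum => f g; rewrite (tsum_tens (tact_inner_bilinear V V' f g)). Qed.

Lemma tact_pure_l (V V' : uq_module U) (f g : U) (x : (V ⊗ V')%type) :
  tensor_act (f ⊗ g : (U ⊗ U)%type) x = \tsum_(v, v' <- x) ((f • v) ⊗ (g • v')).
Proof. by rewrite /tensor_act (tsum_tens (tact_outer_bilinear x)). Qed.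

Lemma lact_form_bilinear (a b : A) :
  bilinear_map (fun f g : U => r (lact f a) (lact g b) : k^o).
Proof.
split=> f.
  exact: (comp_linear (r_r hr _) (lact_lin_f q_neq0 b)).
exact: (comp_linear (f := fun x => r x _ : k^o) (r_l hr _) (lact_lin_f q_neq0 a)).
Qed.

Lemma ract_form_bilinear (a b : A) :
  bilinear_map (fun f g : U => r (ract a g) (ract b f) : k^o).
Proof.
split=> f.
  exact: (comp_linear (f := fun x => r x _ : k^o) (r_l hr _) (ract_lin_f q_neq0 a)).
exact: (comp_linear (r_r hr _) (ract_lin_f q_neq0 b)).
Qed.

(** The intertwining property of R, read on matrix coefficients. *)
Lemma r_intertwine (a b : A) (f : U) :
  \tsum_(f1, f2 <- qe_comul f) (r (lact f1 a) (lact f2 b) : k^o) =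
  \tsum_(f1, f2 <- qe_comul f) (r (ract a f2) (ract b f1) : k^o).
Proof.
move: a; apply: (coord_ind q_neq0 (P := [set a : A | \tsum_(f1, f2 <- qe_comul f)
  (r (lact f1 a) (lact f2 b) : k^o) = \tsum_(f1, f2 <- qe_comul f)
  (r (ract a f2) (ract b f1) : k^o)])).
  have Ll : linear (fun a : A => \tsum_(f1, f2 <- qe_comul f) (r (lact f1 a) (lact f2 b) : k^o)).
    apply: tsum_param_linear => f1 f2.
    exact: (comp_linear (f := fun x => r x _ : k^o) (r_l hr _) (lact_linear f1)).
  have Lr : linear (fun a : A => \tsum_(f1, f2 <- qe_comul f) (r (ract a f2) (ract b f1) : k^o)).
    apply: tsum_param_linear => f1 f2.
    exact: (comp_linear (f := fun x => r x _ : k^o) (r_l hr _) (ract_linear f2)).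
  split; first by rewrite /= (lin0 Ll) (lin0 Lr).
  by move=> t x y /= Ex Ey; rewrite Ll Lr Ex Ey.
move=> V la v0 u I a tV hw us aE /=; move: b.
apply: (coord_ind q_neq0 (P := [set b : A | \tsum_(f1, f2 <- qe_comul f)
  (r (lact f1 a) (lact f2 b) : k^o) = \tsum_(f1, f2 <- qe_comul f)
  (r (ract a f2) (ract b f1) : k^o)])).
  have Ll : linear (fun b : A => \tsum_(f1, f2 <- qe_comul f) (r (lact f1 a) (lact f2 b) : k^o)).
    apply: tsum_param_linear => f1 f2.
    exact: (comp_linear (r_r hr _) (lact_linear f2)).
  have Lr : linear (fun b : A => \tsum_(f1, f2 <- qe_comul f) (r (ract a f2) (ract b f1) : k^o)).
    apply: tsum_param_linear => f1 f2.
    exact: (comp_linear (r_r hr _) (ract_linear f1)).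
  split; first by rewrite /= (lin0 Ll) (lin0 Lr).
  by move=> t x y /= Ex Ey; rewrite Ll Lr Ex Ey.
move=> V' la' v0' u' I' b tV' hw' us' bE /=.
set v := Fw I • v0 in aE; set v' := Fw I' • v0' in bE.
have ol := omega_linear us us'.
have Rl := uR_op_linear q_neq0 q_not_root M_gt0 Lrg rgE Rm tV tV'.
transitivity (omega u u' (uR_op Rm (tensor_act (qe_comul f) (v ⊗ v')))).
  rewrite tact_pure (lin_tsum _ _ Rl) (lin_tsum _ _ ol); apply: eq_tsum => f1 f2.
  by apply: (r_omega hr tV tV' us us') => g; rewrite ev_lact ?aE ?bE um_actM.
rewrite (uR_intertwine Rm tV tV'); set y := uR_op Rm _.
rewrite (lin_tsum _ _ (tact_lin1 y)) (lin_tsum _ _ ol); apply: eq_tsum => f1 f2.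
have us2 : scalar (fun w : V => u (f2 • w)).
  exact: (comp_linear (us : linear (u : V -> k^o)) (um_linr f2)).
have us1 : scalar (fun w : V' => u' (f1 • w)).
  exact: (comp_linear (us' : linear (u' : V' -> k^o)) (um_linr f1)).
rewrite (r_omega hr tV tV' us2 us1 (v := v) (v' := v')) => [|g|g]; last 2 first.
- by rewrite ev_ract aE um_actM.
- by rewrite ev_ract bE um_actM.
rewrite tact_pure_l (lin_tsum _ _ ol) -/y; apply: eq_tsum => w w'.
by rewrite omegaE.
Qed.

Lemma tsum_lact (X : lmodType k) (F : A -> X) f (a : A) : linear F ->
  \tsum_(a1, a2 <- hcomul a) (ev a2 f *: F a1) = F (lact f a).
Proof.
move=> Fl; rewrite /lact (lin_tsum _ _ Fl); apply: eq_tsum => a1 a2.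
by rewrite (linZ Fl).
Qed.

Lemma tsum_ract (X : lmodType k) (F : A -> X) f (a : A) : linear F ->
  \tsum_(a1, a2 <- hcomul a) (ev a1 f *: F a2) = F (ract a f).
Proof.
move=> Fl; rewrite /ract (lin_tsum _ _ Fl); apply: eq_tsum => a1 a2.
by rewrite (linZ Fl).
Qed.

(** Both sides take the value of [r_intertwine] at every element of the
   quantum group. *)
Lemma r_comm (a b : A) :
  \tsum_(a1, a2 <- hcomul a) \tsum_(b1, b2 <- hcomul b) (r a1 b1 *: (a2 ·· b2)) =
  \tsum_(a1, a2 <- hcomul a) \tsum_(b1, b2 <- hcomul b) (r a2 b2 *: (b1 ·· a1)).
Proof.
apply: ev_inj => f; rewrite !(lin_tsum _ _ (ev_l f)).
transitivity (\tsum_(f1, f2 <- qe_comul f) (r (lact f1 a) (lact f2 b) : k^o)).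
  transitivity (\tsum_(f1, f2 <- qe_comul f) \tsum_(a1, a2 <- hcomul a)
     \tsum_(b1, b2 <- hcomul b) (r a1 b1 * (ev a2 f1 * ev b2 f2) : k^o)).
    rewrite [RHS]tsum_exchange; apply: eq_tsum => a1 a2.
    rewrite (lin_tsum _ _ (ev_l f)) [RHS]tsum_exchange; apply: eq_tsum => b1 b2.
    by rewrite (linZ (ev_l f)) evM [LHS]mulr_tsumr.
  apply: eq_tsum => f1 f2.
  rewrite -(tsum_lact f1 a (F := fun x => r x (lact f2 b) : k^o)); last exact: (r_l hr).
  apply: eq_tsum => a1 a2; rewrite -(tsum_lact f2 b (r_r hr a1)) [RHS]mulr_tsumr.
  apply: eq_tsum => b1 b2; rewrite [RHS]mulrA mulrC; congr (_ * _).
rewrite r_intertwine.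
transitivity (\tsum_(f1, f2 <- qe_comul f) \tsum_(a1, a2 <- hcomul a)
   \tsum_(b1, b2 <- hcomul b) (r a2 b2 * (ev b1 f1 * ev a1 f2) : k^o)); last first.
  rewrite [LHS]tsum_exchange; apply: eq_tsum => a1 a2.
  rewrite (lin_tsum _ _ (ev_l f)) [LHS]tsum_exchange; apply: eq_tsum => b1 b2.
  by rewrite (linZ (ev_l f)) evM [RHS]mulr_tsumr.
apply: eq_tsum => f1 f2.
rewrite -(tsum_ract f2 a (F := fun x => r x (ract b f1) : k^o)); last exact: (r_l hr).
apply: eq_tsum => a1 a2; rewrite -(tsum_ract f1 b (r_r hr a2)) [LHS]mulr_tsumr.
apply: eq_tsum => b1 b2; rewrite [RHS]mulrC [_ * ev a1 f2]mulrC.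
exact: mulrA.
Qed.

(** ** The hexagon identities *)

Local Notation kap := (@kap k G q s U A).
Definition rlam (a : A) : C1 := cv_of hC (r_r hr a).
Definition rrho (b : A) : C1 := cv_of hC (r_l hr b).

Lemma rlam_linear : linear rlam.
Proof. by move=> t x y; apply: cvP => z; exact: (r_l hr). Qed.
Lemma rrho_linear : linear rrho.
Proof. by move=> t x y; apply: cvP => z; exact: (r_r hr). Qed.

Lemma lactM f (b c : A) : lact f (b ·· c) =
  \tsum_(f1, f2 <- qe_comul f) (lact f1 b ·· lact f2 c).
Proof.
apply: ev_inj => g; rewrite (lin_tsum _ _ (ev_l g)) ev_lact evM.
have B : bilinear_map (fun x y : U => ev b x * ev c y : k^o).
  by split=> z; [apply: mulr_linr|apply: mulr_linl]; exact: evr.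
have e : qe_comul (g * f) = \tsum_(g1, g2 <- qe_comul g) \tsum_(f1, f2 <- qe_comul f)
    ((g1 * f1) ⊗ (g2 * f2)) := hcomulM (env_hopf U) g f.
rewrite e (lin_tsum _ _ (tsum_linear B)).
rewrite -[RHS](eq_tsum _ (f := fun f1 f2 => \tsum_(g1, g2 <- qe_comul g)
  (ev b (g1 * f1) * ev c (g2 * f2) : k^o))); last first.
  by move=> f1 f2; rewrite evM; apply: eq_tsum => g1 g2; rewrite !ev_lact.
rewrite [RHS]tsum_exchange; apply: eq_tsum => g1 g2.
rewrite (lin_tsum _ _ (tsum_linear B)); apply: eq_tsum => f1 f2.
by rewrite (tsum_tens B).
Qed.

Lemma ractM f (b c : A) : ract (b ·· c) f =
  \tsum_(f1, f2 <- qe_comul f) (ract b f1 ·· ract c f2).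
Proof.
apply: ev_inj => g; rewrite (lin_tsum _ _ (ev_l g)) ev_ract evM.
have B : bilinear_map (fun x y : U => ev b x * ev c y : k^o).
  by split=> z; [apply: mulr_linr|apply: mulr_linl]; exact: evr.
have e : qe_comul (f * g) = \tsum_(f1, f2 <- qe_comul f) \tsum_(g1, g2 <- qe_comul g)
    ((f1 * g1) ⊗ (f2 * g2)) := hcomulM (env_hopf U) f g.
rewrite e (lin_tsum _ _ (tsum_linear B)); apply: eq_tsum => f1 f2.
rewrite (lin_tsum _ _ (tsum_linear B)) evM; apply: eq_tsum => g1 g2.
by rewrite (tsum_tens B) !ev_ract.
Qed.

Section Comul.
Variables (X : lmodType k) (F : U -> U -> X).
Hypothesis Fb : bilinear_map F.

Lemma tsum_comulK mu : L mu -> tensor_sum F (qe_comul (K mu)) = F (K mu) (K mu).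
Proof. by move=> Lmu; rewrite qe_comulK // (tsum_tens Fb). Qed.

Lemma tsum_comulE i : tensor_sum F (qe_comul (Ef U i)) =
  F (Ef U i) (K (alpha i)) + F 1 (Ef U i).
Proof. by rewrite qe_comulE (linD (tsum_linear Fb)) !(tsum_tens Fb). Qed.

Lemma tsum_comulF i : tensor_sum F (qe_comul (Ff U i)) =
  F (Ff U i) 1 + F (K (- alpha i)) (Ff U i).
Proof. by rewrite qe_comulF (linD (tsum_linear Fb)) !(tsum_tens Fb). Qed.

End Comul.

Lemma lact1 (a : A) : lact 1 a = a.
Proof. by apply: ev_inj => g; rewrite ev_lact mulr1. Qed.
Lemma ract1 (a : A) : ract a 1 = a.
Proof. by apply: ev_inj => g; rewrite ev_ract mul1r. Qed.

Fact lact_mul_bilinear (b c : A) : bilinear_map (fun f g : U => lact f b ·· lact g c).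
Proof.
split=> f; first exact: (comp_linear (hmul_linr hA _) (lact_lin_f q_neq0 c)).
exact: (comp_linear (f := fun x => x ·· _) (hmul_linl hA _) (lact_lin_f q_neq0 b)).
Qed.

Fact ract_mul_bilinear (b c : A) : bilinear_map (fun f g : U => ract b f ·· ract c g).
Proof.
split=> f; first exact: (comp_linear (hmul_linr hA _) (ract_lin_f q_neq0 c)).
exact: (comp_linear (f := fun x => x ·· _) (hmul_linl hA _) (ract_lin_f q_neq0 b)).
Qed.

Lemma rho_F b i : rrho b * kap (Ff U i) + rrho (lact (Ff U i) b) * kap (K (- alpha i)) =
  rrho (ract b (Ff U i)) + kap (Ff U i) * rrho (ract b (K (- alpha i))).
Proof.
apply: cvP => a; rewrite !cvD !mul_kap kap_mul.
have := r_intertwine a b (Ff U i).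
by rewrite (tsum_comulF (lact_form_bilinear a b)) (tsum_comulF (ract_form_bilinear a b)) lact1 ract1.
Qed.

Lemma rho_K b mu : L mu -> rrho (lact (K mu) b) * kap (K mu) = kap (K mu) * rrho (ract b (K mu)).
Proof.
move=> Lmu; apply: cvP => a; rewrite mul_kap kap_mul.
have := r_intertwine a b (K mu).
by rewrite (tsum_comulK (lact_form_bilinear a b)) // (tsum_comulK (ract_form_bilinear a b)).
Qed.

Lemma lam_E a i : rlam (lact (Ef U i) a) * kap (K (alpha i)) + rlam a * kap (Ef U i) =
  kap (Ef U i) * rlam (ract a (K (alpha i))) + rlam (ract a (Ef U i)).
Proof.
apply: cvP => b; rewrite !cvD !mul_kap kap_mul.
have := r_intertwine a b (Ef U i).
by rewrite (tsum_comulE (lact_form_bilinear a b)) (tsum_comulE (ract_form_bilinear a b)) lact1 ract1.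
Qed.

Lemma lam_K a mu : L mu -> rlam (lact (K mu) a) * kap (K mu) = kap (K mu) * rlam (ract a (K mu)).
Proof.
move=> Lmu; apply: cvP => b; rewrite mul_kap kap_mul.
have := r_intertwine a b (K mu).
by rewrite (tsum_comulK (lact_form_bilinear a b)) // (tsum_comulK (ract_form_bilinear a b)).
Qed.

Lemma sub5 (X : zmodType) (x1 x2 x3 x4 x5 y1 y2 y3 y4 y5 : X) :
  (x1 + x2 + x3 - x4 - x5) - (y1 + y2 + y3 - y4 - y5) =
  (x1 - y1) + (x2 - y2) + (x3 - y3) - (x4 - y4) - (x5 - y5).
Proof.
have subDD (a b c e : X) : (a + b) - (c + e) = (a - c) + (b - e) by rewrite opprD addrACA.
by rewrite 4![in LHS]subDD !opprD.
Qed.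

(** The defects of the two hexagon identities. Each is shown to intertwine
   translations by generators ([hex1_F], [hex2_E]), so that it vanishes
   everywhere once it vanishes at highest weight vectors, or at their duals. *)
Definition hex1 (b c : A) : C1 := rrho (b ·· c) - rrho c * rrho b.
Definition hex2 (a b : A) : C1 := rlam (a ·· b) - rlam a * rlam b.

(** Compatibility of the l-functional with a lowering operator holds for b,
   for c and for their product; the difference of the three relations has
   only defects in it. *)
Lemma hex1_F b c i (Ki := K (- alpha i)) (Fi := Ff U i) :
  hex1 b c * kap Fi = hex1 (ract b Fi) c + hex1 (ract b Ki) (ract c Fi) +
    kap Fi * hex1 (ract b Ki) (ract c Ki) - hex1 (lact Fi b) c * kap Ki -
    hex1 (lact Ki b) (lact Fi c) * kap Ki.
Proof.
have Li := LN (La i).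
have RF x : rrho x * kap Fi = rrho (ract x Fi) + kap Fi * rrho (ract x Ki) -
    rrho (lact Fi x) * kap Ki by rewrite -rho_F addrK.
have RK x : kap Ki * rrho (ract x Ki) = rrho (lact Ki x) * kap Ki by rewrite rho_K.
have lF : lact Fi (b ·· c) = lact Fi b ·· c + lact Ki b ·· lact Fi c.
  by rewrite lactM (tsum_comulF (lact_mul_bilinear b c)) lact1.
have rF : ract (b ·· c) Fi = ract b Fi ·· c + ract b Ki ·· ract c Fi.
  by rewrite ractM (tsum_comulF (ract_mul_bilinear b c)) ract1.
have rK : ract (b ·· c) Ki = ract b Ki ·· ract c Ki.
  by rewrite ractM (tsum_comulK (ract_mul_bilinear b c)).
have E2 : rrho c * rrho b * kap Fi = rrho c * rrho (ract b Fi) +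
    rrho (ract c Fi) * rrho (ract b Ki) + kap Fi * (rrho (ract c Ki) * rrho (ract b Ki)) -
    rrho (lact Fi c) * rrho (lact Ki b) * kap Ki - rrho c * rrho (lact Fi b) * kap Ki.
  have mid : rrho c * (kap Fi * rrho (ract b Ki)) = rrho (ract c Fi) * rrho (ract b Ki) +
      kap Fi * (rrho (ract c Ki) * rrho (ract b Ki)) -
      rrho (lact Fi c) * rrho (lact Ki b) * kap Ki.
    by rewrite mulrA RF mulrBl mulrDl -(mulrA (rrho (lact Fi c)) (kap Ki)) RK !mulrA.
  by rewrite -mulrA RF mulrBr mulrDr mid !mulrA !addrA.
have E1 : rrho (b ·· c) * kap Fi = rrho (ract b Fi ·· c) + rrho (ract b Ki ·· ract c Fi) +
    kap Fi * rrho (ract b Ki ·· ract c Ki) - rrho (lact Ki b ·· lact Fi c) * kap Ki -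
    rrho (lact Fi b ·· c) * kap Ki.
  by rewrite RF rF rK lF !(linD rrho_linear) mulrDl opprD !addrA addrAC.
by rewrite /hex1 mulrBl E1 E2 sub5 !mulrBl !mulrBr addrAC.
Qed.

Lemma hex2_E a b i (Ki := K (alpha i)) (Ei := Ef U i) :
  kap Ei * hex2 (ract a Ki) (ract b Ki) =
    hex2 (lact Ei a) (lact Ki b) * kap Ki + hex2 a (lact Ei b) * kap Ki +
    hex2 a b * kap Ei - hex2 a (ract b Ei) - hex2 (ract a Ei) (ract b Ki).
Proof.
have Li := La i.
have LE x : kap Ei * rlam (ract x Ki) = rlam (lact Ei x) * kap Ki + rlam x * kap Ei -
    rlam (ract x Ei) by rewrite lam_E addrK.
have LK x : kap Ki * rlam (ract x Ki) = rlam (lact Ki x) * kap Ki by rewrite lam_K.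
have lE : lact Ei (a ·· b) = lact Ei a ·· lact Ki b + a ·· lact Ei b.
  by rewrite lactM (tsum_comulE (lact_mul_bilinear a b)) lact1.
have rE : ract (a ·· b) Ei = ract a Ei ·· ract b Ki + a ·· ract b Ei.
  by rewrite ractM (tsum_comulE (ract_mul_bilinear a b)) ract1.
have rK : ract (a ·· b) Ki = ract a Ki ·· ract b Ki.
  by rewrite ractM (tsum_comulK (ract_mul_bilinear a b)).
have E2 : kap Ei * (rlam (ract a Ki) * rlam (ract b Ki)) =
    rlam (lact Ei a) * rlam (lact Ki b) * kap Ki + rlam a * rlam (lact Ei b) * kap Ki +
    rlam a * rlam b * kap Ei - rlam a * rlam (ract b Ei) - rlam (ract a Ei) * rlam (ract b Ki).
  have mid : rlam a * kap Ei * rlam (ract b Ki) = rlam a * rlam (lact Ei b) * kap Ki +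
      rlam a * rlam b * kap Ei - rlam a * rlam (ract b Ei).
    by rewrite -mulrA LE mulrBr mulrDr !mulrA.
  by rewrite mulrA LE mulrBl mulrDl mid -(mulrA (rlam (lact Ei a)) (kap Ki)) LK !mulrA !addrA.
have E1 : kap Ei * rlam (ract a Ki ·· ract b Ki) =
    rlam (lact Ei a ·· lact Ki b) * kap Ki + rlam (a ·· lact Ei b) * kap Ki +
    rlam (a ·· b) * kap Ei - rlam (a ·· ract b Ei) - rlam (ract a Ei ·· ract b Ki).
  by rewrite -rK LE lE rE !(linD rlam_linear) mulrDl opprD !addrA addrAC.
by rewrite /hex2 mulrBr E1 E2 sub5 !mulrBl.
Qed.

Lemma evcM_K (b c : A) mu : L mu -> ev (b ·· c) (K mu) = ev b (K mu) * ev c (K mu).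
Proof.
move=> Lmu; rewrite evM (tsum_comulK (X := k^o) (F := fun f g => ev b f * ev c g : k^o)) //.
by split=> z; [apply: mulr_linr|apply: mulr_linl]; exact: evr.
Qed.

(** The defect vanishes at highest weight vectors, where the form is
   diagonal, and [hex1_F] propagates this along the lowering words that
   generate the coordinate algebra. *)
Lemma rrhoM b c : rrho (b ·· c) = rrho c * rrho b.
Proof.
apply/eqP; rewrite -subr_eq0 -/(hex1 b c); apply/eqP; apply: cvP => a; rewrite cv0.
move: a; apply: (coord_ind q_neq0 (P := [set a : A | hex1 b c a = 0])).
  split; first exact: (lin0 (cv_linear _)).
  move=> t x y /= Ex Ey; have /= -> := cv_linear (hex1 b c) t x y.
  by rewrite Ex Ey scaler0 addr0.
move=> V la v0 u I a tV hw us aE; change (hex1 b c a = 0); have [Ll irr v00 v0E v0w] := hw.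
have ul : linear (u : V -> k^o) by exact: us.
elim: I u us ul a aE b c => [|i I IH] u us ul a aE b c.
  rewrite Fw_nil in aE; have aE' f : ev a f = u (f • v0) by rewrite aE um_act1.
  rewrite /hex1 cvD cvN cvM.
  have rE x : rrho x a = ev a 1 * ev x (K la).
    exact: (r_highest q_neq0 q_not_root M_gt0 Lrg rgE hr _ tV hw us aE').
  have [y yE] := rho_kap q_neq0 q_not_root M_gt0 Lrg rgE hr c.
  have -> : \tsum_(a1, a2 <- hcomul a) (rrho c a1 * rrho b a2) = (kap y * rrho b) a.
    by rewrite cvM; apply: eq_tsum => a1 a2; congr (_ * _); exact: yE.
  rewrite kap_mul rE evcM_K //.
  have us' : scalar (fun v => u (y • v)) by exact: (comp_linear ul (um_linr y)).
  have raE f : ev (ract a y) f = u (y • (f • v0)) by rewrite ev_ract aE' um_actM.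
  have -> : rrho b (ract a y) = ev (ract a y) 1 * ev b (K la).
    exact: (r_highest (u := fun v => u (y • v)) q_neq0 q_not_root M_gt0 Lrg rgE hr _ tV hw us' raE).
  rewrite ev_ract mulr1 -yE -[r a c]/(rrho c a) rE -mulrA [ev c _ * _]mulrC subrr.
  by [].
have [c0 c0E] := coef_ex A (Fw I • v0) tV us.
have -> : a = lact (Ff U i) c0.
  by apply: ev_inj => f; rewrite ev_lact aE c0E um_actM Fw_cons um_actM.
have IH0 b' c' : hex1 b' c' c0 = 0 by exact: IH us ul _ c0E b' c'.
have IHK b' c' : (hex1 b' c' * kap (K (- alpha i))) c0 = 0.
  rewrite mul_kap.
  have -> : lact (K (- alpha i)) c0 = chi (- alpha i) (la - wt I) *: c0.
    apply: ev_inj => f; rewrite ev_lact (linZ (ev_l f)) !c0E um_actM.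
    by rewrite (wvK (wv_Fv0 q_neq0 Ll v0w I) (LN (La i))) (linZ (um_linr f)) (linZ ul).
  transitivity (chi (- alpha i) (la - wt I) *: (hex1 b' c' c0 : k^o)).
    exact: (linZ (cv_linear (hex1 b' c'))).
  by rewrite IH0 scaler0.
have IHF b' c' : (kap (Ff U i) * hex1 b' c') c0 = 0.
  rewrite kap_mul.
  have us' : scalar (fun v => u (Ff U i • v)) by exact: (comp_linear ul (um_linr _)).
  by apply: (IH _ us' us') => f; rewrite ev_ract c0E um_actM.
by rewrite -mul_kap hex1_F 4!cvD 2!cvN !IH0 !IHK IHF !subr0 !addr0.
Qed.

(** The defect is a value at an element of the quantum group, which is shown
   to kill every vector: against the dual of the highest weight vector the
   form is diagonal, and [hex2_E] propagates this along raising words, which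
   separate vectors by [u0_E_separate]. *)
Lemma rlamM a b : rlam (a ·· b) = rlam a * rlam b.
Proof.
apply/eqP; rewrite -subr_eq0 -/(hex2 a b); apply/eqP; apply: cvP => c; rewrite cv0.
have [y yE] : exists y, forall c, hex2 a b c = ev c y.
  have [x xE] := lam_kap q_neq0 q_not_root M_gt0 Lrg rgE hr a; have [x' xE'] := lam_kap q_neq0 q_not_root M_gt0 Lrg rgE hr b; have [z zE] := lam_kap q_neq0 q_not_root M_gt0 Lrg rgE hr (a ·· b).
  exists (z - x * x') => c'; rewrite (linB (evr c')) -zE /hex2 cvD cvN cvM -ev_comul.
  by congr (_ - _); apply: eq_tsum => c1 c2; congr (_ * _); [exact: xE|exact: xE'].
move: c; apply: (coord_ind q_neq0 (P := [set c : A | hex2 a b c = 0])).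
  split; first exact: (lin0 (cv_linear _)).
  move=> t x z /= Ex Ez; have /= -> := cv_linear (hex2 a b) t x z.
  by rewrite Ex Ez scaler0 addr0.
move=> V la v0 u I c tV hw us cE; change (hex2 a b c = 0); have [Ll irr v00 v0E v0w] := hw.
have u0s : scalar (u0 v0) by exact: (u0_scalar q_neq0 q_not_root M_gt0 Lrg rgE Ll irr v00 v0E v0w).
have u0l : linear (u0 v0 : V -> k^o) by exact: u0s.
rewrite yE cE.
have -> : y • (Fw I • v0) = 0; last exact: (lin0 (us : linear (u : V -> k^o))).
set v := Fw I • v0.
apply: (u0_E_separate q_neq0 q_not_root M_gt0 Lrg rgE Ll irr v00 v0E v0w) => J.
pose uJ := (fun w : V => u0 v0 (Ew J • w)).
have uJs : scalar uJ by exact: (comp_linear u0l (um_linr _)).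
have [e eE] := coef_ex A v tV uJs.
rewrite -[LHS]eE -yE.
move: (a) (b) (e) eE; rewrite /uJ {uJ uJs e}; elim/last_ind: J (v) => [|J i IH] w a' b' e eE.
  have {}eE f : ev e f = u0 v0 (f • w) by rewrite eE Ew_nil um_act1.
  have rE x : rlam x e = ev x (K la) * u0 v0 w by exact: (r_dual q_neq0 q_not_root M_gt0 Lrg rgE hr _ tV hw eE).
  have [x xE] := lam_kap q_neq0 q_not_root M_gt0 Lrg rgE hr b'.
  rewrite /hex2 cvD cvN cvM.
  have -> : \tsum_(e1, e2 <- hcomul e) (rlam a' e1 * rlam b' e2) = (rlam a' * kap x) e.
    by rewrite cvM; apply: eq_tsum => e1 e2; congr (_ * _); exact: xE.
  rewrite mul_kap rE evcM_K //.
  have leE f : ev (lact x e) f = u0 v0 (f • (x • w)) by rewrite ev_lact eE um_actM.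
  have -> : rlam a' (lact x e) = ev a' (K la) * u0 v0 (x • w) by exact: (r_dual q_neq0 q_not_root M_gt0 Lrg rgE hr _ tV hw leE).
  by rewrite -eE -xE -[r b' e]/(rlam b' e) rE mulrA subrr.
pose Ki := K (alpha i); pose Kn := K (- alpha i).
have KnK : Kn * Ki = 1 by exact: KNK (La i).
have aK (x : A) : x = ract (ract x Kn) Ki.
  by apply: ev_inj => f; rewrite !ev_ract mulrA KnK mul1r.
have uJs : scalar (fun w : V => u0 v0 (Ew J • w)) by exact: (comp_linear u0l (um_linr _)).
have [e0 e0E] := coef_ex A w tV uJs.
have -> : e = ract e0 (Ef U i).
  by apply: ev_inj => f; rewrite ev_ract eE e0E Ew_rcons !um_actM.
have IHl x a1 b1 : hex2 a1 b1 (lact x e0) = 0.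
  by apply: (IH (x • w)) => f; rewrite ev_lact e0E um_actM.
rewrite -kap_mul (aK a') (aK b') hex2_E 4!cvD 2!cvN !mul_kap.
by rewrite !IHl !(IH w _ _ e0 e0E) !subr0 !addr0.
Qed.

End Coquasitriangularity.

Section StandardForm.
Variables (k : fieldType) (G : semisimple_datum) (q : k).
Hypothesis q_neq0 : q != 0.
Hypothesis q_not_root : forall n : nat, (0 < n)%N -> q ^+ n != 1.
Variables (s : root_of_q G q) (U : quantum_env s) (A : quantum_coord U).
Local Notation N := (rk G).
Local Notation weight := 'rV[rat]_(rk G).
Local Notation L := (lattice (s := G)).
Local Notation pairing := (weight_form (cartan G) (symd (s := G))).
Local Notation alpha := (@simple_root (rk G)).
Local Notation d := (symd (s := G)).
Local Notation "f • v" := (um_act f v) (at level 40).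
Local Notation chi := (chi s).
Local Notation Fw := (Fw U).
Local Notation Ew := (Ew U).
Local Notation K := (Kf U).
Local Notation "a ·· b" := (hmul a b) (at level 40, left associativity).
Local Notation qr ga := (qroot_lattice ga : weight).
Local Notation ev := (@qc_ev k G q s U A).
Variables (M : nat) (rg : weight).
Hypothesis M_gt0 : (0 < M)%N.
Hypothesis Lrg : L rg.
Hypothesis rgE : forall i, pairing rg (alpha i) = (2 * M * d i)%:R.
Variables (Rm : universal_R U) (r : A -> A -> k).
Hypothesis hr : is_standard_rform Rm r.

Let hA := qc_is_hopf A.
Let hC := hopf_coalgebra hA.
Local Notation C1 := (conv_alg k^o hC).

Let evr c : linear (ev c : U -> k^o).
Proof. exact: ev_r. Qed.

Local Notation kap := (@kap k G q s U A).
Local Notation rlam := (rlam hr).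
Local Notation rrho := (rrho hr).
Local Notation lamE := (lam_E q_neq0 q_not_root M_gt0 Lrg rgE hr).

Lemma lact_one f : lact f (hone A) = qe_counit f *: hone A.
Proof.
apply: ev_inj => g; rewrite ev_lact (linZ (ev_l g)) !qc_ev1 env_counitM.
by rewrite mulrC.
Qed.

Lemma ract_one f : ract (hone A) f = qe_counit f *: hone A.
Proof.
by apply: ev_inj => g; rewrite ev_ract (linZ (ev_l g)) !qc_ev1 env_counitM.
Qed.

Lemma rrho_one : rrho (hone A) = 1.
Proof.
apply/eqP; rewrite -subr_eq0; apply/eqP; set psi := _ - _.
have psiF i : psi * kap (Ff U i) = kap (Ff U i) * psi.
  rewrite /psi mulrBl mulrBr mul1r mulr1; congr (_ - _).
  have := rho_F q_neq0 q_not_root M_gt0 Lrg rgE hr (hone A) i.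
  rewrite lact_one !ract_one qe_counitF qe_counitK; last exact/LN/La.
  by rewrite !scale0r scale1r !(lin0 (rrho_linear hr)) mul0r addr0 add0r.
apply: cvP => a; rewrite cv0; move: a; apply: (coord_ind q_neq0 (P := [set a : A | psi a = 0])).
  split; first exact: (lin0 (cv_linear _)).
  move=> t x y /= Ex Ey; have /= -> := cv_linear psi t x y.
  by rewrite Ex Ey scaler0 addr0.
move=> V la v0 u I a tV hw us aE; change (psi a = 0); have [Ll irr v00 v0E v0w] := hw.
have ul : linear (u : V -> k^o) by exact: us.
elim: I u us ul a aE => [|i I IH] u us ul a aE.
  rewrite Fw_nil in aE; have aE' f : ev a f = u (f • v0) by rewrite aE um_act1.
  rewrite /psi cvD cvN cv1 [_ *: _]mulr1 qc_ev_counit.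
  rewrite -[rrho _ a]/(r a (hone A)).
  rewrite (r_highest q_neq0 q_not_root M_gt0 Lrg rgE hr (hone A) tV hw us aE') qc_ev1 qe_counitK //.
  by rewrite mulr1 subrr.
have [c0 c0E] := coef_ex A (Fw I • v0) tV us.
have -> : a = lact (Ff U i) c0.
  by apply: ev_inj => f; rewrite ev_lact aE c0E um_actM Fw_cons um_actM.
rewrite -mul_kap psiF kap_mul.
have us' : scalar (fun v => u (Ff U i • v)) by exact: (comp_linear ul (um_linr _)).
by apply: (IH _ us' us') => f; rewrite ev_ract c0E um_actM.
Qed.

(** The functional r (1, -) - 1 commutes with the raising operators, and the
   argument of [rlamM] applies. *)
Lemma rlam_one : rlam (hone A) = 1.
Proof.
apply/eqP; rewrite -subr_eq0; apply/eqP; set psi := _ - _.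
have psiE i : psi * kap (Ef U i) = kap (Ef U i) * psi.
  rewrite /psi mulrBl mulrBr mul1r mulr1; congr (_ - _).
  have := lam_E q_neq0 q_not_root M_gt0 Lrg rgE hr (hone A) i.
  rewrite lact_one !ract_one qe_counitE qe_counitK; last exact: La.
  by rewrite !scale0r scale1r !(lin0 (rlam_linear hr)) mul0r addr0 add0r.
have [y yE] : exists y, forall c, psi c = ev c y.
  have [x xE] := lam_kap q_neq0 q_not_root M_gt0 Lrg rgE hr (hone A).
  exists (x - 1) => c'; rewrite (linB (evr c')) -xE /psi cvD cvN cv1 [_ *: _]mulr1.
  by rewrite qc_ev_counit.
apply: cvP => c; rewrite cv0; move: c; apply: (coord_ind q_neq0 (P := [set c : A | psi c = 0])).
  split; first exact: (lin0 (cv_linear _)).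
  move=> t x z /= Ex Ez; have /= -> := cv_linear psi t x z.
  by rewrite Ex Ez scaler0 addr0.
move=> V la v0 u I c tV hw us cE; change (psi c = 0); have [Ll irr v00 v0E v0w] := hw.
have u0s : scalar (u0 v0) by exact: (u0_scalar q_neq0 q_not_root M_gt0 Lrg rgE Ll irr v00 v0E v0w).
have u0l : linear (u0 v0 : V -> k^o) by exact: u0s.
rewrite yE cE.
have -> : y • (Fw I • v0) = 0; last exact: (lin0 (us : linear (u : V -> k^o))).
set v := Fw I • v0.
apply: (u0_E_separate q_neq0 q_not_root M_gt0 Lrg rgE Ll irr v00 v0E v0w) => J.
pose uJ := (fun w : V => u0 v0 (Ew J • w)).
have uJs : scalar uJ by exact: (comp_linear u0l (um_linr _)).
have [e eE] := coef_ex A v tV uJs.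
rewrite -[LHS]eE -yE.
move: (e) eE; rewrite /uJ {uJ uJs e}; elim/last_ind: J (v) => [|J i IH] w e eE.
  have {}eE f : ev e f = u0 v0 (f • w) by rewrite eE Ew_nil um_act1.
  rewrite /psi cvD cvN cv1 [_ *: _]mulr1 qc_ev_counit -[rlam _ e]/(r (hone A) e).
  rewrite (r_dual q_neq0 q_not_root M_gt0 Lrg rgE hr (hone A) tV hw eE) qc_ev1 qe_counitK //.
  by rewrite eE um_act1 mul1r subrr.
have uJs : scalar (fun w : V => u0 v0 (Ew J • w)) by exact: (comp_linear u0l (um_linr _)).
have [e0 e0E] := coef_ex A w tV uJs.
have -> : e = ract e0 (Ef U i).
  by apply: ev_inj => f; rewrite ev_ract eE e0E Ew_rcons !um_actM.
rewrite -kap_mul -psiE mul_kap; apply: (IH (Ef U i • w)) => f.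
by rewrite ev_lact e0E um_actM.
Qed.

Lemma standard_coquasitriangular : is_coquasitriangular r.
Proof.
split.
- exact: (r_bilinear hr).
- exact: (r_comm q_neq0 q_not_root M_gt0 Lrg rgE hr).
- move=> a b c; have := rlamM q_neq0 q_not_root M_gt0 Lrg rgE hr a b.
  by move/(congr1 (fun phi : C1 => phi c)).
- move=> a b c; have := rrhoM q_neq0 q_not_root M_gt0 Lrg rgE hr b c.
  by move/(congr1 (fun phi : C1 => phi a)).
- move=> b; have E : rlam (hone A) b = (1 : C1) b by rewrite rlam_one.
  by rewrite cv1 [_ *: _]mulr1 in E; exact: E.
- move=> a; have E : rrho (hone A) a = (1 : C1) a by rewrite rrho_one.
  by rewrite cv1 [_ *: _]mulr1 in E; exact: E.
Qed.

(** ** The functionals given by the quantum group *)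

Definition env_functionals : set (A -> k^o) :=
  [set g | exists f, g = (fun c => ev c f : k^o)].

Lemma env_functionals_hopf : is_hopf_subalgebra env_functionals.
Proof.
split.
- split; last first.
    split; first by exists 0; apply: funext => c; rewrite (lin0 (evr c)).
    move=> t _ _ [f ->] [g ->]; exists (t *: f + g).
    by apply: funext => c; rewrite evr.
  move=> _ [f ->]; split; first exact: (ev_l f).
  exists [seq ((fun c : A => ev c p.1 : k^o) : A -> k^o, (fun c : A => ev c p.2 : k^o) : A -> k^o) |
    p <- repr (qe_comul f)].
    by move=> p /mapP[p' _ ->]; split; exact: ev_l.
  by move=> a b; rewrite evM big_map.
- by exists 1; apply: funext => c; rewrite qc_ev_counit.
- move=> _ _ [f ->] [g ->]; exists (f * g).
  by apply: funext => c; rewrite ev_comul.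
- by move=> _ [f ->]; exists (qe_antip f); apply: funext => c; rewrite ev_hantip.
- move=> _ [f ->].
  exists [seq ((fun c : A => ev c p.1 : k^o) : A -> k^o, (fun c : A => ev c p.2 : k^o) : A -> k^o) |
    p <- repr (qe_comul f)].
    by move=> p /mapP[p' _ ->]; split; [exists p'.1|exists p'.2].
  by move=> a b; rewrite evM big_map.
Qed.

Lemma env_functionals_lplus : range (lplus r) `<=` env_functionals.
Proof.
move=> _ [b _ <-]; have [f fE] := rho_kap q_neq0 q_not_root M_gt0 Lrg rgE hr b.
by exists f; apply: funext => a; have := fE a.
Qed.

Lemma env_functionals_lminus : range (lminus r) `<=` env_functionals.
Proof.
move=> _ [a _ <-]; rewrite /lminus (conv_inv_r hA standard_coquasitriangular).
have [f fE] := lam_kap q_neq0 q_not_root M_gt0 Lrg rgE hr (hantip a).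
by exists f; apply: funext => b; have := fE b.
Qed.

End StandardForm.

(** * A grading by parity *)

Section Triangular.
Variables (k : fieldType) (G : semisimple_datum) (q : k).
Hypothesis q_neq0 : q != 0.
Variables (s : root_of_q G q) (U : quantum_env s).
Local Notation N := (rk G).
Local Notation weight := 'rV[rat]_(rk G).
Local Notation L := (lattice (s := G)).
Local Notation alpha := (@simple_root (rk G)).
Local Notation chi := (chi s).
Local Notation Fw := (Fw U).
Local Notation Ew := (Ew U).
Local Notation K := (Kf U).

Variables (par : weight -> bool) (eE eF : 'I_N -> bool).
Hypothesis parD : forall x y, L x -> L y -> par (x + y) = par x (+) par y.
Hypothesis parEF : forall i, eE i (+) eF i = par (alpha i).

Fact par0 : par 0 = false.
Proof. by have := parD (L0 G) (L0 G); rewrite addr0 addbb. Qed.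

Fact parN x : L x -> par (- x) = par x.
Proof. by move=> Lx; have := parD Lx (LN Lx); rewrite subrr par0; case: (par x); case: (par _). Qed.

Definition degw (e : 'I_N -> bool) (I : seq 'I_N) : bool := \big[addb/false]_(i <- I) e i.

Fact degw_cons e i I : degw e (i :: I) = e i (+) degw e I.
Proof. exact: big_cons. Qed.

Fact degw_nil e : degw e [::] = false. Proof. exact: big_nil. Qed.

Definition tri_gen (e : bool) : set U :=
  [set x | exists I J mu, [/\ L mu, par mu (+) degw eF I (+) degw eE J = e &
    x = Fw I * K mu * Ew J]].

Definition tri (e : bool) : set U := lin_span (tri_gen e).

(** Homogeneity is tested by left multiplication on the spans of triangular
   products, so that no basis of the quantum group is needed; it implies
   membership in such a span by [grade_tri]. *)
Definition grade (e : bool) : set U :=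
  [set x | forall e' y, tri e' y -> tri (e (+) e') (x * y)].

Fact tri_subspace e : is_subspace (tri e). Proof. exact: lin_span_subspace. Qed.

Lemma grade_gen e x : (forall I J mu, L mu ->
    tri (e (+) (par mu (+) degw eF I (+) degw eE J)) (x * (Fw I * K mu * Ew J))) ->
  grade e x.
Proof.
move=> H e' y; apply: (lin_span_min (P := [set y | tri (e (+) e') (x * y)])).
  split; first by rewrite /= mulr0; exact: (tri_subspace _).1.
  by move=> c u v Pu Pv; rewrite /= mulrDr -scalerAr; exact: (tri_subspace _).2.
by move=> _ [I [J [mu [Lmu <- ->]]]]; exact: H.
Qed.

Lemma grade_subspace e : is_subspace (grade e).
Proof.
split; first by move=> e' y _; rewrite mul0r; exact: (tri_subspace _).1.
move=> c x y gx gy e' z tz; rewrite mulrDl -scalerAl.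
by apply: (tri_subspace _).2; [exact: gx|exact: gy].
Qed.

Lemma gradeM e e' x y : grade e x -> grade e' y -> grade (e (+) e') (x * y).
Proof. by move=> gx gy e'' z tz; rewrite -mulrA -addbA; apply: gx; exact: gy. Qed.

Lemma grade1 : grade false 1.
Proof. by move=> e y; rewrite mul1r. Qed.

Lemma grade_tri e x : grade e x -> tri e x.
Proof.
move=> gx; rewrite -[x]mulr1 -[e]addbF; apply: gx; apply: lin_span_gen.
exists [::], [::], 0; split; first exact: L0.
  by rewrite par0 !degw_nil.
by rewrite Fw_nil Ew_nil K0 !mulr1.
Qed.

Lemma grade_K mu : L mu -> grade (par mu) (K mu).
Proof.
move=> Lmu; apply: grade_gen => I J nu Lnu.
rewrite !mulrA KFw // -!scalerAl -(mulrA (Fw I)) -KD //.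
apply: (subspaceZ _ (tri_subspace _)); apply: lin_span_gen.
exists I, J, (mu + nu); split=> //; first exact: LD.
by rewrite parD // !addbA.
Qed.

Lemma grade_F i : grade (eF i) (Ff U i).
Proof.
apply: grade_gen => I J nu Lnu; apply: lin_span_gen.
exists (i :: I), J, nu; split=> //; last by rewrite Fw_cons !mulrA.
by rewrite degw_cons; case: (par nu) (eF i) (degw eF I) (degw eE J) => [] [] [] [].
Qed.

(** Moving E_i through a word of F_j produces K of a root in place of E_i
   and F_i, which has the same parity by [parEF]. *)
Lemma grade_E i : grade (eE i) (Ef U i).
Proof.
apply: grade_gen => I J nu Lnu; elim: I => [|j I IH].
  have EK : Ef U i * K nu = (chi nu (alpha i))^-1 *: (K nu * Ef U i).
    by rewrite KE // scalerA mulVf ?scale1r // chi_neq0.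
  rewrite Fw_nil mul1r mulrA EK -scalerAl -mulrA.
  apply: (subspaceZ _ (tri_subspace _)); apply: lin_span_gen.
  exists [::], (i :: J), nu; split=> //; last by rewrite Fw_nil mul1r Ew_cons.
  by rewrite degw_cons; case: (par nu) (eE i) (degw eF [::]) (degw eE J) => [] [] [] [].
set X := Fw I * K nu * Ew J; have XE : Fw (j :: I) * K nu * Ew J = Ff U j * X.
  by rewrite Fw_cons !mulrA.
have tX : tri (par nu (+) degw eF I (+) degw eE J) X.
  by apply: lin_span_gen; exists I, J, nu.
rewrite XE mulrA EF mulrDl -mulrA.
apply: (subspaceD (tri_subspace _)).
  have -> : eE i (+) (par nu (+) degw eF (j :: I) (+) degw eE J) =
      eF j (+) (eE i (+) (par nu (+) degw eF I (+) degw eE J)).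
    rewrite degw_cons.
    by case: (par nu) (eE i) (eF j) (degw eF I) (degw eE J) => [] [] [] [] [].
  exact: grade_F.
case: eqP => [<-|_]; last by rewrite mul0r; exact: (tri_subspace _).1.
rewrite -scalerAl mulrBl; apply: (subspaceZ _ (tri_subspace _)).
have -> : eE i (+) (par nu (+) degw eF (i :: I) (+) degw eE J) =
    par (alpha i) (+) (par nu (+) degw eF I (+) degw eE J).
  rewrite degw_cons -parEF.
  by case: (par nu) (eE i) (eF i) (degw eF I) (degw eE J) => [] [] [] [] [].
apply: (subspaceB (tri_subspace _)).
  exact: (grade_K (La i)).
by rewrite -(parN (La i)); exact: (grade_K (LN (La i))).
Qed.

Lemma grade_nminus : (forall i, eF i = false) -> nminus (U := U) `<=` grade false.
Proof.
move=> e0 x; apply; split.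
  split; [exact: grade_subspace|exact: grade1|].
  by move=> y z gy gz; exact: (gradeM gy gz).
by move=> _ [i _ <-]; rewrite -(e0 i); exact: grade_F.
Qed.

Lemma grade_nplus : (forall i, eE i = false) -> nplus (U := U) `<=` grade false.
Proof.
move=> e0 x; apply; split.
  split; [exact: grade_subspace|exact: grade1|].
  by move=> y z gy gz; exact: (gradeM gy gz).
by move=> _ [i _ <-]; rewrite -(e0 i); exact: grade_E.
Qed.

End Triangular.

(** ** Parity of functionals on the double *)

Section DoubleParity.
Variables (k : fieldType) (G : semisimple_datum) (q : k).
Hypothesis q_neq0 : q != 0.
Hypothesis q_not_root : forall n : nat, (0 < n)%N -> q ^+ n != 1.
Variables (s : root_of_q G q) (U : quantum_env s) (A : quantum_coord U).
Local Notation N := (rk G).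
Local Notation weight := 'rV[rat]_(rk G).
Local Notation L := (lattice (s := G)).
Local Notation pairing := (weight_form (cartan G) (symd (s := G))).
Local Notation alpha := (@simple_root (rk G)).
Local Notation d := (symd (s := G)).
Local Notation "f • v" := (um_act f v) (at level 40).
Local Notation chi := (chi s).
Local Notation Fw := (Fw U).
Local Notation Ew := (Ew U).
Local Notation K := (Kf U).
Local Notation "a ·· b" := (hmul a b) (at level 40, left associativity).
Local Notation qr ga := (qroot_lattice ga : weight).
Local Notation ev := (@qc_ev k G q s U A).
Variables (M : nat) (rg : weight).
Hypothesis M_gt0 : (0 < M)%N.
Hypothesis Lrg : L rg.
Hypothesis rgE : forall i, pairing rg (alpha i) = (2 * M * d i)%:R.
Variables (Rm : universal_R U) (r : A -> A -> k).
Hypothesis hr : is_standard_rform Rm r.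

Let hA := qc_is_hopf A.
Let hC := hopf_coalgebra hA.
Local Notation C1 := (conv_alg k^o hC).

Let evr c : linear (ev c : U -> k^o).
Proof. exact: ev_r. Qed.

Local Notation theta := (theta Rm).
Local Notation kap := (@kap k G q s U A).

Let hcqt := standard_coquasitriangular q_neq0 q_not_root M_gt0 Lrg rgE hr.
Let hD := double_coalgebra hA r.
Local Notation D := (quantum_double r).
Local Notation D1 := (conv_alg k^o hD).
Local Notation cross := (cross hA hcqt).
Local Notation through := (@through k A hA r).

Variable par : weight -> bool.
Hypothesis parD : forall x y, L x -> L y -> par (x + y) = par x (+) par y.

(** On the left factor the lowering operators are even, on the right factor
   the raising operators; the E_i on the left and the F_i on the right have
   the parity of their root. *)
Definition gradeL : bool -> set U :=
  grade (U := U) par (fun i => par (alpha i)) (fun=> false).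
Definition gradeR : bool -> set U :=
  grade (U := U) par (fun=> false) (fun i => par (alpha i)).

Let parL i : par (alpha i) (+) false = par (alpha i).
Proof. exact: addbF. Qed.
Let parR i : false (+) par (alpha i) = par (alpha i).
Proof. by []. Qed.

Fact gradeL1 : gradeL false 1. Proof. exact: grade1. Qed.
Fact gradeR1 : gradeR false 1. Proof. exact: grade1. Qed.

Fact gradeL_K mu : L mu -> gradeL (par mu) (K mu).
Proof. by move=> Lmu; apply: grade_K. Qed.

Fact gradeR_K mu : L mu -> gradeR (par mu) (K mu).
Proof. by move=> Lmu; apply: grade_K. Qed.

(** Represented by a sum of tensors whose two factors have the same parity. *)
Definition even (F : A -> A -> k^o) : Prop := exists2 t : seq (U * U),
  (forall p, p \in t -> exists2 e, gradeL e p.1 & gradeR e p.2) &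
  forall a b, F a b = \sum_(p <- t) ev a p.1 * ev b p.2.

Lemma even_term c e x y : gradeL e x -> gradeR e y ->
  even (fun a b => c * (ev a x * ev b y)).
Proof.
move=> gx gy; exists [:: (c *: x, y)].
  move=> p; rewrite inE => /eqP ->; exists e => //=.
  exact: (subspaceZ _ (grade_subspace _ _ _ _ _)).
by move=> a b; rewrite big_seq1 /= (linZ (evr a)) mulrA.
Qed.

Lemma even_sum (I : eqType) (t : seq I) (F : I -> A -> A -> k^o) :
  (forall i, i \in t -> even (F i)) -> even (fun a b => \sum_(i <- t) F i a b).
Proof.
elim: t => [|i t IH] H; first by exists [::] => // a b; rewrite !big_nil.
have [u uP uE] := H i (mem_head _ _).
have [|w wP wE] := IH; first by move=> j jt; apply: H; rewrite inE jt orbT.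
exists (u ++ w); first by move=> p; rewrite mem_cat => /orP[/uP|/wP].
by move=> a b; rewrite big_cons big_cat /= uE wE.
Qed.

Lemma even_lin c F F' : even F -> even F' -> even (fun a b => c *: F a b + F' a b).
Proof.
move=> [u uP uE] [w wP wE]; exists ([seq (c *: p.1, p.2) | p <- u] ++ w).
  move=> p; rewrite mem_cat => /orP[/mapP[p' /uP[e ge ge'] ->]|/wP //].
  by exists e => //=; exact: (subspaceZ _ (grade_subspace _ _ _ _ _)).
move=> a b; rewrite big_cat big_map /= uE wE scaler_sumr; congr (_ + _).
by apply: eq_bigr => p _; rewrite (linZ (evr a)) -mulrA.
Qed.

(** Convolution in the two variables multiplies the representing tensors. *)
Lemma even_mul F F' : even F -> even F' ->
  even (fun a b => \tsum_(a1, a2 <- hcomul a) \tsum_(b1, b2 <- hcomul b) (F a1 b1 * F' a2 b2)).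
Proof.
move=> [u uP uE] [w wP wE]; exists [seq (p.1 * p'.1, p.2 * p'.2) | p <- u, p' <- w].
  move=> _ /allpairsP[[p p'] [/uP[e g1 g2] /wP[e' g1' g2'] ->]] /=.
  exists (e (+) e'); exact: gradeM.
move=> a b; rewrite big_allpairs_dep /=.
transitivity (\sum_(p <- u) \sum_(p' <- w) \sum_(x <- repr (hcomul a)) \sum_(y <- repr (hcomul b))
   ((ev x.1 p.1 * ev y.1 p.2) * (ev x.2 p'.1 * ev y.2 p'.2))).
  rewrite /tensor_sum.
  under eq_bigr => x _ do under eq_bigr => y _ do rewrite uE wE big_distrlr /=.
  under eq_bigr => x _ do rewrite exchange_big /=.
  rewrite exchange_big; apply: eq_bigr => p _ /=.
  under eq_bigr => x _ do rewrite exchange_big /=.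
  by rewrite exchange_big.
apply: eq_bigr => p _; apply: eq_bigr => p' _; rewrite -!ev_comul /tensor_sum big_distrlr /=.
by apply: eq_bigr => x _; apply: eq_bigr => y _; rewrite mulrACA.
Qed.

Definition even_dual : set D1 := [set phi | even (fun a b => phi (a ⊗ b : D))].

Lemma even_dual_subalgebra : is_subalgebra even_dual.
Proof.
have ext (F F' : A -> A -> k^o) : (forall a b, F a b = F' a b) -> even F -> even F'.
  by move=> FF [u uP uE]; exists u => // a b; rewrite -FF.
split; first split.
- by exists [::] => // a b; rewrite big_nil cv0.
- move=> c x y ex ey; apply: ext (even_lin c ex ey) => a b.
  by rewrite cvD cvZ.
- apply: ext (even_term 1 gradeL1 gradeR1) => a b.
  rewrite (one_dprod hA) (dprodE hA) (hcounitM hA) mul1r !qc_ev_counit.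
  by [].
- move=> x y ex ey; apply: ext (even_mul ex ey) => a b.
  by rewrite dsum_conv.
Qed.

(** These functionals are values at coproducts, and the coproduct of each
   generator is a sum of tensors with factors of equal parity. *)
Lemma even_through f : even_dual (through (kap f)).
Proof.
have ext (F F' : A -> A -> k^o) : (forall a b, F a b = F' a b) -> even F -> even F'.
  by move=> FF [u uP uE]; exists u => // a b; rewrite -FF.
have tE g a b : through (kap g) (a ⊗ b : D) = ev (a ·· b) g.
  by rewrite throughE (dprodE hA).
have B a b : bilinear_map (fun f g : U => ev a f * ev b g : k^o).
  by split=> z; [apply: mulr_linr|apply: mulr_linl]; exact: evr.
move: f; apply: (env_ind (P := [set f | even_dual (through (kap f))])).
- have [[S0 Sl] S1 SM] := even_dual_subalgebra.
  split; first split.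
  + apply: ext S0 => a b; rewrite tE (lin0 (evr _)) cv0.
    by [].
  + move=> c f g Sf Sg; apply: ext (Sl c _ _ Sf Sg) => a b.
    by rewrite cvD cvZ !tE evr.
  + apply: ext S1 => a b; rewrite tE (one_dprod hA) (dprodE hA) qc_ev_counit.
    by [].
  + move=> f g Sf Sg; apply: ext (SM _ _ Sf Sg) => a b.
    rewrite tE -ev_comul dsum_conv.
    have C : bilinear_map (fun c1 c2 : A => ev c1 f * ev c2 g : k^o).
      by split=> z; [apply: mulr_linr|apply: mulr_linl]; exact: ev_l.
    rewrite (tsum_mul hA _ _ C); apply: eq_tsum => a1 a2; apply: eq_tsum => b1 b2.
    by rewrite !tE.
- move=> mu Lmu.
  apply: ext (even_term 1 (gradeL_K Lmu) (gradeR_K Lmu)) => a b.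
  by rewrite tE mul1r evcM_K.
- move=> i; pose t := [:: (Ef U i, K (alpha i)); (1, Ef U i)].
  exists t.
    move=> p; rewrite !inE => /orP[] /eqP ->.
      exists (par (alpha i)); first exact: (@grade_E k G q q_neq0 s U par _ _ parD parL i).
      exact: (gradeR_K (La i)).
    exists false; first exact: gradeL1.
    exact: (@grade_E k G q q_neq0 s U par _ _ parD parR i).
  by move=> a b; rewrite tE evM (tsum_comulE (B a b)) !big_cons big_nil addr0.
- move=> i; pose t := [:: (Ff U i, 1); (K (- alpha i), Ff U i)].
  exists t.
    move=> p; rewrite !inE => /orP[] /eqP ->.
      exists false; last exact: gradeR1.
      exact: (@grade_F k G q s U par (fun i => par (alpha i)) (fun=> false)).
    exists (par (alpha i)); last exact: (@grade_F k G q s U par (fun=> false) (fun i => par (alpha i))).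
    by rewrite -(parN parD (La i)); exact: (gradeL_K (LN (La i))).
  by move=> a b; rewrite tE evM (tsum_comulF (B a b)) !big_cons big_nil addr0.
Qed.

(** ** The functionals of the first family are even *)

Lemma antip_weight (P : set U) ga x : weight_part P ga x ->
  weight_part (setT : set U) ga (qe_antip x).
Proof.
move=> [_ pw]; split=> // mu Lmu.
have <- : qe_antip (K mu * x * K (- mu)) = K mu * qe_antip x * K (- mu).
  rewrite !env_antipM !qe_antipK ?opprK ?mulrA //; exact: LN.
by rewrite pw // (linZ (@env_antip_linear _ _ _ _ U)).
Qed.

Lemma linear_bigsum (V W : lmodType k) I (t : seq I) (F : I -> V -> W) :
  (forall i, linear (F i)) -> linear (fun x => \sum_(i <- t) F i x).
Proof.
by move=> H c x y; rewrite scaler_sumr -big_split; apply: eq_bigr => i _; exact: H.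
Qed.

Section CrossFormula.
Variables (V : uq_module U) (la : weight) (v0 : V) (u : V -> k) (I : seq 'I_N) (e : A) (n : nat).
Hypothesis hw : is_highest la v0.
Hypothesis us : scalar u.
Hypothesis eE : forall f, ev e f = u (f • (Fw I • v0)).
Hypothesis nF : forall I, (n <= ht I)%N -> Fw I • v0 = 0.

Local Notation nu := (la - wt I).
Local Notation m := (ht I + n)%N.
Local Notation coefT ga de p p' :=
  (chi (qr ga + qr de) (nu - qr de) * ev e (qe_antip p.1 * p'.2)).

Fact Lnu : L nu. Proof. by have [Ll _ _ _ _] := hw; exact: LB Ll (Lwt I). Qed.

(** The term of the r-form expansion given by one summand of Theta for each
   of its two factors. The Cartan parts depend on the weights of a and b and
   have been absorbed into K_(nu - de), which no longer does. *)
Definition crossT a b ga de (p p' : U * U) : k^o :=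
  coefT ga de p p' * (ev a (p.2 * K (qr de - nu)) * ev b (p'.1 * K (nu - qr de))).

Let H a b ga de : k^o := \sum_(p <- theta ga) \sum_(p' <- theta de) crossT a b ga de p p'.

(** A large de lowers the vector of e below all its weights, and a large ga
   then raises it above the highest one; the bound depends on e alone. *)
Lemma crossT_vanish a b ga de p p' : p \in theta ga -> p' \in theta de ->
  (m <= htq ga)%N || (m <= htq de)%N -> crossT a b ga de p p' = 0.
Proof.
have [Ll irr v00 v0E v0w] := hw.
move=> /theta_weight[pw _] /theta_weight[_ pw'] big; rewrite /crossT eE um_actM.
have -> : qe_antip p.1 • (p'.2 • (Fw I • v0)) = 0; last first.
  by rewrite (lin0 (us : linear (u : V -> k^o))) mulr0 mul0r.
have [nd|dn] := leqP n (htq de).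
  rewrite (F_nilpotent_on q_neq0 q_not_root M_gt0 Lrg rgE Ll irr v00 v0E v0w nF pw').
    by rewrite (lin0 (um_linr _)).
  by rewrite (leq_trans nd) // leq_addl.
have {big} mg : (m <= htq ga)%N.
  by case/orP: big => // le; have := leq_trans (leq_addl (ht I) n) le; rewrite leqNgt dn.
have wp := wv_weight_part q_neq0 (LN (Lqroot de)) Lnu pw' (wv_Fv0 q_neq0 Ll v0w I).
have Ld := LD Lnu (LN (Lqroot de)).
have wq := wv_weight_part q_neq0 (Lqroot ga) Ld (antip_weight pw) wp.
apply: (wv_high q_neq0 q_not_root Lrg rgE Ll irr v00 v0E v0w (LD Ld (Lqroot ga)) wq).
rewrite !pairingDr !pairingNr (rg_wt rgE) !(rg_qroot rgE) -!addrA ltrDl addrA -opprD addrC subr_gt0.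
rewrite -natrD -mulnDr ltr_nat ltn_pmul2l ?muln_gt0 //.
by rewrite (leq_trans _ mg) // ltn_add2l.
Qed.

Fact H_vanish a b ga de : (m <= htq ga)%N || (m <= htq de)%N -> H a b ga de = 0.
Proof.
move=> big; rewrite /H big_seq big1 // => p pt; rewrite big_seq big1 // => p' pt'.
exact: crossT_vanish.
Qed.

Fact scalar_shuffle (x y f g h i z : k) :
  x * (y * (f * g * (h * i * z))) = f * i * z * (g * x * (h * y)).
Proof. by ring. Qed.

(** Both l-functionals are values at explicit elements ([rho_explicit],
   [lam_explicit]), but over ranges of weights depending on a and b; by
   [crossT_vanish] these shrink to a common range, which makes the
   right-hand side linear in a and b. *)
Lemma cross_formula a b : cross e (a ⊗ b : D) =
  \sum_(ga <- gammas G m) \sum_(de <- gammas G m) H a b ga de.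
Proof.
have [Ll irr v00 v0E v0w] := hw; have Ln := Lnu.
have lF c x y : linear (fun a : A => c * (ev a x * y) : k^o).
  by apply: mulr_linr; apply: mulr_linl; exact: ev_l.
have lG c x y : linear (fun b : A => c * (x * ev b y) : k^o).
  by apply: mulr_linr; apply: mulr_linr; exact: ev_l.
have Hl b0 : linear (fun a0 => \sum_(ga <- gammas G m) \sum_(de <- gammas G m) H a0 b0 ga de).
  apply: linear_bigsum => ga; apply: linear_bigsum => de; apply: linear_bigsum => p.
  by apply: linear_bigsum => p'; exact: lF.
have Hr a0 : linear (fun b0 => \sum_(ga <- gammas G m) \sum_(de <- gammas G m) H a0 b0 ga de).
  apply: linear_bigsum => ga; apply: linear_bigsum => de; apply: linear_bigsum => p.
  by apply: linear_bigsum => p'; exact: lG.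
have cl : linear (cross e : D -> k^o) by exact: cv_linear.
move: a b; apply: (coord_ind q_neq0 (P := [set a : A | forall b, cross e (a ⊗ b : D) =
    \sum_(ga <- gammas G m) \sum_(de <- gammas G m) H a b ga de])).
  split=> [b|t a a' Ea Ea' b].
    have -> : ((0 : A) ⊗ b : D) = 0 by exact: (lin0 (tensl_linear b)).
    by rewrite (lin0 cl) (lin0 (Hl b)).
  have -> : ((t *: a + a') ⊗ b : D) = t *: (a ⊗ b : D) + (a' ⊗ b : D) by exact: tensl_linear.
  by rewrite cl Ea Ea' (Hl b).
move=> V' la' v0' u' I' a tV' hw' us' aE b; move: b.
apply: (coord_ind q_neq0 (P := [set b : A | cross e (a ⊗ b : D) =
    \sum_(ga <- gammas G m) \sum_(de <- gammas G m) H a b ga de])).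
  split=> [|t b b' Eb Eb']; rewrite /mkset.
    have -> : (a ⊗ (0 : A) : D) = 0 by exact: (lin0 (tensr_linear a)).
    by rewrite (lin0 cl) (lin0 (Hr a)).
  have -> : (a ⊗ (t *: b + b') : D) = t *: (a ⊗ b : D) + (a ⊗ b' : D) by exact: tensr_linear.
  by rewrite cl Eb Eb' (Hr a).
move=> V'' la'' v0'' u'' I'' b tV'' hw'' us'' bE.
have [Ll' _ _ _ v0w'] := hw'; have [Ll'' _ _ _ v0w''] := hw''.
have [n0 nF'] := F_nilpotent q_neq0 q_not_root A M_gt0 Lrg rgE tV' hw'.
(* Ranges wide enough for the expansions of both forms and containing the
   common range m. *)
pose n1 := maxn n0 m; pose n2 := maxn (ht I'').+1 m.
have nF1 J : (n1 <= ht J)%N -> Fw J • v0' = 0.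
  by move=> le; apply: nF'; apply: leq_trans le; exact: leq_maxl.
have lt2 : (ht I'' < n2)%N by exact: leq_maxl.
pose nu' := la' - wt I'; pose nu'' := la'' - wt I''.
have Ln' : L nu' by exact: LB Ll' (Lwt I').
have Ln'' : L nu'' by exact: LB Ll'' (Lwt I'').
have r1 := rho_explicit q_neq0 q_not_root M_gt0 Lrg rgE hr tV' hw' us' aE nF1.
have r2 := lam_explicit q_neq0 q_not_root M_gt0 Lrg rgE hr tV'' hw'' us'' bE lt2.
have al := @env_antip_linear _ _ _ _ U.
rewrite /mkset.
have -> : cross e (a ⊗ b : D) = ev e (qe_antip (rho_elt Rm n1 nu' a) * lam_elt Rm n2 nu'' b).
  rewrite crossE cvM -ev_comul; apply: eq_tsum => e1 e2.
  rewrite -[lam hA hcqt b e2]/(r b e2) -[rhoi hA hcqt a e1]/(r (hantip e1) a).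
  by rewrite r1 r2 ev_hantip.
transitivity (\sum_(ga <- gammas G n1) \sum_(de <- gammas G n2) H a b ga de).
  rewrite /rho_elt /lam_elt (lin_sum al) mulr_suml (lin_sum (evr e)); apply: eq_bigr => ga _.
  rewrite mulr_sumr (lin_sum (evr e)); apply: eq_bigr => de _.
  rewrite (lin_sum al) mulr_suml (lin_sum (evr e)) big_seq [RHS]big_seq.
  apply: eq_bigr => p /theta_weight[_ _].
  rewrite mulr_sumr (lin_sum (evr e)) big_seq [RHS]big_seq.
  apply: eq_bigr => p' /theta_weight[_ pw].
  have Lg := Lqroot ga; have Ld := Lqroot de.
  rewrite (linZ al) -scalerAl -scalerAr !(linZ (evr e)).
  rewrite env_antipM qe_antipK; last exact: LB.
  rewrite [- (nu' - qr ga)]opprB.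
  rewrite /crossT -[qr de - nu]opprB; set mu := nu - qr de.
  have Lmu : L mu by exact: LB Ln Ld.
  have wp : weight_vector mu (p'.2 • (Fw I • v0)).
    exact: (wv_weight_part q_neq0 (LN Ld) Ln pw (wv_Fv0 q_neq0 Ll v0w I)).
  have ul : linear (u : V -> k^o) by exact: us.
  have ul' : linear (u' : V' -> k^o) by exact: us'.
  have ul'' : linear (u'' : V'' -> k^o) by exact: us''.
  have E1 : ev e (qe_antip p.1 * K (qr ga - nu') * (K (nu'' + qr de) * p'.2)) =
      chi (qr ga - nu') mu * (chi (nu'' + qr de) mu * ev e (qe_antip p.1 * p'.2)).
    rewrite !eE !um_actM (wvK wp (LD Ln'' Ld)) !(linZ (um_linr _)) (wvK wp (LB Lg Ln')).
    by rewrite !(linZ (um_linr _)) !(linZ ul) [LHS]mulrCA.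
  have E2 : ev a (p.2 * K (- mu)) = (chi nu' mu)^-1 * ev a p.2.
    rewrite !aE um_actM (wvK (wv_Fv0 q_neq0 Ll' v0w' I') (LN Lmu)) (linZ (um_linr _)) (linZ ul').
    by rewrite chiNl chiC.
  have E3 : ev b (p'.1 * K mu) = chi nu'' mu * ev b p'.1.
    rewrite !bE um_actM (wvK (wv_Fv0 q_neq0 Ll'' v0w'' I'') Lmu) (linZ (um_linr _)) (linZ ul'').
    by rewrite chiC.
  rewrite E1 E2 E3 (chiDl q_neq0 s Lg (LN Ln') Lmu) (chiDl q_neq0 s Ln'' Ld Lmu) (chiDl q_neq0 s Lg Ld Lmu) chiNl.
  have sc (c : k) (z : k^o) : c *: z = (c : k) * (z : k) by [].
  rewrite !sc.
  exact: scalar_shuffle.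
transitivity (\sum_(ga <- gammas G n1) \sum_(de <- gammas G m) H a b ga de).
  apply: eq_bigr => ga _; apply: gammas_shrink; first exact: leq_maxr.
  by move=> de le; apply: H_vanish; rewrite le orbT.
apply: gammas_shrink; first exact: leq_maxr.
by move=> ga le; rewrite big1 // => de _; apply: H_vanish; rewrite le.
Qed.

(** The two factors of a term are an element of U(n_-) and one of U(n_+),
   which are even on their sides, times K_(de - nu) and K_(nu - de), which
   have the same parity. *)
Lemma even_cross_coef : even_dual (cross e).
Proof.
have Ln := Lnu.
have ext (F F' : A -> A -> k^o) : (forall a b, F a b = F' a b) -> even F -> even F'.
  by move=> FF [t tP tE]; exists t => // a b; rewrite -FF.
apply: (ext (fun a b => \sum_(ga <- gammas G m) \sum_(de <- gammas G m) H a b ga de)).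
  by move=> a b; rewrite cross_formula.
apply: even_sum => ga _; apply: even_sum => de _.
apply: even_sum => p /theta_weight[_ [pw _]]; apply: even_sum => p' /theta_weight[[pw' _] _].
have Lmu := LB Ln (Lqroot de).
have gp : gradeL false p.2 by apply: grade_nminus.
have gp' : gradeR false p'.1 by apply: grade_nplus.
have gK : gradeL (par (nu - qr de)) (K (qr de - nu)).
  by rewrite -(parN parD Lmu) opprB; apply: gradeL_K; exact: LB (Lqroot de) Ln.
by apply: (even_term _ (gradeM gp gK) (gradeM gp' (gradeR_K Lmu))).
Qed.

End CrossFormula.

Lemma even_cross e : even_dual (cross e).
Proof.
move: e; apply: (coord_ind q_neq0 (P := [set e : A | even_dual (cross e)])).
  have [S _ _] := even_dual_subalgebra; split.
    by rewrite /= (lin0 (@cross_linear k A hA r hcqt)); exact: S.1.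
  by move=> c x y Ex Ey; rewrite /= (@cross_linear k A hA r hcqt); exact: S.2.
move=> V la v0 u I e tV hw us eE.
have [n nF] := F_nilpotent q_neq0 q_not_root A M_gt0 Lrg rgE tV hw.
exact: (even_cross_coef hw us eE nF).
Qed.

Lemma even_double_alg (phi : D1) :
  double_alg hcqt (@env_functionals k G q s U A) phi -> even_dual phi.
Proof.
apply; split; first exact: even_dual_subalgebra.
move=> _ [[e _ <-]|[g [f gE] ->]]; first exact: even_cross.
have -> : g = kap f by apply: cvP => c; rewrite gE.
exact: even_through.
Qed.

End DoubleParity.

(** * Powers of a highest weight coefficient *)

Section Endgame.
Variables (k : fieldType) (G : semisimple_datum) (q : k).
Hypothesis q_neq0 : q != 0.
Hypothesis q_not_root : forall n : nat, (0 < n)%N -> q ^+ n != 1.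
Variables (s : root_of_q G q) (U : quantum_env s) (A : quantum_coord U).
Local Notation N := (rk G).
Local Notation weight := 'rV[rat]_(rk G).
Local Notation L := (lattice (s := G)).
Local Notation pairing := (weight_form (cartan G) (symd (s := G))).
Local Notation alpha := (@simple_root (rk G)).
Local Notation d := (symd (s := G)).
Local Notation "f • v" := (um_act f v) (at level 40).
Local Notation chi := (chi s).
Local Notation Fw := (Fw U).
Local Notation Ew := (Ew U).
Local Notation K := (Kf U).
Local Notation "a ·· b" := (hmul a b) (at level 40, left associativity).
Local Notation qr ga := (qroot_lattice ga : weight).
Local Notation ev := (@qc_ev k G q s U A).
Variables (M : nat) (rg : weight).
Hypothesis M_gt0 : (0 < M)%N.
Hypothesis Lrg : L rg.
Hypothesis rgE : forall i, pairing rg (alpha i) = (2 * M * d i)%:R.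
Variables (Rm : universal_R U) (r : A -> A -> k).
Hypothesis hr : is_standard_rform Rm r.

Let hA := qc_is_hopf A.
Let hC := hopf_coalgebra hA.
Local Notation C1 := (conv_alg k^o hC).

Let evr c : linear (ev c : U -> k^o).
Proof. exact: ev_r. Qed.

Local Notation kap := (@kap k G q s U A).
Local Notation D := (quantum_double r).
Let hcqt := standard_coquasitriangular q_neq0 q_not_root M_gt0 Lrg rgE hr.

Variables (V : uq_module U) (v0 : V).
Hypothesis tV : type_L V.
Hypothesis hw : is_highest rg v0.

Fact u0_sc : scalar (u0 v0).
Proof.
have [Ll irr v00 v0E v0w] := hw.
exact: (u0_scalar q_neq0 q_not_root M_gt0 Lrg rgE Ll irr v00 v0E v0w).
Qed.

Definition hcoef : A := sval (cid (coef_ex A v0 tV u0_sc)).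

Fact hcoefE f : ev hcoef f = u0 v0 (f • v0).
Proof. exact: (svalP (cid (coef_ex A v0 tV u0_sc))). Qed.

Definition hpow n : A := iter n (hmul hcoef) (hone A).

(** Raising operators act as twisted derivations and kill the coefficient
   itself. *)
Lemma hpow_E n i : lact (Ef U i) (hpow n) = 0.
Proof.
elim: n => [|n IH]; first by rewrite lact_one qe_counitE scale0r.
have [Ll irr v00 v0E v0w] := hw.
have c0 : lact (Ef U i) hcoef = 0.
  apply: ev_inj => f; rewrite ev_lact hcoefE um_actM v0E (lin0 (ev_l f)) (lin0 (um_linr _)).
  exact: (lin0 (u0_sc : linear (u0 v0 : V -> k^o))).
rewrite /hpow iterS -/(hpow n) (lactM q_neq0) (tsum_comulE (lact_mul_bilinear q_neq0 _ _)).
by rewrite IH c0 (lin0 (hmul_linl hA _)) (lin0 (hmul_linr hA _)) addr0.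
Qed.

Lemma hpow_F n i : ract (hpow n) (Ff U i) = 0.
Proof.
elim: n => [|n IH]; first by rewrite ract_one qe_counitF scale0r.
have [Ll irr v00 v0E v0w] := hw.
have c0 : ract hcoef (Ff U i) = 0.
  apply: ev_inj => f; rewrite ev_ract hcoefE um_actM (lin0 (ev_l f)).
  exact: (u0_Ff q_neq0 q_not_root M_gt0 Lrg rgE Ll irr v00 v0E v0w).
rewrite /hpow iterS -/(hpow n) (ractM q_neq0) (tsum_comulF (ract_mul_bilinear q_neq0 _ _)).
by rewrite IH c0 (lin0 (hmul_linl hA _)) (lin0 (hmul_linr hA _)) addr0.
Qed.

Lemma hpow_K n mu : L mu -> ev (hpow n) (K mu) = chi mu rg ^+ n.
Proof.
move=> Lmu; have [Ll irr v00 v0E v0w] := hw.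
elim: n => [|n IH]; first by rewrite qc_ev1 qe_counitK // expr0.
rewrite /hpow iterS -/(hpow n) evcM_K // IH exprS hcoefE (wvK v0w Lmu); congr (_ * _).
rewrite (linZ (u0_sc : linear (u0 v0 : V -> k^o))).
rewrite (u0_v0 q_neq0 q_not_root M_gt0 Lrg rgE Ll irr v00 v0E v0w).
by rewrite [_ *: _]mulr1.
Qed.

Lemma hpow_tri n I J mu : L mu ->
  ev (hpow n) (Fw I * K mu * Ew J) = (nilp I && nilp J)%:R * chi mu rg ^+ n.
Proof.
move=> Lmu; case: I => [|i I]; last first.
  by rewrite mul0r Fw_cons -!mulrA -ev_ract hpow_F (lin0 (ev_l _)).
case/lastP: J => [|J i].
  by rewrite Fw_nil Ew_nil mulr1 !mul1r hpow_K.
rewrite Ew_rcons mulrA -ev_lact hpow_E (lin0 (ev_l _)).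
by rewrite /nilp size_rcons /= mul0r.
Qed.

Variable par : weight -> bool.
Hypothesis parD : forall x y, L x -> L y -> par (x + y) = par x (+) par y.

Definition geom (mu : weight) : nat -> k^o := fun n => chi mu rg ^+ n.

(** Combinations of the geometric sequences whose ratios come from weights
   of parity e. *)
Definition expo (e : bool) : set (nat -> k^o) :=
  lin_span [set g | exists2 mu, L mu /\ par mu = e & g = geom mu].

(** On powers of the highest weight coefficient a triangular product F_I
   K_mu E_J vanishes unless both words are empty. *)
Lemma expo_tri eE eF e x : (forall i, eE i (+) eF i = par (alpha i)) ->
  tri (U := U) par eE eF e x -> expo e (fun n => ev (hpow n) x).
Proof.
move=> parEF; apply: (lin_span_min (P := [set x | expo e (fun n => ev (hpow n) x)])).
  split=> [|t y z Py Pz] /=.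
    have -> : (fun n => ev (hpow n) (0 : U)) = 0 :> (nat -> k^o).
      by apply: funext => n; rewrite (lin0 (evr _)).
    exact: (lin_span_subspace _).1.
  have -> : (fun n => ev (hpow n) (t *: y + z)) =
      t *: (fun n => ev (hpow n) y : k^o) + (fun n => ev (hpow n) z : k^o) :> (nat -> k^o).
    by apply: funext => n; rewrite evr.
  exact: (lin_span_subspace _).2.
move=> _ [I [J [mu [Lmu eD ->]]]] /=.
case: (boolP (nilp I && nilp J)) => [/andP[I0 J0]|IJ].
  apply: lin_span_gen; exists mu.
    by rewrite -eD (nilP I0) (nilP J0) !degw_nil !addbF.
  by apply: funext => n; rewrite hpow_tri // I0 J0 mul1r.
have -> : (fun n => ev (hpow n) (Fw I * K mu * Ew J)) = 0 :> (nat -> k^o).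
  by apply: funext => n; rewrite hpow_tri // (negbTE IJ) mul0r.
exact: (lin_span_subspace _).1.
Qed.

Lemma expo_mul e f g : expo e f -> expo e g -> expo false (fun n => f n * g n).
Proof.
have linl (t a b c : k) : (t * a + b) * c = t * (a * c) + b * c by rewrite mulrDl mulrA.
have linr (t a b c : k) : c * (t * a + b) = t * (c * a) + c * b by rewrite mulrDr mulrCA.
move=> ef eg; move: f ef; apply: (lin_span_min (P := [set f | expo false (fun n => f n * g n)])).
  split=> [|t y z Py Pz] /=.
    have -> : (fun n => (0 : nat -> k^o) n * g n) = 0 by apply: funext => n; exact: mul0r.
    exact: (lin_span_subspace _).1.
  have -> : (fun n => (t *: y + z) n * g n) =
      t *: (fun n => y n * g n : k^o) + (fun n => z n * g n : k^o) :> (nat -> k^o).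
    by apply: funext => n; exact: linl.
  exact: (lin_span_subspace _).2.
move=> _ [mu [Lmu pmu] ->] /=; move: g eg.
apply: (lin_span_min (P := [set g | expo false (fun n => geom mu n * g n)])).
  split=> [|t y z Py Pz] /=.
    have -> : (fun n => geom mu n * (0 : nat -> k^o) n) = 0 by apply: funext => n; exact: mulr0.
    exact: (lin_span_subspace _).1.
  have -> : (fun n => geom mu n * (t *: y + z) n) =
      t *: (fun n => geom mu n * y n : k^o) + (fun n => geom mu n * z n : k^o) :> (nat -> k^o).
    by apply: funext => n; exact: linr.
  exact: (lin_span_subspace _).2.
move=> _ [nu [Lnu pnu] ->] /=; apply: lin_span_gen; exists (mu + nu).
  by split; [exact: LD|rewrite parD // pmu pnu addbb].
by apply: funext => n; rewrite /geom (chiDl q_neq0 s Lmu Lnu Lrg) exprMn.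
Qed.

Lemma expo_even (F : A -> A -> k^o) : even par F ->
  expo false (fun n => F (hpow n) (hpow n)).
Proof.
move=> [t tP FE].
have -> : (fun n => F (hpow n) (hpow n)) =
    \sum_(p <- t) (fun n => ev (hpow n) p.1 * ev (hpow n) p.2 : k^o) :> (nat -> k^o).
  by apply: funext => n; rewrite FE fct_sumE.
apply: subspace_sum_in; first exact: lin_span_subspace.
move=> p /tP[e g1 g2]; apply: (expo_mul (e := e)).
  by apply: expo_tri (grade_tri parD g1) => i; rewrite addbF.
by apply: expo_tri (grade_tri parD g2) => i.
Qed.

(** Geometric sequences are eigenvectors of the shift, with their ratios as
   eigenvalues. *)
Lemma not_expo mu0 : L mu0 ->
  (forall mu, L mu -> par mu = false -> chi mu rg != chi mu0 rg) -> ~ expo false (geom mu0).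
Proof.
move=> L0 ne.
have sub : [set g | exists2 mu, L mu /\ par mu = false & g = geom mu] =
    [set v | exists2 i, L i /\ par i = false & v = geom i] by [].
move=> /(lin_span_seq (F := geom) (Q := fun mu => L mu /\ par mu = false)) [t tP tE].
pose T (f : nat -> k^o) : nat -> k^o := fun n => f n.+1.
have Tl : linear T by move=> c f g; apply: funext => n.
have Tg c mu : T (c *: geom mu) = chi mu rg *: (c *: geom mu).
  apply: funext => n; rewrite /T !fctE /geom exprS.
  exact: mulrCA.
have T0 : T (geom mu0) = chi mu0 rg *: geom mu0.
  by have := Tg 1 mu0; rewrite scale1r.
have := eigen_separate (F := fun p : k * weight => p.1 *: geom p.2)
  (e := fun p => chi p.2 rg) Tl T0 (fun p _ => Tg p.1 p.2) _ tE.
move=> /(_ (fun p pt => ne _ (tP p pt).1 (tP p pt).2)) /(congr1 (fun f => f 0%N)).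
by rewrite /geom expr0 => /eqP; rewrite oner_eq0.
Qed.

Fact pair_env a b mu : pair_eval a b (env_functional2 A (K mu ⊗ 1)) = ev a (K mu) * ev b 1.
Proof.
have B : bilinear_map (fun f g : U => ev a f * ev b g : k^o).
  by split=> z; [apply: mulr_linr|apply: mulr_linl]; exact: evr.
transitivity (tensor_sum (fun f g : U => ev a f * ev b g : k^o) (K mu ⊗ 1 : (U ⊗ U)%type)).
  rewrite /pair_eval /env_functional2 [LHS](lin_tsum _ _ (tsum_linear (pair_bilinear a b))).
  by apply: eq_tsum => f g; rewrite (tsum_tens (pair_bilinear a b)).
by rewrite (tsum_tens B).
Qed.

(** The image of f determines f on pure tensors, so f takes the values of
   the tensor on the powers of the highest weight coefficient: the geometric
   sequence of mu0, which is odd, whereas f is even. *)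
Lemma missed_tensor mu0 : L mu0 ->
  (forall mu, L mu -> par mu = false -> chi mu rg != chi mu0 rg) ->
  forall f : D -> k^o, FRT_dual (qdouble_rform r) f ->
  qdouble_iota f <> env_functional2 A (K mu0 ⊗ 1).
Proof.
move=> Lm0 ne f Ff fE.
have ac := @coord_antip_comul k G q s U A.
have as_ := @coord_antip_surj k G q s U A M rg M_gt0 Lrg rgE.
have Gh := env_functionals_hopf q_neq0 A.
have Gp := env_functionals_lplus q_neq0 q_not_root M_gt0 Lrg rgE hr.
have Gm := env_functionals_lminus q_neq0 q_not_root M_gt0 Lrg rgE hr.
have fd := FRT_double_dual hA hcqt ac Gh Gp Gm as_ Ff.
have [phi Gphi fphi] := FRT_double hA hcqt ac Gh Gp Gm as_ Ff.
have evn : even par (fun a b => f (a ⊗ b : D)).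
  by rewrite fphi; exact: (even_double_alg parD Gphi).
apply: (not_expo Lm0 ne); have := expo_even evn; congr (expo _ _).
apply: funext => n; rewrite -(iota_eval hA hcqt _ _ fd) fE pair_env hpow_K //.
(* The second factor of the tensor is K_0, whose sequence is constant. *)
have <- : K 0 = 1 :> U by exact: K0.
rewrite hpow_K; last exact: L0.
by rewrite chi0l expr1n mulr1.
Qed.

End Endgame.

(** ** A separating parity *)

Section Parity.
Variables (k : fieldType) (G : semisimple_datum) (q : k).
Hypothesis q_neq0 : q != 0.
Hypothesis q_not_root : forall n : nat, (0 < n)%N -> q ^+ n != 1.
Variable s : root_of_q G q.
Local Notation weight := 'rV[rat]_(rk G).
Local Notation L := (lattice (s := G)).
Local Notation pairing := (weight_form (cartan G) (symd (s := G))).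
Local Notation alpha := (@simple_root (rk G)).
Local Notation d := (symd (s := G)).
Variables (M : nat) (rg : weight).
Hypothesis M_gt0 : (0 < M)%N.
Hypothesis Lrg : L rg.
Hypothesis rgE : forall i, pairing rg (alpha i) = (2 * M * d i)%:R.

Fact oddzD (a b : int) : ((a + b) %% 2 != 0)%Z = ((a %% 2 != 0)%Z (+) (b %% 2 != 0)%Z).
Proof. by lia. Qed.

(** The parity of a weight is that of its exponent against the regular
   weight, after division by the largest power of 2 dividing all exponents;
   some weight is then odd. *)
Lemma parity_exists : exists (par : weight -> bool) mu0,
  [/\ forall x y, L x -> L y -> par (x + y) = par x (+) par y, L mu0 &
      forall mu, L mu -> par mu = false -> chi s mu rg != chi s mu0 rg].
Proof.
pose P v := `[< exists mu, [/\ L mu, lexp s mu rg != 0 & logn 2 `|lexp s mu rg|%N = v] >].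
have exP : exists v, P v.
  pose i0 := Ordinal (rk_gt0 G); exists (logn 2 `|lexp s (alpha i0) rg|%N).
  apply/asboolP; exists (alpha i0); split=> //; first exact: La.
  apply/eqP => e0; have := lexpE s (La i0) Lrg.
  rewrite e0 pairingC rgE => /esym/eqP.
  by rewrite mulf_eq0 !pnatr_eq0 !muln_eq0 !eqn0Ngt (qden_gt0 s) M_gt0 symd_gt0.
(* v is the least 2-adic valuation of a nonzero exponent. *)
case: (ex_minnP exP) => v /asboolP[mu0 [L0 nz lv]] minv.
have dv mu : L mu -> ((2 ^ v)%N%:Z %| lexp s mu rg)%Z.
  move=> Lmu; have [->|nzm] := eqVneq (lexp s mu rg) 0; first exact: dvdz0.
  rewrite dvdzE absz_nat pfactor_dvdn ?absz_gt0 //.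
  by apply: minv; apply/asboolP; exists mu.
pose par mu := ((lexp s mu rg %/ (2 ^ v)%N%:Z)%Z %% 2 != 0)%Z.
exists par, mu0; split=> // [x y Lx Ly|mu Lmu pmu].
  by rewrite /par lexpDl // divzDl ?oddzD //; exact: dv.
apply/eqP => /(qrt_inj q_neq0 q_not_root) e; change (lexp s mu rg = lexp s mu0 rg) in e.
move: pmu; rewrite /par e => /negbFE/eqP /dvdz_mod0P d2.
have : ((2 ^ v.+1)%N%:Z %| lexp s mu0 rg)%Z.
  by rewrite -(divzK (dv _ L0)) expnS PoszM; exact: dvdz_mul.
by rewrite dvdzE absz_nat pfactor_dvdn ?absz_gt0 // lv ltnn.
Qed.

End Parity.

(** * Endomorphism algebras and submodules *)

Section Endomorphisms.
Variables (k : fieldType) (V : lmodType k) (V_nz : exists v : V, v != 0).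

Definition endo_pred : {pred V -> V} := [pred f : V -> V | `[< linear f >]].

(** Endomorphisms form a nonzero ring only on a nonzero module, hence the
   extra parameter. *)
Record endo (nz : exists v : V, v != 0) : Type :=
  Endo {endo_fun :> V -> V; _ : endo_fun \in endo_pred}.
Local Notation En := (endo V_nz).

HB.instance Definition _ := [isSub of En for @endo_fun V_nz].
HB.instance Definition _ := [Choice of En by <:].

Fact endo_submod : subsemimod_closed endo_pred.
Proof.
split=> [|c f /asboolP fl]; last first.
  apply/asboolP => b x y; rewrite !fctE fl scalerDr !scalerA.
  by rewrite mulrC.
split=> [|f g /asboolP fl /asboolP gl].
  by apply/asboolP => b x y; rewrite /= scaler0 addr0.
apply/asboolP => b x y; rewrite !fctE fl gl scalerDr !addrA.
by congr (_ + _); rewrite -!addrA; congr (_ + _); rewrite addrC.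
Qed.
HB.instance Definition _ := GRing.SubChoice_isSubLmodule.Build k (V -> V)
  endo_pred En endo_submod.

Lemma endo_linear (f : En) : linear f.
Proof. by case: f => f fP; apply/asboolP. Qed.

Definition endo_of (f : V -> V) (fl : linear f) : En := Endo V_nz (introT (asboolP _) fl).

Lemma endoP (f g : En) : f =1 g -> f = g.
Proof. by move=> fg; apply: val_inj; apply: funext. Qed.

Lemma endoD (f g : En) x : (f + g) x = f x + g x. Proof. by []. Qed.
Lemma endoN (f : En) x : (- f) x = - f x. Proof. by []. Qed.
Lemma endoZ c (f : En) x : (c *: f) x = c *: f x. Proof. by []. Qed.
Lemma endo0 x : (0 : En) x = 0. Proof. by []. Qed.

Definition endo_mul (f g : En) : En := endo_of (comp_linear (endo_linear f) (endo_linear g)).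

Fact id_linear : linear (fun x : V => x). Proof. by []. Qed.

Definition endo_one : En := endo_of id_linear.

Fact endo_mulA : associative endo_mul. Proof. by move=> f g h; exact: endoP. Qed.
Fact endo_mul1l : left_id endo_one endo_mul. Proof. by move=> f; exact: endoP. Qed.
Fact endo_mul1r : right_id endo_one endo_mul. Proof. by move=> f; exact: endoP. Qed.
Fact endo_mulDl : left_distributive endo_mul +%R. Proof. by move=> f g h; exact: endoP. Qed.
Fact endo_mulDr : right_distributive endo_mul +%R.
Proof. by move=> f g h; apply: endoP => x; exact: (linD (endo_linear f)). Qed.
Fact endo_one_neq0 : endo_one != 0.
Proof.
have [v v0] := V_nz.
by apply/eqP => /(congr1 (fun f : En => f v)) e; case/eqP: v0; exact: e.
Qed.

HB.instance Definition _ := GRing.Zmodule_isNzRing.Build En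
  endo_mulA endo_mul1l endo_mul1r endo_mulDl endo_mulDr endo_one_neq0.

Fact endo_scaleAl c (f g : En) : c *: (f * g) = (c *: f) * g.
Proof. exact: endoP. Qed.
HB.instance Definition _ := GRing.Lmodule_isLalgebra.Build k En endo_scaleAl.

Fact endo_scaleAr c (f g : En) : c *: (f * g) = f * (c *: g).
Proof. by apply: endoP => x; rewrite [RHS](linZ (endo_linear f)). Qed.
HB.instance Definition _ := GRing.Lalgebra_isAlgebra.Build k En endo_scaleAr.

Lemma endoM (f g : En) x : (f * g) x = f (g x). Proof. by []. Qed.
Lemma endo1 x : (1 : En) x = x. Proof. by []. Qed.

End Endomorphisms.

Section Subspace.
Variables (k : fieldType) (W : lmodType k) (P : set W) (hP : is_subspace P).

Definition subsp_pred : {pred W} := [pred x | `[< P x >]].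

Record subsp (h : is_subspace P) : Type :=
  Subsp {subsp_val :> W; _ : subsp_val \in subsp_pred}.
Local Notation S := (subsp hP).

HB.instance Definition _ := [isSub of S for @subsp_val hP].
HB.instance Definition _ := [Choice of S by <:].

Fact subsp_closed : subsemimod_closed subsp_pred.
Proof.
split; first split; first by apply/asboolP; exact: hP.1.
  by move=> x y /asboolP Px /asboolP Py; apply/asboolP; exact: subspaceD.
by move=> c x /asboolP Px; apply/asboolP; exact: subspaceZ.
Qed.
HB.instance Definition _ := GRing.SubChoice_isSubLmodule.Build k W subsp_pred S subsp_closed.

Lemma subsp_valP (x : S) : P (val x).
Proof. by case: x => x xP; apply/asboolP. Qed.

Definition subsp_of (x : W) (Px : P x) : S := Subsp hP (introT (asboolP _) Px).

Lemma subsp_val_linear : linear (fun x : S => subsp_val x).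
Proof. by []. Qed.

Lemma subsp_inj (x y : S) : subsp_val x = subsp_val y -> x = y.
Proof. exact: val_inj. Qed.

End Subspace.

(** * Quantum integers and the Serre elements *)

Section QuantumIntegers.
Variables (k : fieldType) (p : k).
Hypothesis p0 : p != 0.
Hypothesis p1 : forall n : nat, (0 < n)%N -> p ^+ n != 1.

Fact q_den n : (0 < n)%N -> p ^+ n - p ^- n != 0.
Proof.
move=> n0; rewrite subr_eq0; apply/eqP => e.
have /eqP := p1 (ltn_addr n n0); apply.
by rewrite exprD {1}e mulVf // expf_neq0.
Qed.

Fact q_intE n : q_int p n * (p - p^-1) = p ^+ n - p ^- n.
Proof. by rewrite /q_int divfK // (q_den (n := 1)). Qed.

Lemma q_int_neq0 n : (0 < n)%N -> q_int p n != 0.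
Proof.
move=> n0; have := q_den n0; rewrite -q_intE; apply: contra => /eqP ->.
by rewrite mul0r.
Qed.

Lemma q_int0 : q_int p 0 = 0. Proof. by rewrite /q_int expr0 invr1 subrr mul0r. Qed.
Lemma q_int1 : q_int p 1 = 1. Proof. by rewrite /q_int divff // (q_den (n := 1)). Qed.

Lemma q_intD m n : q_int p (m + n) = p ^+ m * q_int p n + p ^- n * q_int p m.
Proof.
have D : p - p^-1 != 0 by exact: (q_den (n := 1) isT).
rewrite -[LHS](mulfK D) -[RHS](mulfK D) mulrDl -(mulrA (p ^+ m)) -(mulrA (p ^- n)) !q_intE.
by rewrite exprD invfM; congr (_ / _); ring.
Qed.

Lemma q_factS n : q_fact p n.+1 = q_fact p n * q_int p n.+1.
Proof. by rewrite /q_fact big_nat_recr. Qed.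

Lemma q_fact0 : q_fact p 0 = 1. Proof. by rewrite /q_fact big_geq. Qed.

Lemma q_fact_neq0 n : q_fact p n != 0.
Proof.
elim: n => [|n IH]; first by rewrite q_fact0 oner_neq0.
by rewrite q_factS mulf_neq0 // q_int_neq0.
Qed.

Lemma q_bin0 n : q_bin p n 0 = 1.
Proof. by rewrite /q_bin subn0 q_fact0 mul1r divff // q_fact_neq0. Qed.

Lemma q_binn n : q_bin p n n = 1.
Proof. by rewrite /q_bin subnn q_fact0 mulr1 divff // q_fact_neq0. Qed.

Lemma q_bin_step n r : (r < n)%N ->
  q_bin p n r * q_int p (n - r) = q_bin p n r.+1 * q_int p r.+1.
Proof.
move=> lt; rewrite /q_bin -(subnSK lt) !q_factS.
have f0 := q_fact_neq0; have i0 := q_int_neq0.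
by field; rewrite !f0 !i0.
Qed.

Lemma q_bin_pascal m r : (r < m)%N ->
  q_bin p m.+1 r.+1 = p ^+ r.+1 * q_bin p m r.+1 + p ^- (m - r) * q_bin p m r.
Proof.
move=> lt; have mE : m.+1 = (r.+1 + (m - r))%N by rewrite addSn subnKC // ltnW.
rewrite /q_bin subSS (q_factS m) mE q_intD -(subnSK lt) !q_factS.
have f0 := q_fact_neq0; have i0 := q_int_neq0.
set P := p ^+ r.+1; set Q := p ^- _.
by field; rewrite !f0 !i0.
Qed.

(** The q-binomial theorem at one of its zeros; the partial sums telescope
   by the Pascal rule. *)
Lemma q_alternating m :
  \sum_(0 <= r < m.+2) (-1) ^+ r * q_bin p m.+1 r * p ^+ (r * m) = 0.
Proof.
have partial r : (r <= m)%N -> \sum_(0 <= j < r.+1) (-1) ^+ j * q_bin p m.+1 j * p ^+ (j * m) =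
    (-1) ^+ r * q_bin p m r * p ^+ (r * m.+1).
  elim: r => [|r IH] lt; first by rewrite big_nat1 !q_bin0 !mul0n.
  rewrite big_nat_recr //= IH ?(ltnW lt) // q_bin_pascal //.
  have e1 : p ^+ (r.+1 * m.+1) = p ^+ r.+1 * p ^+ (r.+1 * m) by rewrite mulnS exprD.
  have e2 : p ^+ (r * m.+1) = p ^- (m - r) * p ^+ (r.+1 * m).
    have -> : (r.+1 * m = (m - r) + r * m.+1)%N by rewrite mulSn mulnS addnA subnK ?(ltnW lt).
    by rewrite exprD mulKf // expf_neq0.
  by rewrite e1 e2 exprS; ring.
rewrite big_nat_recr //= partial // !q_binn exprS mulSn mulnS.
by ring.
Qed.

End QuantumIntegers.

Section InverseParameter.
Variables (k : fieldType) (p : k).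

Lemma q_intV n : q_int p^-1 n = q_int p n.
Proof.
rewrite /q_int !exprVn !invrK -opprB -[p^-1 - p]opprB invrN mulrNN.
by [].
Qed.

Lemma q_binV n r : q_bin p^-1 n r = q_bin p n r.
Proof.
have fV m : q_fact p^-1 m = q_fact p m by apply: eq_bigr => j _; exact: q_intV.
by rewrite /q_bin !fV.
Qed.

End InverseParameter.

Section SerreCommutation.
Variables (k : fieldType) (B : algType k) (p : k).
Hypothesis p0 : p != 0.
Hypothesis p1 : forall n : nat, (0 < n)%N -> p ^+ n != 1.
Variables (n : nat) (y z : B).
Hypothesis n_gt0 : (0 < n)%N.

(** Here y, z and p stand for the generators F_i, F_j and for q_i, with n =
   1 - a_ij; the same computation serves the raising operators. *)
Definition serre_term r : B := y ^+ (n - r) * z * y ^+ r.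
Definition serre_sum : B :=
  \sum_(0 <= r < n.+1) ((-1) ^+ r * q_bin p n r) *: serre_term r.

Fact qcomm_exp (a : B) c r : a * y = c *: (y * a) -> a * y ^+ r = c ^+ r *: (y ^+ r * a).
Proof.
move=> ay; elim: r => [|r IH]; first by rewrite !expr0 mulr1 mul1r scale1r.
rewrite [y ^+ r.+1]exprS mulrA ay -scalerAl -[y * a * _]mulrA IH -scalerAr scalerA mulrA.
by rewrite [c ^+ r.+1]exprS.
Qed.

Section Other.
Variables (w a b : B) (c : k).
Hypothesis wy : w * y = y * w.
Hypothesis wz : w * z = z * w + c *: (a - b).
Hypothesis ay : a * y = p ^+ n.-1 *: (y * a).
Hypothesis by_ : b * y = p ^- n.-1 *: (y * b).

(** For the partner of z. The commutator contributes an alternating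
   q-binomial sum at p^(n-1) and at p^(1-n), and both vanish. *)
Lemma serre_comm_other : w * serre_sum = serre_sum * w.
Proof.
have wyr r : w * y ^+ r = y ^+ r * w.
  by have := @qcomm_exp w 1 r; rewrite expr1n !scale1r; exact.
have term r : (r <= n)%N -> w * serre_term r = serre_term r * w +
    c *: (y ^+ n * ((p ^+ (r * n.-1)) *: a - (p^-1 ^+ (r * n.-1)) *: b)).
  move=> le; rewrite /serre_term !mulrA wyr -!mulrA (mulrA w) wz mulrDl mulrDr.
  rewrite -[z * w * _]mulrA wyr; congr (_ + _).
  rewrite -scalerAl -scalerAr; congr (_ *: _).
  rewrite mulrBl (qcomm_exp r ay) (qcomm_exp r by_) !exprVn -!exprM [(r * _)%N]mulnC.
  have -> : y ^+ n = y ^+ (n - r) * y ^+ r by rewrite -exprD subnK.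
  by rewrite !mulrBr -!scalerAr !mulrA.
rewrite /serre_sum mulr_sumr mulr_suml.
under eq_big_nat => r /andP[_ rn] do rewrite -scalerAr (term r rn) scalerDr.
rewrite big_split /=; under [X in X + _]eq_bigr => r _ do rewrite scalerAl.
rewrite -[RHS]addr0; congr (_ + _).
have shuffle t u v (Y : B) : t *: (c *: (Y * (u *: a - v *: b))) =
    c *: (Y * ((t * u) *: a - (t * v) *: b)).
  rewrite !mulrBr -!scalerAr !scalerBr !scalerA.
  by congr (_ *: _ - _ *: _); ring.
case: (n) n_gt0 => // m _ /=.
transitivity (c *: (y ^+ m.+1 *
   ((\sum_(0 <= r < m.+2) (-1) ^+ r * q_bin p m.+1 r * p ^+ (r * m)) *: a -
    (\sum_(0 <= r < m.+2) (-1) ^+ r * q_bin p^-1 m.+1 r * p^-1 ^+ (r * m)) *: b))).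
  rewrite !scaler_suml -sumrB mulr_sumr scaler_sumr; apply: eq_bigr => r _.
  by rewrite q_binV; exact: shuffle.
rewrite q_alternating // q_alternating ?invr_neq0 //.
  by rewrite !scale0r subrr mulr0 scaler0.
by move=> m' m0; rewrite exprVn invr_eq1 p1.
Qed.

End Other.

Section Same.
Variables (x a b : B).
Let c := (p - p^-1)^-1.
Hypothesis xy : x * y = y * x + c *: (a - b).
Hypothesis ay : a * y = p ^- 2 *: (y * a).
Hypothesis by_ : b * y = p ^+ 2 *: (y * b).
Hypothesis xz : x * z = z * x.
Hypothesis az : a * z = p ^+ n.-1 *: (z * a).
Hypothesis bz : b * z = p ^- n.-1 *: (z * b).

Lemma pow_comm m : x * y ^+ m.+1 = y ^+ m.+1 * x +
  (q_int p m.+1 * c) *: (y ^+ m * (p ^- m *: a - p ^+ m *: b)).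
Proof.
elim: m => [|m IH].
  by rewrite expr1 expr0 invr1 !scale1r mul1r q_int1 // mul1r.
have I1 : q_int p m.+2 = p ^+ m.+1 + p^-1 * q_int p m.+1.
  by rewrite -[m.+2]addn1 q_intD // q_int1 // mulr1 expr1.
have I2 : q_int p m.+2 = p * q_int p m.+1 + p ^- m.+1.
  by rewrite -[m.+2]add1n q_intD // q_int1 // mulr1 expr1.
transitivity (y ^+ m.+1 * (y * x + c *: (a - b)) + (q_int p m.+1 * c) *:
    (y ^+ m * (p ^- m *: (a * y) - p ^+ m *: (b * y)))).
  rewrite exprSr mulrA IH mulrDl -xy -[_ * x * y]mulrA -scalerAl -[_ * (_ - _) * y]mulrA.
  by rewrite mulrBl -!scalerAl.
rewrite ay by_ mulrDr mulrA -exprSr -addrA; congr (_ + _).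
rewrite !scalerA !scalerBr !mulrBr -!scalerAr !mulrA -[y ^+ m * y]exprSr !scalerBr !scalerA.
rewrite addrACA -!opprD -!scalerDl.
have E : p ^+ m.+1 = p * p ^+ m by exact: exprS.
have P0 : p ^+ m != 0 by exact: expf_neq0.
congr (_ *: _ - _ *: _).
  by rewrite I1 E; field; rewrite p0 P0.
by rewrite I2 E; field; rewrite p0 P0.
Qed.

(** The element obtained from a term when one factor y is consumed by x;
   neighbouring terms produce the same one. *)
Definition serre_rest r : B := c *: (y ^+ (n.-1 - r) * z * y ^+ r * (p ^- r *: a - p ^+ r *: b)).

Lemma serre_same_term r : (r <= n)%N -> x * serre_term r =
  serre_term r * x + q_int p (n - r) *: serre_rest r + q_int p r *: serre_rest r.-1.
Proof.
move=> rn.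
have right : z * (x * y ^+ r) = z * y ^+ r * x +
    (q_int p r * c) *: (z * y ^+ r.-1 * (p ^- r.-1 *: a - p ^+ r.-1 *: b)).
  case: (r) => [|m]; first by rewrite q_int0 mul0r scale0r addr0 expr0 !mulr1.
  by rewrite pow_comm mulrDr mulrA -scalerAr /= !mulrA.
have left : x * y ^+ (n - r) = y ^+ (n - r) * x + (q_int p (n - r) * c) *:
    (y ^+ (n - r).-1 * (p ^- (n - r).-1 *: a - p ^+ (n - r).-1 *: b)).
  case: (n - r)%N => [|m]; first by rewrite q_int0 mul0r scale0r addr0 expr0 mulr1 mul1r.
  exact: pow_comm.
have pass : (r < n)%N -> (p ^- (n - r).-1 *: a - p ^+ (n - r).-1 *: b) * (z * y ^+ r) =
    z * y ^+ r * (p ^- r *: a - p ^+ r *: b).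
  move=> lt.
  have nE : n.-1 = ((n - r).-1 + r)%N.
    by rewrite -[in RHS](prednK n_gt0) subSn ?subnK // -ltnS prednK.
  have s2 : (p ^+ 2) ^+ r = p ^+ r * p ^+ r by rewrite -exprM mulnC exprM expr2.
  have P0 m : p ^+ m != 0 by exact: expf_neq0.
  have e1 : p ^- (n - r).-1 * p ^+ n.-1 * (p ^- 2) ^+ r = p ^- r.
    by rewrite nE exprD exprVn s2; field; rewrite !P0.
  have e2 : p ^+ (n - r).-1 * p ^- n.-1 * (p ^+ 2) ^+ r = p ^+ r.
    by rewrite nE exprD s2; field; rewrite !P0.
  rewrite mulrBl -!scalerAl !mulrA az bz -!scalerAl -!mulrA.
  rewrite (qcomm_exp r ay) (qcomm_exp r by_) -!scalerAr !scalerA e1 e2.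
  by rewrite !mulrBr -!scalerAr.
rewrite /serre_term -!mulrA mulrA left mulrDl -(mulrA (y ^+ (n - r)) x) -addrA.
rewrite [x * (z * _)]mulrA xz -(mulrA z) right mulrDr !mulrA -addrA; congr (_ + _).
rewrite addrC; congr (_ + _).
  have [/pass e|] := ltnP r n; last first.
    move=> nr; have -> : r = n by apply/eqP; rewrite eqn_leq rn.
    by rewrite subnn q_int0 mul0r !scale0r !mul0r.
  rewrite /serre_rest scalerA -!scalerAl; congr (_ *: _).
  have -> : (n.-1 - r = (n - r).-1)%N by rewrite -!subn1 subnAC.
  by rewrite -!mulrA e !mulrA.
rewrite /serre_rest scalerA -scalerAr.
case: (r) rn => [|m] lt; first by rewrite q_int0 mul0r !scale0r.
by congr (_ *: _); rewrite /= !mulrA -subn1 -subnDA add1n.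
Qed.

(** For the partner of y. The contributions of neighbouring terms cancel by
   [q_bin_step]. *)
Lemma serre_comm_same : x * serre_sum = serre_sum * x.
Proof.
rewrite /serre_sum mulr_sumr mulr_suml.
under eq_big_nat => r /andP[_ rn] do
  rewrite -scalerAr (serre_same_term rn) -addrA scalerDr scalerAl.
rewrite big_split /= -[RHS]addr0; congr (_ + _).
under eq_bigr => r _ do rewrite scalerDr !(scalerA _ _ (serre_rest _)).
rewrite big_split /= big_nat_recr //= subnn q_int0; rewrite mulr0 scale0r addr0.
rewrite [X in _ + X]big_nat_recl //= q_int0 mulr0 scale0r add0r -big_split /=.
rewrite big_nat big1 // => r /andP[_ rn].
rewrite -scalerDl -[_ * _ * q_int p (n - r)]mulrA q_bin_step // exprS mulN1r !mulNr.
by rewrite mulrA subrr scale0r.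
Qed.

End Same.

End SerreCommutation.

(** * The irreducible module of a given highest weight *)

Section SerreFamily.
Variables (k : fieldType) (G : semisimple_datum) (q : k).
Hypothesis q_neq0 : q != 0.
Hypothesis q_not_root : forall n : nat, (0 < n)%N -> q ^+ n != 1.
Variable s : root_of_q G q.
Local Notation N := (rk G).
Local Notation alpha := (@simple_root (rk G)).
Local Notation chi := (chi s).
Variables (B : algType k) (X Y a b : 'I_N -> B).
Hypothesis XY : forall i j, X i * Y j = Y j * X i +
  (if i == j then (qi q i - (qi q i)^-1)^-1 *: (a i - b i) else 0).
Hypothesis aY : forall i j, a i * Y j = (chi (alpha i) (alpha j))^-1 *: (Y j * a i).
Hypothesis bY : forall i j, b i * Y j = chi (alpha i) (alpha j) *: (Y j * b i).

(** A Serre element of one sign commutes with all generators of the other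
   sign. The relations are stated symmetrically, so that exchanging raising
   and lowering operators gives the second case. *)
Lemma serre_family_comm i j l : i != j ->
  X l * serre_lhs q Y i j = serre_lhs q Y i j * X l.
Proof.
move=> ij; pose n := `|1 - cartan G i j|%N.
have off := cartan_offdiag ij.
have nE : cartan G i j = - (n.-1)%:Z by rewrite /n; lia.
have n0 : (0 < n)%N by rewrite /n; lia.
have cij : chi (alpha i) (alpha j) = qi q i ^- n.-1.
  by rewrite chi_roots nE -invr_expz -exprnP.
have cji : chi (alpha j) (alpha i) = qi q i ^- n.-1 by rewrite chiC cij.
have cii : chi (alpha i) (alpha i) = qi q i ^+ 2.
  by rewrite chi_roots cartan_diag -exprnP.
have p0 := qi_neq0 q_neq0 i; have p1 := qi_not_root q_not_root i.
have [->|li] := eqVneq l i.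
  apply: (serre_comm_same p0 p1 n0 (a := a i) (b := b i)).
  - by rewrite XY eqxx.
  - by rewrite aY cii.
  - by rewrite bY cii.
  - by rewrite XY (negbTE ij) addr0.
  - by rewrite aY cij invrK.
  - by rewrite bY cij.
have [->|lj] := eqVneq l j.
  apply: (serre_comm_other p0 p1 n0 (a := a j) (b := b j)
    (c := (qi q j - (qi q j)^-1)^-1)).
  - by rewrite XY eq_sym (negbTE ij) addr0.
  - by rewrite XY eqxx.
  - by rewrite aY cji invrK.
  - by rewrite bY cji.
apply: (serre_comm_other p0 p1 n0 (a := 0) (b := 0) (c := 0)).
- by rewrite XY (negbTE li) addr0.
- by rewrite XY (negbTE lj) scale0r.
- by rewrite mul0r mulr0 scaler0.
- by rewrite mul0r mulr0 scaler0.
Qed.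

End SerreFamily.

Section WordModule.
Variables (k : fieldType) (G : semisimple_datum) (q : k).
Hypothesis q_neq0 : q != 0.
Hypothesis q_not_root : forall n : nat, (0 < n)%N -> q ^+ n != 1.
Variables (s : root_of_q G q).
Local Notation N := (rk G).
Local Notation weight := 'rV[rat]_(rk G).
Local Notation L := (lattice (s := G)).
Local Notation pairing := (weight_form (cartan G) (symd (s := G))).
Local Notation alpha := (@simple_root (rk G)).
Local Notation chi := (chi s).
Variable la : weight.
Hypothesis Lla : L la.
Local Notation W := (seq 'I_N -> k^o).

(** A vector v of the module to be built is encoded as the function sending
   a word w, read from right to left, to the coefficient of E_w v along the
   highest weight vector. This determines the action of the generators; [wF]
   is obtained by moving F_i to the left through the word. *)
Definition wE i (f : W) : W := fun w => f (i :: w).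
Definition wK mu (f : W) : W := fun w => chi mu (la - wt w) * f w.
Definition wH i (f : W) : W := fun w =>
  (qi q i - (qi q i)^-1)^-1 * (wK (alpha i) f w - wK (- alpha i) f w).

Fixpoint wF i (f : W) (w : seq 'I_N) : k^o := if w is j :: w' then
  wF i (wE j f) w' + (if i == j then wH i f w' else 0) else 0.

Fact wE_linear i : linear (wE i). Proof. by []. Qed.

Fact lin_shuffle (t c x y : k) : c * (t * x + y) = t * (c * x) + c * y.
Proof. by rewrite mulrDr mulrCA. Qed.

Fact wK_linear mu : linear (wK mu).
Proof. by move=> t f g; apply: funext => w; exact: lin_shuffle. Qed.

Fact wH_linear i : linear (wH i).
Proof.
move=> t f g; apply: funext => w; rewrite /wH !wK_linear !fctE.
have E (c x y x' y' : k) : c * (t * x + y - (t * x' + y')) = t * (c * (x - x')) + c * (y - y').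
  by ring.
exact: E.
Qed.

Fact wF_linear i : linear (wF i).
Proof.
move=> t f g; apply: funext => w; elim: w f g => [|j w IH] f g.
  by rewrite /= !fctE /= scaler0 addr0.
rewrite /= !fctE /= wE_linear IH wH_linear !fctE /=.
case: ifP => _; last by rewrite !addr0.
by rewrite scalerDr addrACA.
Qed.

Lemma wKE mu i f : L mu -> wK mu (wE i f) = chi mu (alpha i) *: wE i (wK mu f).
Proof.
move=> Lmu; apply: funext => w; rewrite !fctE /wE /wK wt_cons.
have Lw := Lwt w; have Li := La i.
have -> : la - wt w = alpha i + (la - (alpha i + wt w)) by rewrite addrCA opprD addNKr.
rewrite (chiDr q_neq0 s Lmu Li); first by rewrite -mulrA.
by apply: LB Lla _; exact: LD.
Qed.

Lemma wKD mu nu f : L mu -> L nu -> wK (mu + nu) f = wK mu (wK nu f).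
Proof.
move=> Lmu Lnu; apply: funext => w; rewrite /wK (chiDl q_neq0 s Lmu Lnu) ?mulrA //.
exact: LB Lla (Lwt w).
Qed.

Lemma wK0 f : wK 0 f = f.
Proof. by apply: funext => w; rewrite /wK chi0l mul1r. Qed.

Lemma wEF i j f : wE i (wF j f) = wF j (wE i f) + (if j == i then wH j f else 0).
Proof. by apply: funext => w; rewrite fctE /wE /=; case: ifP. Qed.

Lemma wKF mu i f : L mu -> wK mu (wF i f) = (chi mu (alpha i))^-1 *: wF i (wK mu f).
Proof.
move=> Lmu; apply: funext => w; rewrite !fctE /=.
elim: w f => [|j w IH] f; first by rewrite /wK /= mulr0 scaler0.
have nz x : chi mu x != 0 by exact: chi_neq0.
have E1 : wE j (wK mu f) = (chi mu (alpha j))^-1 *: wK mu (wE j f).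
  by rewrite wKE // scalerA mulVf // scale1r.
have E2 : wF i (wK mu (wE j f)) w = chi mu (alpha i) * wK mu (wF i (wE j f)) w.
  by rewrite IH; exact/esym/mulVKf.
have E3 : wH i (wK mu f) w = chi mu (la - wt w) * wH i f w.
  rewrite /wH /wK; have E (c x y z t : k) : c * (x * (z * t) - y * (z * t)) = z * (c * (x * t - y * t)).
    by ring.
  exact: E.
have E4 : chi mu (la - wt (j :: w)) = (chi mu (alpha j))^-1 * chi mu (la - wt w).
  have Lw := Lwt w; have Lj := La j.
  rewrite wt_cons opprD addrCA (chiDr q_neq0 s Lmu (LN Lj)) ?chiNr //.
  exact: LB.
rewrite /= E1 (linZ (wF_linear i)) fctE E2 E3 /wK E4 /=.
have nzi := nz (alpha i); have nzj := nz (alpha j).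
case: eqP => [->|_].
  have E (x y z t u : k) : x != 0 -> y != 0 ->
      y^-1 * z * (t + u) = y^-1 * (y^-1 * (y * (z * t)) + z * u).
    by move=> x0 y0; field.
  exact: (E _ _ _ _ _ nzj nzj).
have E (x y z t : k) : x != 0 -> y != 0 ->
    y^-1 * z * (t + 0) = x^-1 * (y^-1 * (x * (z * t)) + 0).
  by move=> x0 y0; field; rewrite x0 y0.
exact: (E _ _ _ _ nzi nzj).
Qed.

Definition vac : W := fun w => (nilp w)%:R.

Lemma wE_vac i : wE i vac = 0. Proof. exact: funext. Qed.

Lemma wK_vac mu : wK mu vac = chi mu la *: vac.
Proof.
apply: funext => -[|j w]; rewrite /wK /vac /= fctE.
  by rewrite wt_nil subr0.
by rewrite mulr0 scaler0.
Qed.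

(** ** The submodule generated by the vacuum *)

Definition wFs I : W := foldr wF vac I.
(** On all functions the raising operators violate their Serre relations;
   the submodule generated by the indicator of the empty word satisfies
   them. *)
Definition word_span : set W := lin_span [set g | exists I, g = wFs I].

Fact word_subspace : is_subspace word_span. Proof. exact: lin_span_subspace. Qed.

Fact span_stable (T : W -> W) : linear T -> (forall I, word_span (T (wFs I))) ->
  forall f, word_span f -> word_span (T f).
Proof.
move=> Tl TI f; apply: (lin_span_min (P := [set f | word_span (T f)])).
  split=> [|t g h Pg Ph] /=; first by rewrite (lin0 Tl); exact: word_subspace.1.
  by rewrite Tl; exact: word_subspace.2.
by move=> _ [I ->]; exact: TI.
Qed.

Fact wF_stable i f : word_span f -> word_span (wF i f).
Proof.
by apply: span_stable; [exact: wF_linear|move=> I; apply: lin_span_gen; exists (i :: I)].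
Qed.

Fact wK_stable mu f : L mu -> word_span f -> word_span (wK mu f).
Proof.
move=> Lmu; apply: span_stable; first exact: wK_linear.
elim=> [|i I IH].
  by rewrite wK_vac; apply: (subspaceZ _ word_subspace); apply: lin_span_gen; exists [::].
by rewrite /= wKF // -(linZ (wF_linear i)); apply: wF_stable; apply: (subspaceZ _ word_subspace) => //.
Qed.

Fact wH_stable i f : word_span f -> word_span (wH i f).
Proof.
move=> Pf; have -> : wH i f = (qi q i - (qi q i)^-1)^-1 *: (wK (alpha i) f - wK (- alpha i) f).
  by [].
apply: (subspaceZ _ word_subspace); apply: (subspaceB word_subspace); apply: wK_stable => //.
  exact: La.
exact: (LN (La i)).
Qed.

Fact wE_stable i f : word_span f -> word_span (wE i f).
Proof.
apply: span_stable; first exact: wE_linear.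
elim=> [|j I IH]; first by rewrite wE_vac; exact: word_subspace.1.
rewrite /= wEF; apply: (subspaceD word_subspace); first exact: wF_stable.
case: ifP => _; last exact: word_subspace.1.
by apply: wH_stable; apply: lin_span_gen; exists I.
Qed.

Local Notation S := (subsp word_subspace).
Definition sv (x : S) : W := subsp_val x.

Fact sv_linear : linear sv. Proof. exact: subsp_val_linear. Qed.
Fact sv_inj x y : sv x = sv y -> x = y. Proof. exact: subsp_inj. Qed.

Definition svac : S := subsp_of word_subspace (lin_span_gen (ex_intro _ [::] erefl : [set g | exists I, g = wFs I] vac)).

Fact svacE : sv svac = vac. Proof. by []. Qed.

Fact svac_neq0 : svac != 0.
Proof.
apply/eqP => e; have /eqP : sv svac [::] = sv 0 [::] by rewrite e.
by rewrite svacE (lin0 sv_linear) /vac /= oner_eq0.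
Qed.

Let S_nz : exists x : S, x != 0. Proof. by exists svac; exact: svac_neq0. Qed.
Local Notation En := (endo S_nz).

Section Lift.
Variables (T : W -> W) (Tl : linear T) (Ts : forall f, word_span f -> word_span (T f)).

Definition lift_fun (x : S) : S := subsp_of word_subspace (Ts (subsp_valP x)).

Fact lift_funE x : sv (lift_fun x) = T (sv x). Proof. by []. Qed.

Fact lift_linear : linear lift_fun.
Proof. by move=> c x y; apply: sv_inj; rewrite sv_linear !lift_funE sv_linear Tl. Qed.

Definition lift : En := endo_of S_nz lift_linear.

Lemma liftE (x : S) : sv (lift x) = T (sv x). Proof. exact: lift_funE. Qed.
End Lift.

Definition eE i : En := lift (wE_linear i) (@wE_stable i).
Definition eF i : En := lift (wF_linear i) (@wF_stable i).
(** The identity is a default value outside the lattice; the relations only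
   concern weights of the lattice. *)
Definition eK mu : En := if pselect (L mu) is left Lmu
  then lift (wK_linear mu) (fun f => @wK_stable mu f Lmu) else 1.

Lemma sE i (x : S) : sv (eE i x) = wE i (sv x).
Proof. exact: (liftE (wE_linear i) (@wE_stable i)). Qed.

Lemma sF i (x : S) : sv (eF i x) = wF i (sv x).
Proof. exact: (liftE (wF_linear i) (@wF_stable i)). Qed.

Lemma sK mu (x : S) : L mu -> sv (eK mu x) = wK mu (sv x).
Proof. by move=> Lmu; rewrite /eK; case: pselect => // Lm; exact: liftE. Qed.

Lemma word_ind (Q : set S) : is_subspace Q -> Q svac -> (forall i x, Q x -> Q (eF i x)) ->
  forall x, Q x.
Proof.
move=> Qs Qv QF x.
pose R := [set f : W | exists2 y : S, Q y & f = sv y].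
have : R (sv x).
  apply: (lin_span_min (P := R) _ _ (subsp_valP x)).
    split; first by exists 0 => //; exact: Qs.1.
    move=> c f g [y Qy ->] [z Qz ->]; exists (c *: y + z) => //.
    exact: Qs.2.
  move=> _ [I ->]; elim: I => [|i I [y Qy yE]]; first by exists svac.
  by exists (eF i y); [exact: QF|rewrite sF /= yE].
by move=> [y Qy e]; have -> : x = y by exact: sv_inj.
Qed.

Fact eKF mu i : L mu -> eK mu * eF i = (chi mu (alpha i))^-1 *: (eF i * eK mu).
Proof.
move=> Lmu; apply: endoP => x; apply: sv_inj.
by rewrite endoZ !endoM sK // sF wKF // (linZ sv_linear) sF sK.
Qed.

Fact eKE mu i : L mu -> eK mu * eE i = chi mu (alpha i) *: (eE i * eK mu).
Proof.
move=> Lmu; apply: endoP => x; apply: sv_inj.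
by rewrite endoZ !endoM sK // sE wKE // (linZ sv_linear) sE sK.
Qed.

Fact eKD mu nu : L mu -> L nu -> eK (mu + nu) = eK mu * eK nu.
Proof.
move=> Lmu Lnu; apply: endoP => x; apply: sv_inj.
by rewrite endoM !sK ?wKD //; exact: LD.
Qed.

Fact eK0 : eK 0 = 1.
Proof. by apply: endoP => x; apply: sv_inj; rewrite sK ?wK0 ?endo1 //; exact: L0. Qed.

Fact eEF i j : eE i * eF j = eF j * eE i + (if i == j then
  (qi q i - (qi q i)^-1)^-1 *: (eK (alpha i) - eK (- alpha i)) else 0).
Proof.
have Li := La i; apply: endoP => x; apply: sv_inj.
rewrite endoM sE sF wEF endoD (linD sv_linear) endoM sF sE eq_sym; congr (_ + _).
case: eqP => [<-|_]; last by rewrite endo0 (lin0 sv_linear).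
by rewrite endoZ (linZ sv_linear) endoD endoN (linB sv_linear) !sK //; exact: LN.
Qed.

(** A Serre element of the lowering operators vanishes at the empty word,
   hence, commuting with the raising operators, at all words. *)
Fact eserre_F i j : i != j -> serre_lhs q eF i j = 0.
Proof.
move=> ij; set T := serre_lhs _ _ _ _.
have aY i' j' : eK (alpha i') * eF j' = (chi (alpha i') (alpha j'))^-1 *: (eF j' * eK (alpha i')).
  exact: (eKF j' (La i')).
have bY i' j' : eK (- alpha i') * eF j' = chi (alpha i') (alpha j') *: (eF j' * eK (- alpha i')).
  by rewrite (eKF j' (LN (La i'))) chiNl invrK.
have Tc l : eE l * T = T * eE l.
  exact: (serre_family_comm q_neq0 q_not_root eEF aY bY l ij).
have T0 (x : S) : sv (T x) [::] = 0.
  pose ev0 (f : En) : k^o := sv (f x) [::].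
  have evl : linear ev0.
    by move=> c f g; rewrite /ev0 endoD endoZ sv_linear.
  rewrite -[LHS]/(ev0 T) /T /serre_lhs (lin_sum evl) big1 // => r _.
  rewrite (linZ evl); set z := ev0 _; have -> : z = 0; last by rewrite scaler0.
  rewrite /z /ev0; case: (_ - r)%N => [|m]; first by rewrite expr0 mul1r endoM sF.
  by rewrite exprS -!mulrA endoM sF.
apply: endoP => x; apply: sv_inj; apply: funext => w.
rewrite endo0 (lin0 sv_linear).
elim: w x => [|l w IH] x; first exact: T0.
have -> : sv (T x) (l :: w) = wE l (sv (T x)) w by [].
by rewrite -sE -endoM Tc endoM IH.
Qed.

(** A Serre element of the raising operators kills the vacuum, hence,
   commuting with the lowering operators, the module it generates. *)
Fact eserre_E i j : i != j -> serre_lhs q eE i j = 0.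
Proof.
move=> ij; set T := serre_lhs _ _ _ _.
have XY i' j' : eF i' * eE j' = eE j' * eF i' + (if i' == j' then
    (qi q i' - (qi q i')^-1)^-1 *: (eK (- alpha i') - eK (alpha i')) else 0).
  rewrite eEF eq_sym -addrA; case: eqP => [->|_]; last by rewrite !addr0.
  by rewrite -scalerDr -[eK (- alpha j') - _]opprB subrr scaler0 addr0.
have aY i' j' : eK (- alpha i') * eE j' = (chi (alpha i') (alpha j'))^-1 *: (eE j' * eK (- alpha i')).
  by rewrite (eKE j' (LN (La i'))) chiNl.
have bY i' j' : eK (alpha i') * eE j' = chi (alpha i') (alpha j') *: (eE j' * eK (alpha i')).
  exact: (eKE j' (La i')).
have Tc l : eF l * T = T * eF l.
  exact: (serre_family_comm q_neq0 q_not_root XY aY bY l ij).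
have e0 l : eE l svac = 0 by apply: sv_inj; rewrite sE svacE wE_vac (lin0 sv_linear).
have f0 (f : En) : f 0 = 0 by exact: (lin0 (endo_linear f)).
apply: endoP => x; rewrite endo0; move: x; apply: (word_ind (Q := [set x | T x = 0])).
- split=> [|c x y Tx Ty]; first exact: f0.
  by rewrite /mkset (endo_linear T) Tx Ty scaler0 addr0.
- pose evv (f : En) : S := f svac.
  have evl : linear evv by move=> c f g; rewrite /evv endoD endoZ.
  rewrite /mkset -[LHS]/(evv T) /T /serre_lhs (lin_sum evl) big1 // => r _.
  rewrite (linZ evl); set z := evv _; have -> : z = 0; last by rewrite scaler0.
  rewrite /z /evv; case: r {z} => [|m]; first by rewrite mulr1 endoM e0 f0.
  by rewrite exprSr mulrA endoM e0 f0.
- move=> l x Tx; rewrite /mkset -endoM -Tc endoM.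
  by rewrite Tx f0.
Qed.

Lemma word_relations : uq_relations s eK eE eF.
Proof.
have inv mu : L mu -> eK mu * eK (- mu) = 1.
  by move=> Lmu; rewrite -eKD ?subrr ?eK0 //; exact: LN.
split.
- exact: eK0.
- exact: eKD.
- by move=> mu i Lmu; rewrite eKE // -scalerAl -mulrA inv // mulr1.
- by move=> mu i Lmu; rewrite eKF // -scalerAl -mulrA inv // mulr1 chiE_N chiNr.
- by move=> i j; rewrite eEF addrC addKr.
- exact: eserre_E.
- exact: eserre_F.
Qed.

Variable U : quantum_env s.

Definition word_rep : {lrmorphism U -> En} := sval (cid (qe_univ U word_relations)).

Fact word_repK mu : L mu -> word_rep (Kf U mu) = eK mu.
Proof. by rewrite /word_rep; case: cid => phi [? ? ? ?] /=; auto. Qed.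

Fact word_repE i : word_rep (Ef U i) = eE i.
Proof. by rewrite /word_rep; case: cid => phi [? ? ? ?] /=; auto. Qed.

Fact word_repF i : word_rep (Ff U i) = eF i.
Proof. by rewrite /word_rep; case: cid => phi [? ? ? ?] /=; auto. Qed.

Definition word_act (f : U) (x : S) : S := word_rep f x.

Fact word_act_linl x : linear (fun f => word_act f x).
Proof. by move=> c f g; rewrite /word_act linearP. Qed.

Fact word_act_linr f : linear (word_act f).
Proof. exact: endo_linear. Qed.

Fact word_act1 x : word_act 1 x = x.
Proof. by rewrite /word_act rmorph1. Qed.

Fact word_actM f g x : word_act (f * g) x = word_act f (word_act g x).
Proof. by rewrite /word_act rmorphM. Qed.

Definition word_module : uq_module U :=
  UqModule word_act_linl word_act_linr word_act1 word_actM.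

(** Vanishing on the words of length at least m. *)
Definition supported m (f : W) : Prop := forall w, (m <= size w)%N -> f w = 0.

Lemma wF_supported m i f : supported m f -> supported m.+1 (wF i f).
Proof.
move=> fm w; elim: w m f fm => [//|j w IH] m f fm le.
have H0 : wH i f w = 0 by rewrite /wH /wK (fm w) // !mulr0 subrr mulr0.
rewrite /= H0 if_same addr0; case: w IH le {H0} => [//|j' w] IH le.
apply: (IH m.-1); last by case: (m) le.
by move=> u lu; apply: fm => /=; case: (m) lu.
Qed.

Lemma word_supported (x : S) : exists m, supported m (sv x).
Proof.
move: x; apply: (word_ind (Q := [set x : S | exists m, supported m (sv x)])).
- split=> [|c x y [m xm] [n yn]]; first by exists 0%N => w _; rewrite (lin0 sv_linear).
  exists (maxn m n) => w; rewrite geq_max => /andP[mw nw].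
  have -> : sv (c *: x + y) w = c *: sv x w + sv y w by rewrite sv_linear.
  by rewrite xm // yn // scaler0 addr0.
- by exists 1%N => -[|i w].
- by move=> i x [m xm]; exists m.+1; rewrite sF; exact: wF_supported.
Qed.

(** A raising word of maximal length in the support of a nonzero element
   maps it to a nonzero multiple of the vacuum, which generates. *)
Lemma word_irreducible : irreducible word_module.
Proof.
split; first by exists svac; exact: svac_neq0.
move=> P Psub Pst.
have PE i (x : S) : P x -> P (eE i x).
  by move=> Px; have := Pst (Ef U i) x Px; rewrite /= /word_act word_repE.
have PF i (x : S) : P x -> P (eF i x).
  by move=> Px; have := Pst (Ff U i) x Px; rewrite /= /word_act word_repF.
have [[x Px x0]|no] := pselect (exists2 x : S, P x & x != 0); last first.
  left; apply/seteqP; split=> [x Px|x ->]; last exact: Psub.1.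
  by apply: contrapT => /eqP x0; apply: no; exists x.
right; apply/seteqP; split=> // z _; move: z; apply: word_ind => //.
have [m xm] := word_supported x.
have [w0 xw0] : exists w, sv x w != 0.
  apply: contrapT => H; case/eqP: x0; apply: sv_inj; apply: funext => w.
  rewrite (lin0 sv_linear).
  by apply: contrapT => e; apply: H; exists w; exact/eqP.
pose Pn n := `[< exists w, size w = n /\ sv x w != 0 >].
have exPn : exists n, Pn n by exists (size w0); apply/asboolP; exists w0.
have bPn n : Pn n -> (n <= m)%N.
  move=> /asboolP[w [<- xw]]; rewrite leqNgt; apply: contra xw => lt.
  by rewrite xm // ltnW.
(* A word w of maximal length in the support of x. *)
case: (ex_maxnP exPn bPn) => n /asboolP[w [wn xw]] maxw.
have shift u (y : S) : P y -> exists2 t : S, P t & forall v, sv t v = sv y (u ++ v).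
  elim: u y => [|i u IH] y Py; first by exists y.
  by have [t Pt tE] := IH _ (PE i y Py); exists t => // v; rewrite tE sE.
have [y Py yE] := shift w x Px.
have -> : svac = (sv x w : k)^-1 *: (y : S).
  apply: sv_inj; apply: funext => u; rewrite (linZ sv_linear) svacE.
  have E : vac u = (sv x w : k)^-1 * (sv y u : k); last exact: E.
  rewrite yE; case: u => [|i u]; first by rewrite cats0 mulVf.
  suff -> : sv x (w ++ i :: u) = 0 by rewrite mulr0.
  apply: contrapT => /eqP ne.
  have : (size (w ++ i :: u) <= n)%N by apply: maxw; apply/asboolP; exists (w ++ i :: u).
  by rewrite size_cat /= wn addnS ltnNge leq_addr.
exact: subspaceZ.
Qed.

Lemma word_highest : is_highest (V := word_module) la svac.
Proof.
split=> //; first exact: word_irreducible.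
- exact: svac_neq0.
- move=> i; rewrite /= /word_act word_repE; by apply: sv_inj; rewrite sE svacE wE_vac (lin0 sv_linear).
- move=> mu Lmu; rewrite /= /word_act word_repK //; apply: sv_inj.
  by rewrite sK // svacE wK_vac (linZ sv_linear) svacE.
Qed.

End WordModule.

Theorem corollary1 (R : realType) (G : semisimple_datum) (q : R[i])
    (q_neq0 : q != 0) (q_not_root : forall n : nat, (0 < n)%N -> q ^+ n != 1)
    (s : root_of_q G q) (U : quantum_env s) (A : quantum_coord U)
    (Rm : universal_R U) (r : A -> A -> R[i])
    (hr : is_standard_rform Rm r) :
  ~ (forall z : (U ⊗ U)%type,
       exists2 f : quantum_double r -> (R[i])^o,
         FRT_dual (qdouble_rform r) f &
         qdouble_iota f = env_functional2 A z).
Proof.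
move=> onto; have [M [rg [M_gt0 Lrg rgE]]] := regular_weight G.
have hw := word_highest q_neq0 q_not_root Lrg U.
have tV : type_L (word_module q_neq0 q_not_root Lrg U).
  have [_ irr v00 v0E v0w] := hw.
  exists rg; last by split=> //; exists (svac s rg).
  by split=> // i; rewrite rgE ler0n.
have [par [mu0 [parD L0 ne]]] := parity_exists q_neq0 q_not_root s M_gt0 Lrg rgE.
have [f Ff fE] := onto (Kf U mu0 ⊗ 1).
exact: (missed_tensor q_neq0 q_not_root M_gt0 Lrg rgE hr tV hw parD L0 ne Ff fE).
Qed.
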